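(* Let $n,m\in\mathbb{N}$. Then the Brinkmann Problem for all endomorphisms of $F_n\times\mathbb{Z}^m$ is decidable; that is, there is an algorithm which, given an endomorphism $\Phi\in\operatorname{End}(F_n\times\mathbb{Z}^m)$ and two elements $x,y\in F_n\times\mathbb{Z}^m$, decides whether there exists some $k\in\mathbb{N}$ such that $(x)\Phi^k=y$.
   Context: $\mathbb{N}=\{0,1,2,\dots\}$. $F_n$ denotes the free group of rank $n$ and $\mathbb{Z}^m$ the free-abelian group of rank $m$. The group $F_n\times\mathbb{Z}^m$ is given by the finite presentation $\langle x_1,\dots,x_n,t_1,\dots,t_m \mid t_it_j=t_jt_i,\ t_ix_k=x_kt_i,\ i,j\in[1,m],\ k\in[1,n]\rangle$. Elements are given to the algorithm as words in the generators (and inverses), and endomorphisms are given as the list of words representing the images of the generators. Homomorphisms act on the right: $(x)\Phi$ is the image of $x$ under $\Phi$, and $\Phi^k$ is the $k$-fold composition, with $\Phi^0=\mathrm{id}$. *)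

(* Defs.v *)
From HB Require Import structures.
From mathcomp Require Import all_boot generic_quotient.
From mathcomp Require Import boolp.

Set Implicit Arguments.
Unset Strict Implicit.
Unset Printing Implicit Defensive.

Local Open Scope quotient_scope.

(* The letter (i, false) stands for the i-th generator, (i, true) for its
   inverse. *)
Definition letter (r : nat) : Type := ('I_r * bool)%type.
Definition word (r : nat) : Type := seq (letter r).

Definition inv_letter r (a : letter r) : letter r := (a.1, ~~ a.2).
Definition inv_word r (w : word r) : word r := rev (map (@inv_letter r) w).

(* R u v is read as the defining relation u = v. *)
Inductive pres_eq r (R : word r -> word r -> Prop) : word r -> word r -> Prop :=
| pres_refl u : pres_eq R u u
| pres_sym u v : pres_eq R u v -> pres_eq R v u
| pres_trans u v w : pres_eq R u v -> pres_eq R v w -> pres_eq R u w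
| pres_cat u u' v v' :
    pres_eq R u u' -> pres_eq R v v' -> pres_eq R (u ++ v) (u' ++ v')
| pres_cancel a : pres_eq R [:: a; inv_letter a] [::]
| pres_rel u v : R u v -> pres_eq R u v.

Section PresentedGroup.
Variables (r : nat) (R : word r -> word r -> Prop).

Definition pres_eqb : rel (word r) := fun u v => `[< pres_eq R u v >].

Lemma pres_eqb_refl : reflexive pres_eqb.
Proof. by move=> u; apply/asboolP; apply: pres_refl. Qed.

Lemma pres_eqb_sym : symmetric pres_eqb.
Proof.
by move=> u v; apply/asboolP/asboolP => h; apply: pres_sym.
Qed.

Lemma pres_eqb_trans : transitive pres_eqb.
Proof.
by move=> v u w /asboolP uv /asboolP vw; apply/asboolP; apply: pres_trans vw.
Qed.

Canonical pres_equiv :=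
  EquivRel pres_eqb pres_eqb_refl pres_eqb_sym pres_eqb_trans.

Definition presented : Type := {eq_quot pres_equiv}.
HB.instance Definition _ := Choice.on presented.

Definition elt_of (w : word r) : presented := \pi_{eq_quot pres_equiv} w.
Definition word_of (g : presented) : word r :=
  repr (g : {eq_quot pres_equiv}).

Lemma word_ofK : cancel word_of elt_of.
Proof. by move=> g; rewrite /elt_of /word_of reprK. Qed.

Lemma elt_ofP u v : elt_of u = elt_of v <-> pres_eq R u v.
Proof.
split; first by move/eqmodP/asboolP.
by move=> h; apply/eqmodP/asboolP.
Qed.

Lemma word_of_elt u : pres_eq R (word_of (elt_of u)) u.
Proof. by apply/elt_ofP; rewrite word_ofK. Qed.

Definition pres_mul (g h : presented) := elt_of (word_of g ++ word_of h).
Definition pres_one : presented := elt_of [::].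
Definition pres_inv (g : presented) := elt_of (inv_word (word_of g)).

Lemma elt_of_cat u v : elt_of (u ++ v) = pres_mul (elt_of u) (elt_of v).
Proof.
by apply/elt_ofP/pres_sym; apply: pres_cat; apply: word_of_elt.
Qed.

Lemma inv_wordK : involutive (@inv_word r).
Proof.
move=> w; rewrite /inv_word map_rev revK -map_comp map_id_in //.
by case=> i b _; rewrite /= /inv_letter /= negbK.
Qed.

Lemma inv_word_cat u v : inv_word (u ++ v) = inv_word v ++ inv_word u :> word r.
Proof. by rewrite /inv_word map_cat rev_cat. Qed.

Lemma pres_catV w : pres_eq R (w ++ inv_word w) [::].
Proof.
elim: w => [|a w IHw]; first exact: pres_refl.
rewrite -cat1s inv_word_cat -catA (catA w).
apply: pres_trans (pres_cancel R a).
apply: (pres_cat (u' := [:: a]) (v' := [:: inv_letter a])).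
  exact: pres_refl.
by apply: (pres_cat IHw); apply: pres_refl.
Qed.

Lemma pres_Vcat w : pres_eq R (inv_word w ++ w) [::].
Proof. by have := pres_catV (inv_word w); rewrite inv_wordK. Qed.

Lemma pres_mulA : associative pres_mul.
Proof.
move=> f g h; rewrite -(word_ofK f) -(word_ofK g) -(word_ofK h).
by rewrite -!elt_of_cat catA.
Qed.

Lemma pres_mul1 : left_id pres_one pres_mul.
Proof. by move=> g; rewrite -(word_ofK g) -elt_of_cat. Qed.

Lemma pres_mulr1 : right_id pres_one pres_mul.
Proof. by move=> g; rewrite -(word_ofK g) -elt_of_cat cats0. Qed.

Lemma pres_mulV : left_inverse pres_one pres_inv pres_mul.
Proof.
move=> g; rewrite -{2}(word_ofK g) -elt_of_cat.
exact/elt_ofP/pres_Vcat.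
Qed.

Lemma pres_mulrV : right_inverse pres_one pres_inv pres_mul.
Proof.
move=> g; rewrite -{1}(word_ofK g) -elt_of_cat.
exact/elt_ofP/pres_catV.
Qed.

HB.instance Definition _ := isGroup.Build presented
  pres_mulA pres_mul1 pres_mulr1 pres_mulV pres_mulrV.

End PresentedGroup.

Definition x_gen n m (k : 'I_n) : letter (n + m) := (lshift m k, false).
Definition t_gen n m (i : 'I_m) : letter (n + m) := (rshift n i, false).

Inductive FZ_rel n m : word (n + m) -> word (n + m) -> Prop :=
| FZ_tt (i j : 'I_m) :
    FZ_rel [:: t_gen n i; t_gen n j] [:: t_gen n j; t_gen n i]
| FZ_tx (i : 'I_m) (k : 'I_n) :
    FZ_rel [:: t_gen n i; x_gen m k] [:: x_gen m k; t_gen n i].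

(* The group F_n x Z^m, through its standard presentation. *)
Definition FZ (n m : nat) : groupType := presented (@FZ_rel n m).
Definition FZ_elt n m (w : word (n + m)) : FZ n m := elt_of (@FZ_rel n m) w.

(* [ws] lists words for the images of x_1, ..., x_n, t_1, ..., t_m. *)
Definition represents n m (ws : (n + m).-tuple (word (n + m)))
    (Phi : {multiplicative FZ n m -> FZ n m}) : Prop :=
  forall i : 'I_(n + m), FZ_elt (tnth ws i) = Phi (FZ_elt [:: (i, false)]).

(* Partial recursive functions of n arguments on the natural numbers. *)
Inductive recfun : nat -> Type :=
| Rzero n : recfun n
| Rsucc : recfun 1
| Rproj n (i : 'I_n) : recfun n
| Rcomp n k (f : recfun k) (gs : 'I_k -> recfun n) : recfun n
| Rprim n (f : recfun n) (g : recfun n.+2) : recfun n.+1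
| Rmin n (f : recfun n.+1) : recfun n.

(* [computes f v r] : f is defined at v, with value r. In [Rprim f g] the
   recursion is on the first argument, g receives the predecessor and then the
   previous value; [Rmin f] searches for the least first argument of f. *)
Fixpoint computes n (f : recfun n) : n.-tuple nat -> nat -> Prop :=
  match f in recfun n return n.-tuple nat -> nat -> Prop with
  | Rzero _ => fun _ r => r = 0
  | Rsucc => fun v r => r = (tnth v ord0).+1
  | Rproj _ i => fun v r => r = tnth v i
  | Rcomp _ k f gs => fun v r =>
      exists2 w : k.-tuple nat,
        forall i, computes (gs i) v (tnth w i) & computes f w r
  | Rprim _ f g => fun v r =>
      exists h : nat -> nat,
        [/\ computes f (behead_tuple v) (h 0),
            forall i, i < thead v ->
              computes g [tuple of i :: h i :: behead_tuple v] (h i.+1)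
          & r = h (thead v)]
  | Rmin _ f => fun v r =>
      computes f [tuple of r :: v] 0 /\
      forall i, i < r -> exists s, computes f [tuple of i :: v] s.+1
  end.

Lemma computes_fun n (f : recfun n) v r s :
  computes f v r -> computes f v s -> r = s.
Proof.
elim: f v r s => /= [{}n|||{}n k f IHf gs IHgs|{}n f IHf g IHg|{}n f IHf] v r s.
- by move=> -> ->.
- by move=> -> ->.
- by move=> ? ? -> ->.
- move=> [w1 gw1 fw1] [w2 gw2 fw2]; apply: IHf fw1 _.
  suff -> : w1 = w2 by [].
  by apply: eq_from_tnth => i; apply: IHgs (gw1 i) (gw2 i).
- move=> [h1 [f1 g1 ->]] [h2 [f2 g2 ->]].
  suff: forall i, i <= thead v -> h1 i = h2 i by apply.
  elim=> [_|i IHi lti]; first exact: IHf f1 f2.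
  move: (g1 _ lti) (g2 _ lti); rewrite (IHi (ltnW lti)); exact: IHg.
move=> [fr0 fr] [fs0 fs]; case: (ltngtP r s) => // lt.
  by have [q /IHf/(_ fr0)] := fs _ lt.
by have [q /IHf/(_ fs0)] := fr _ lt.
Qed.

(* Goedel numbers: the letter (i, b) is coded by 2 i + b, and sequences by the
   bijection [CodeSeq.code : seq nat -> nat]. *)
Definition code_letter r (a : letter r) : nat := a.1.*2 + a.2.
Definition code_word r (w : word r) : nat :=
  CodeSeq.code [seq code_letter a | a <- w].
Definition code_words r (ws : seq (word r)) : nat :=
  CodeSeq.code [seq code_word w | w <- ws].

(* Main.v *)
Require Import Defs.
From mathcomp Require Import all_boot.
From HB Require Import structures.
From mathcomp Require Import all_order perm all_algebra all_field.
From mathcomp Require Import boolp zify ring.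

(* An endomorphism Phi acts on the integer-valued polynomial functions of degree
   less than c on G = F_n x Z^m by an integer matrix, so that (x)Phi^k = y becomes a
   linear orbit problem s B^k = w at each level c, and the levels separate points.

   If w is not periodic under B, then k is explicitly bounded: for e a multiple of the
   exponents of the finite monoid of matrices mod 7, B^(2e) - B^e is divisible by 7; when
   k is large, the eigenvalues of B^e on the span of the orbit of s have modulus at most 2,
   so those of (B^(2e) - B^e) / 7 are algebraic integers of modulus less than 1, hence 0;
   then B^e is unipotent on the tail of the orbit, which grows at least linearly.

   A common period: let Phi^M be idempotent on H_1 mod 3 and mod 5.  If y is periodic at
   level c, some q-th power of Phi^M, with q a power of p = 3 (resp. 5), is the identity
   mod p along the orbit of y; iterated q-th differences are then divisible by p^i and
   bounded by 2^i r, and bounded, so they vanish, and y is fixed by Phi^M at level c.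
   Thus either y is fixed by Phi^M, or an explicit level c at which y differs from
   (y)Phi^M bounds k.

   If y is fixed by Phi^M, the kernels of the powers of Phi matter: they are stable from an
   explicit power on, because a non-injective restriction of an endomorphism of a free
   group to a finitely generated subgroup lowers the rank (Nielsen-Schreier, and free
   groups are Hopfian).

   Hence it is enough to test the k below a bound computed from the input. *)
Set Implicit Arguments.
Unset Strict Implicit.
Unset Printing Implicit Defensive.
Import Order.TTheory GRing.Theory Num.Theory.

(** * Linear orbits *)

Local Open Scope ring_scope.

(** The level c that tells y from (y)Phi^M is computed from the length of a word for (y)Phi^M, so M
    must be known before c: an exponent read off from the action at level c would be circular. Hence
    M depends on n + m only. A single prime p gives no more than a period p^c in powers of Phi^M;
    two are used because 3^c and 5^c are coprime. Both exceed 2, so that p^i outgrows the bound 2^i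
    r on i-th differences. The prime 7 exceeds 2^2 + 2, a bound on |a^(2e) - a^e| when |a^e| is at
    most 2.

    When y is fixed by Phi^M, no level bounds k. Then y has a preimage y' under Phi^L inside its own
    cycle, and for a suitable j < M the elements (x)Phi^j and y' have the same image under some
    power of Phi. If the kernels of the powers are stable from L on, these elements already agree
    after L steps, so that an exponent below L + M reaches y. *)

(** The orbit of [x] enters its cycle after at most [#|T|] steps; the factorial is at least that
    large and is a multiple of the length of the cycle. *)
Lemma iter_fact (T : finType) (g : T -> T) (x : T) :
  iter (2 * #|T|`!) g x = iter #|T|`! g x.
Proof.
have [i [j [ltij lej eqij]]] : exists i j : nat,
    [/\ (i < j)%N, (j <= #|T|)%N & iter i g x = iter j g x].
  have : ~~ injectiveb (fun i : 'I_#|T|.+1 => iter i g x).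
    apply/negP => /injectiveP/leq_card.
    by rewrite card_ord ltnn.
  case/injectivePn => i [j neij eqij].
  wlog ltij : i j neij eqij / (i < j)%N.
    move=> W; case: (ltngtP i j) => [lt|lt|/val_inj eq].
    - exact: W lt.
    - by apply: (W j i) lt; rewrite 1?eq_sym.
    - by rewrite eq eqxx in neij.
  by exists i, j; split; rewrite // -ltnS.
have per q k : (i <= k)%N -> iter (k + q * (j - i)) g x = iter k g x.
  elim: q => [|q IHq] leik; first by rewrite mul0n addn0.
  rewrite mulSn addnCA iterD IHq // -iterD.
  have -> : ((j - i + k) = (k - i) + j)%N by lia.
  by rewrite iterD -eqij -iterD subnK.
have [q Dq] : exists q, (#|T|`! = q * (j - i))%N.
  by apply/dvdnP/dvdn_fact; lia.
rewrite mul2n -addnn {1}Dq addnC per // (leq_trans _ (fact_geq _)) //.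
exact: leq_trans (ltnW ltij) lej.
Qed.

(** Up to sign, the product of the nonzero eigenvalues is the lowest nonzero coefficient of the
    characteristic polynomial: a rational algebraic integer, hence a nonzero integer. If the product
    were nonempty, its modulus would be less than 1. *)
Lemma small_nilpotent d (E : 'M[rat]_d.+1) :
  (forall z : algC, eigenvalue (map_mx ratr E) z -> z \in Aint /\ `|z| < 1) ->
  E ^+ d.+1 = 0.
Proof.
move=> smallE.
pose p := char_poly (map_mx (ratr : rat -> algC) E).
have Dp : p = map_poly ratr (char_poly E) by rewrite /p -map_char_poly.
have [rs] := closed_field_poly_normal p.
rewrite (monicP (char_poly_monic _)) scale1r => Drs.
have rsE z : z \in rs -> z \in Aint /\ `|z| < 1.
  move=> zrs; apply: smallE.
  by rewrite eigenvalue_root_char -/p Drs root_prod_XsubC.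
pose ns := [seq z <- rs | z != 0].
have Dp2 : p = 'X ^+ (count (pred1 0) rs) * \prod_(z <- ns) ('X - z%:P).
  rewrite Drs (bigID (pred1 0)) /=; congr (_ * _); last by rewrite big_filter.
  rewrite (eq_bigr (fun=> 'X)) => [|z /= /eqP->]; last by rewrite subr0.
  by rewrite big_const_seq; elim: (count _ _) => //= k ->; rewrite exprS.
have c0 : p`_(count (pred1 0) rs) = \prod_(z <- ns) (- z).
  rewrite Dp2 coefXnM ltnn subnn -horner_coef0 horner_prod.
  by apply: eq_bigr => z _; rewrite hornerXsubC sub0r.
have ns0 : ns = [::].
  case Dns: ns => [//|z0 s].
  have cint : p`_(count (pred1 0) rs) \in Num.int.
    apply: Cint_rat_Aint; first by rewrite Dp coef_map Crat_rat.
    rewrite c0 big_seq; apply: rpred_prod => z; rewrite mem_filter => /andP[_ zrs].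
    by rewrite rpredN; case: (rsE _ zrs).
  have c_neq0 : p`_(count (pred1 0) rs) != 0.
    rewrite c0 prodf_seq_neq0; apply/allP => z.
    by rewrite mem_filter /= oppr_eq0 => /andP[].
  have := norm_intr_ge1 cint c_neq0; rewrite c0.
  rewrite real_leNgt ?num_real ?normr_real //.
  suff -> : `|\prod_(z <- ns) (- z)| < 1 by [].
  have nsE : all (fun z => `|z| < 1) (z0 :: s).
    by apply/allP => z; rewrite -Dns mem_filter => /andP[_ /rsE[]].
  rewrite Dns; elim: s z0 nsE {Dns} => [|z1 s IHs] z0 /= /andP[z0E sE].
    by rewrite big_seq1 normrN.
  rewrite big_cons normrM normrN.
  by apply: mulr_ilt1; rewrite ?normr_ge0 // IHs.
have Dc : char_poly E = 'X^(d.+1).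
  apply: (map_inj_poly (fmorph_inj (ratr : rat -> algC)) (rmorph0 _)).
  rewrite -Dp Dp2 ns0 big_nil mulr1 map_polyXn.
  have: size p = d.+2 by rewrite size_char_poly.
  by rewrite Dp2 ns0 big_nil mulr1 size_polyXn => -[->].
have := Cayley_Hamilton E; rewrite Dc.
by rewrite rmorphXn /= horner_mx_X.
Qed.

(** * Explicit bounds on eigenvalues *)

Lemma det_bound n (A : 'M[int]_n) (r : nat) :
  (forall i j, `|A i j| <= r%:Z) -> `|\det A| <= (n`! * r ^ n)%:Z.
Proof.
move=> Ar; rewrite /determinant; apply: le_trans (ler_norm_sum _ _ _) _.
have -> : (n`! * r ^ n)%:Z = \sum_(s : 'S_n) (r ^ n)%:Z.
  by rewrite sumr_const card_Sn PoszM -mulr_natl natz.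
apply: ler_sum => s _; rewrite normrM normrX normrN normr1 expr1n mul1r normr_prod.
have -> : (r ^ n)%:Z = \prod_(i < n) r%:Z by rewrite prodr_const card_ord -natz natrX natz.
by apply: ler_prod => i _; rewrite normr_ge0 Ar.
Qed.

Lemma adj_bound n (A : 'M[int]_n) (r : nat) : (0 < r)%N ->
  (forall i j, `|A i j| <= r%:Z) ->
  forall i j, `|(\adj A) i j| <= (n`! * r ^ n)%:Z.
Proof.
move=> r0 Ar i j; rewrite mxE /cofactor normrM normrX normrN normr1 expr1n mul1r.
apply: (@le_trans _ _ (n.-1`! * r ^ n.-1)%:Z).
  by apply: det_bound => a b; rewrite !mxE.
case: n A Ar i j => [|n] A Ar i j; first by case: i.
rewrite lez_nat leq_mul //= ?leq_pexp2l //.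
by rewrite factS leq_pmull.
Qed.

Lemma eigenvalue_Aint n (A : 'M[int]_n) (z : algC) :
  eigenvalue (map_mx intr A) z -> z \in Aint.
Proof.
rewrite eigenvalue_root_char -map_char_poly => zr.
apply: root_monic_Aint zr _ _; first by rewrite monic_map ?char_poly_monic.
by apply/polyOverP => i; rewrite coef_map intr_int.
Qed.

(** Apply the linear factors one after another: the last nonzero vector is an eigenvector. *)
Lemma eigenvector_factor (F : fieldType) n (A : 'M[F]_n.+1) (v : 'rV_n.+1) rs :
  v != 0 -> v *m horner_mx A (\prod_(x <- rs) ('X - x%:P)) = 0 ->
  exists2 x, x \in rs & exists2 z : 'rV_n.+1, z != 0 & z *m A = x *: z.
Proof.
elim: rs v => [|x rs IHrs] v v0.
  by rewrite big_nil rmorph1 mulmx1 => v0'; rewrite v0' eqxx in v0.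
rewrite big_cons rmorphM /= -mulmxE mulmxA.
case: (eqVneq (v *m horner_mx A ('X - x%:P)) 0) => [vx0 _|vx0].
  exists x; first exact: mem_head.
  exists v => //; move: vx0; rewrite rmorphB /= horner_mx_X horner_mx_C mulmxBr.
  by rewrite mul_mx_scalar => /subr0_eq.
by case/(IHrs _ vx0) => y yrs zP; exists y => //; rewrite inE yrs orbT.
Qed.

Section Krylov.
Variables (n : nat) (B : 'M[int]_n) (s : 'rV[int]_n).

Definition krylov d : 'M[int]_(d, n) := \matrix_(i < d, j < n) (s *m B ^+ i) 0 j.

Lemma row_krylov d i : row i (krylov d) = s *m B ^+ i.
Proof. by apply/rowP => j; rewrite !mxE. Qed.

Definition krylovQ d : 'M[rat]_(d, n) := map_mx intr (krylov d).

(** For the largest [d] with independent rows, s B^d depends on the earlier vectors, so their span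
    is stable under [B]; [A] is the matrix of [B] on it. *)
Lemma krylov_basis : exists2 d, (d <= n)%N & row_free (krylovQ d) /\
  (exists A : 'M[rat]_d, krylovQ d *m map_mx intr B = A *m krylovQ d) /\
  (map_mx intr s <= krylovQ d)%MS.
Proof.
pose P d := row_free (krylovQ d).
have P0 : exists d, P d by exists 0%N; rewrite /P /row_free -leqn0 rank_leq_row.
have Pn d : P d -> (d <= n)%N by rewrite /P /row_free => /eqP <-; apply: rank_leq_col.
case: (ex_maxnP P0 Pn) => d Pd maxd; exists d; first exact: Pn.
split=> //.
have rowQ k i : row i (krylovQ k) = map_mx intr (s *m B ^+ i).
  by rewrite -map_row row_krylov.
have sub1 : (krylovQ d.+1 <= krylovQ d)%MS.
  have sub : (krylovQ d <= krylovQ d.+1)%MS.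
    apply/row_subP => i; have -> : row i (krylovQ d) = row (widen_ord (leqnSn d) i) (krylovQ d.+1).
      by rewrite !rowQ.
    exact: row_sub.
  rewrite -(mxrank_leqif_sup sub) eqn_leq mxrankS //=.
  move: Pd; rewrite /P /row_free => /eqP ->.
  have: ~~ P d.+1 by apply/negP => /maxd; rewrite ltnn.
  rewrite /P /row_free => ne; rewrite -ltnS ltn_neqAle ne; exact: rank_leq_row.
split.
  have : (krylovQ d *m map_mx intr B <= krylovQ d)%MS.
    apply: submx_trans sub1; apply/row_subP => i; rewrite row_mul rowQ -map_mxM.
    rewrite -mulmxA mulmxE -exprSr.
    have -> : map_mx intr (s *m B ^+ i.+1) = row (lift ord0 i) (krylovQ d.+1) :> 'rV[rat]_n.
      by rewrite rowQ.
    exact: row_sub.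
  by case/submxP => A ->; exists A.
apply: submx_trans sub1.
have -> : map_mx intr s = row ord0 (krylovQ d.+1) :> 'rV[rat]_n by rewrite rowQ mulmx1.
exact: row_sub.
Qed.

End Krylov.

Definition spectral_bound (n r : nat) : nat := (n * (n * (r * (n`! * r ^ n))))%N.

(** Select columns where [N] has an invertible minor M. Cramer's rule gives b det(M) z = z P with P
    an integer matrix of bounded entries; compare at the largest coordinate of [z], the nonzero
    integer det(M) having modulus at least 1. In the application [N] and [N'] hold the orbit before
    and after k steps, and [b] is the k-th power of an eigenvalue. *)
Lemma eigenvalue_bound n d (N N' : 'M[int]_(d.+1, n)) (r : nat) (b : algC) (z : 'rV[algC]_d.+1) :
  (0 < r)%N -> row_free (map_mx intr N : 'M[rat]_(_, _)) ->
  (forall i j, `|N i j| <= r%:Z) -> (forall i j, `|N' i j| <= r%:Z) ->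
  z != 0 -> b *: (z *m map_mx intr N) = z *m map_mx intr N' ->
  `|b| <= (spectral_bound d.+1 r)%:R.
Proof.
move=> r0 Nfree Nr N'r z0 Dz.
have fullT : row_full (map_mx intr N^T : 'M[rat]_(_, _)).
  by rewrite -map_trmx /row_full mxrank_tr.
pose f := fullrankfun fullT.
pose M : 'M[int]_d.+1 := rowsub f N^T.
pose M' : 'M[int]_d.+1 := rowsub f N'^T.
have Mu : (map_mx intr M : 'M[rat]_d.+1) \in unitmx.
  have -> : map_mx intr M = rowsub f (map_mx intr N^T) :> 'M[rat]_d.+1.
    by apply/matrixP => i j; rewrite !mxE.
  by rewrite -row_full_unit; apply: fullrowsub_full.
have detM : \det M != 0.
  by move: Mu; rewrite unitmxE det_map_mx unitfE intr_eq0.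
pose P := M' ^T *m \adj M^T.
have Dz2 : (b * (\det M)%:~R) *: z = z *m map_mx intr P.
  rewrite /P map_mxM /= mulmxA.
  have -> : z *m map_mx intr M'^T = b *: (z *m map_mx intr M^T).
    have sub (X : 'M[int]_(d.+1, n)) :
        z *m map_mx intr (rowsub f X^T)^T = colsub f (z *m map_mx intr X).
      apply/rowP => j; rewrite !mxE; apply: eq_bigr => i _; by rewrite !mxE.
    rewrite !sub -Dz; apply/rowP => j; by rewrite !mxE.
  rewrite -scalemxAl -mulmxA -map_mxM mul_mx_adj det_tr map_scalar_mx mul_mx_scalar.
  by rewrite scalerA.
have Pb i j : `|P i j| <= (d.+1 * (r * (d.+1`! * r ^ d.+1)))%:Z.
  rewrite mxE; apply: le_trans (ler_norm_sum _ _ _) _.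
  set t := (r * _)%N.
  have -> : (d.+1 * t)%:Z = \sum_(k < d.+1) t%:Z.
    by rewrite sumr_const card_ord PoszM -mulr_natl natz.
  apply: ler_sum => k _; rewrite normrM /t PoszM.
  apply: ler_pM; rewrite ?normr_ge0 //; first by rewrite !mxE.
  by apply: adj_bound => // i' j'; rewrite !mxE.
have [j zmax] : exists j, forall i, `|z 0 i| <= `|z 0 j|.
  have [j _ jP] := @real_arg_maxP algC 'I_d.+1 ord0 xpredT (fun i => `|z 0 i|) isT
    (fun i _ => normr_real _).
  by exists j => i; apply: jP.
have zj0 : 0 < `|z 0 j|.
  rewrite normr_gt0; apply: contraNneq z0 => zj0; apply/eqP/rowP => i; rewrite mxE.
  by apply/eqP; rewrite -normr_eq0 eq_le normr_ge0 andbT (le_trans (zmax i)) // zj0 normr0.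
rewrite -(ler_pM2r zj0); apply: le_trans (_ : `|(b * (\det M)%:~R) * z 0 j| <= _).
  rewrite !normrM ler_wpM2r ?normr_ge0 // ler_peMr ?normr_ge0 //.
  by rewrite norm_intr_ge1 ?intr_int // intr_eq0.
move/rowP/(_ j): Dz2; rewrite mxE => ->; rewrite mxE.
apply: le_trans (ler_norm_sum _ _ _) _.
rewrite /spectral_bound natrM -mulrA mulr_natl.
set t := _ * `|z 0 j|.
have -> : t *+ d.+1 = \sum_(i < d.+1) t by rewrite sumr_const card_ord.
apply: ler_sum => i _; rewrite normrM mulrC.
apply: ler_pM; rewrite ?normr_ge0 ?zmax // mxE -intr_norm.
by rewrite [leRHS]pmulrn ler_int; exact: Pb.
Qed.

Lemma spectral_boundS d n r : (0 < r)%N -> (d <= n)%N ->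
  (spectral_bound d r <= spectral_bound n r)%N.
Proof.
move=> r0 ledn; rewrite /spectral_bound !leq_mul //.
  by rewrite leq_fact.
exact: leq_pexp2l.
Qed.

(** For a prime p, [p ^ (n * n)] is the number of square matrices of size n over the field with p
    elements. *)
Definition idem_exp (p n : nat) := (p ^ (n * n))`!.

Lemma fact_dvd a b : (a <= b)%N -> (a`! %| b`!)%N.
Proof. by move=> leab; rewrite -(bin_fact leab) mulnCA dvdn_mulr. Qed.

(** The factorial attached to [b] is a multiple of the one attached to any prime [p <= b], so a
    single exponent serves both 3 and 5. *)
Lemma idem_mod p b n (B : 'M[int]_n) : prime p -> (p <= b)%N ->
  exists E : 'M[int]_n,
    B ^+ (2 * idem_exp b n) - B ^+ idem_exp b n = p%:Z *: E.
Proof.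
move=> p_pr lepb.
have idem : map_mx (intr : int -> 'F_p) (B ^+ (2 * idem_exp b n)) =
            map_mx intr (B ^+ idem_exp b n).
  have expE k : map_mx (intr : int -> 'F_p) (B ^+ k) = iter k (mulmx (map_mx intr B)) 1%:M.
    elim: k => [|k IHk]; first by rewrite expr0 /= map_mx1.
    by rewrite exprS -mulmxE map_mxM /= IHk.
  have := iter_fact (mulmx (map_mx intr B : 'M['F_p]_n)) 1%:M.
  rewrite card_mx card_Fp // -!expE => idem.
  have /dvdnP[q Dq] : ((p ^ (n * n))`! %| idem_exp b n)%N.
    by apply: fact_dvd; case: (n * n)%N => // k; rewrite leq_exp2r.
  have mulexp k l : map_mx intr (B ^+ k) = map_mx intr (B ^+ l) :> 'M['F_p]_n ->
      map_mx intr (B ^+ (q * k)) = map_mx intr (B ^+ (q * l)) :> 'M['F_p]_n.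
    move=> kl; elim: q {Dq} => [|q IHq]; first by rewrite !mul0n.
    by rewrite !mulSn !exprD -!mulmxE !map_mxM /= IHq kl.
  by rewrite Dq mulnCA; apply: mulexp.
exists (\matrix_(i, j) (((B ^+ (2 * idem_exp b n) - B ^+ idem_exp b n) i j) %/ p)%Z).
apply/matrixP => i j; rewrite [RHS]mxE [X in _ * X]mxE mulrC divzK //.
move/matrixP/(_ i j): idem; rewrite [LHS]mxE [RHS]mxE => /eqP.
rewrite -subr_eq0 -intrB -(dvdz_pcharf (pchar_Fp p_pr)).
by rewrite !mxE.
Qed.

(** Bounds on the first few vectors of the orbit and of its k-th translate suffice, since a Krylov
    basis of [s] has at most n vectors. *)
Lemma nilpotent_of_bounded n (B : 'M[int]_n) (s : 'rV[int]_n) (r k : nat) :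
  let e := idem_exp 7 n in
  (forall i j, (i <= n)%N -> `|(s *m B ^+ i) 0 j| <= r%:Z) ->
  (forall i j, (i <= n)%N -> `|(s *m B ^+ (k + i)) 0 j| <= r%:Z) ->
  (0 < r)%N -> (e * spectral_bound n r <= k)%N ->
  s *m (B ^+ (2 * e) - B ^+ e) ^+ n = 0.
Proof.
move=> e sr wr r0 lek.
have [d ledn [Nfree [[A DA] sN]]] := krylov_basis B s.
have e0 : (0 < e)%N by rewrite fact_gt0.
case: d => [|d] in ledn A DA Nfree sN *.
  have s0 : map_mx intr s = 0 :> 'rV[rat]_n.
    by case/submxP: sN => D ->; apply/rowP => j; rewrite mxE big_ord0 mxE.
  have -> : s = 0.
    by apply/rowP => j; move/rowP/(_ j): s0; rewrite !mxE => /eqP; rewrite intr_eq0 => /eqP.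
  by rewrite mul0mx.
set N := krylovQ B s d.+1 in DA Nfree sN.
pose qr : {rmorphism rat -> algC} := ratr.
have qrZ m p (M : 'M[int]_(m, p)) : map_mx qr (map_mx intr M) = map_mx intr M.
  by apply/matrixP => i j; rewrite !mxE rmorph_int.
have qr7 : qr 7%:R^-1 = 7%:R^-1 by rewrite fmorphV rmorph_nat.
have powA i : A ^+ i *m N = N *m map_mx intr (B ^+ i).
  elim: i => [|i IHi]; first by rewrite !expr0 map_mx1 mulmx1 mul1mx.
  by rewrite exprSr -mulmxE -mulmxA -DA mulmxA IHi exprSr -mulmxE map_mxM mulmxA.
have [E DE] := @idem_mod 7 7 n B isT isT; rewrite -/e in DE.
pose EA := 7%:R^-1 *: (A ^+ (2 * e) - A ^+ e).
have EAN : EA *m N = N *m map_mx intr E.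
  rewrite /EA -scalemxAl mulmxBl !powA -mulmxBr.
  have -> : map_mx intr (B ^+ (2 * e)) - map_mx intr (B ^+ e) =
     7%:R *: map_mx intr E :> 'M[rat]_n.
    rewrite -map_mxB DE; apply/matrixP => i j; rewrite !mxE; exact: (intrM _ 7).
  by rewrite -scalemxAr scalerA mulVf ?scale1r.
have EA0 : EA ^+ d.+1 = 0.
  apply: small_nilpotent => g /eigenvalueP[v Dv v0].
  (* Factoring [q], which annihilates [v] through [A], yields an eigenvalue [a] of [A] with g =
     (a^(2e) - a^e) / 7. *)
  pose q : {poly algC} := 7%:R^-1 *: ('X^(2 * e) - 'X^e) - g%:P.
  have hornq M : horner_mx M q = 7%:R^-1 *: (M ^+ (2 * e) - M ^+ e) - g%:M :> 'M[algC]_d.+1.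
    by rewrite /q rmorphB /= horner_mx_C linearZ /= rmorphB /= !rmorphXn /= horner_mx_X.
  have vq : v *m horner_mx (map_mx qr A) q = 0.
    rewrite hornq mulmxBr mul_mx_scalar -Dv; apply/eqP; rewrite subr_eq0; apply/eqP.
    congr (_ *m _); rewrite /EA map_mxZ qr7 map_mxB !rmorphXn //.
  have q0 : q != 0.
    apply/negP => /eqP q0.
    have : q`_(2 * e) = 7%:R^-1.
      rewrite /q coefB coefZ coefB !coefXn coefC eqxx.
      have -> : (2 * e == e)%N = false by apply/eqP; lia.
      have -> : (2 * e == 0)%N = false by apply/eqP; lia.
      by rewrite !subr0 mulr1.
    by rewrite q0 coef0 => /esym/eqP; rewrite invr_eq0 pnatr_eq0.
  have [rs Drs] := closed_field_poly_normal q.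
  have [|a ars [z z0 Dz]] := @eigenvector_factor _ _ (map_mx qr A) v rs v0.
    move: vq; rewrite Drs linearZ /= -scalemxAr => /eqP.
    by rewrite scaler_eq0 lead_coef_eq0 (negPf q0) => /eqP.
  have qa : q.[a] = 0.
    have /rootP ra : root (\prod_(x <- rs) ('X - x%:P)) a.
      by rewrite root_prod_XsubC; exact: ars.
    by rewrite Drs hornerZ ra mulr0.
  have Dg : g = 7%:R^-1 * (a ^+ (2 * e) - a ^+ e).
    by apply/esym/eqP; rewrite -subr_eq0 -qa /q !hornerE.
  pose zN := z *m map_mx qr N.
  have zN0 : zN != 0.
    have /row_freeP[M NM] : row_free (map_mx qr N) by rewrite /row_free mxrank_map.
    apply: contraNneq z0 => zN0.
    by rewrite -[z]mulmx1 -NM mulmxA -/zN zN0 mul0mx.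
  have powz i : z *m (map_mx qr A) ^+ i = a ^+ i *: z.
    elim: i => [|i IHi]; first by rewrite !expr0 mulmx1 scale1r.
    by rewrite exprSr -mulmxE mulmxA IHi -scalemxAl Dz scalerA -exprSr.
  (* Through [N], [g] is also an eigenvalue of the integer matrix [E], hence an algebraic
     integer. *)
  have zE : zN *m map_mx intr E = g *: zN.
    rewrite /zN -mulmxA -qrZ -map_mxM -EAN map_mxM mulmxA.
    rewrite {1}/EA map_mxZ qr7 map_mxB !rmorphXn -scalemxAr mulmxBr !powz.
    by rewrite -scalerBl scalerA -Dg -scalemxAl.
  have gA : g \in Aint by apply: (@eigenvalue_Aint _ E); apply/eigenvalueP; exists zN.
  split=> //.
  pose H := spectral_bound n r.
  have aH : `|a ^+ k| <= H%:R.
    apply: le_trans (_ : (spectral_bound d.+1 r)%:R <= _); last first.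
      by rewrite ler_nat spectral_boundS.
    apply: (@eigenvalue_bound _ _ (krylov B s d.+1) (krylov B (s *m B ^+ k) d.+1) r _ z) => //.
    - by move=> i j; rewrite mxE; apply: sr; have := ltn_ord i; lia.
    - move=> i j; rewrite mxE -mulmxA mulmxE -exprD; apply: wr; have := ltn_ord i; lia.
    rewrite scalemxAl -powz -mulmxA; congr (_ *m _).
    rewrite -qrZ -[krylov _ _ _ in RHS]/_ -qrZ -rmorphXn -map_mxM powA.
    congr map_mx; apply/row_matrixP => i.
    rewrite /N /krylovQ -map_mxM -!map_row row_mul !row_krylov.
    by rewrite -!mulmxA !mulmxE -!exprD addnC.
  (* Otherwise |a^k| is at least 2^H > H, because k is at least e H. *)
  have ae : `|a ^+ e| <= 2%:R.
    rewrite real_leNgt ?normr_real ?realn //; apply/negP => a2.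
    have a1 : 1 <= `|a|.
      rewrite real_leNgt ?normr_real ?real1 //; apply/negP => a1.
      suff: `|a ^+ e| <= 1 by move/(lt_le_trans a2); rewrite (ltr_nat _ 2 1).
      by rewrite normrX exprn_ile1 ?normr_ge0 // ltW.
    have : H.+1%:R <= `|a ^+ k|.
      rewrite normrX; apply: le_trans (_ : `|a| ^+ (e * H) <= _); last first.
        by rewrite ler_weXn2l.
      rewrite exprM -normrX; apply: le_trans (_ : 2%:R ^+ H <= _).
        by rewrite -natrX ler_nat ltn_expl.
      by rewrite lerXn2r ?nnegrE ?normr_ge0 ?ler0n // ltW.
    by move/le_trans/(_ aH); rewrite ler_nat ltnn.
  rewrite Dg normrM normfV normr_nat mulrC ltr_pdivrMr ?ltr0n // mul1r.
  rewrite (le_lt_trans (ler_normB _ _)) //.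
  apply: le_lt_trans (_ : _ <= 4%:R + 2%:R) _; last by rewrite -natrD ltr_nat.
  apply: lerD => //; rewrite mulnC exprM normrX.
  have -> : 4%:R = 2%:R ^+ 2 :> algC by rewrite -natrX.
  by rewrite lerXn2r ?nnegrE ?normr_ge0 ?ler0n.
have AN0 : (A ^+ (2 * e) - A ^+ e) ^+ d.+1 = 0.
  have -> : A ^+ (2 * e) - A ^+ e = 7%:R *: EA by rewrite /EA scalerA divff ?scale1r.
  by rewrite exprZn EA0 scaler0.
have powD i : (A ^+ (2 * e) - A ^+ e) ^+ i *m N = N *m map_mx intr ((B ^+ (2 * e) - B ^+ e) ^+ i).
  elim: i => [|i IHi]; first by rewrite !expr0 map_mx1 mulmx1 mul1mx.
  rewrite exprSr -mulmxE -mulmxA mulmxBl !powA -mulmxBr mulmxA IHi exprSr -mulmxE map_mxM map_mxB.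
  by rewrite mulmxA.
have sd : s *m (B ^+ (2 * e) - B ^+ e) ^+ d.+1 = 0.
  have : map_mx intr (s *m (B ^+ (2 * e) - B ^+ e) ^+ d.+1) = 0 :> 'rV[rat]_n.
    rewrite map_mxM; case/submxP: sN => t ->.
    by rewrite -mulmxA -powD AN0 mul0mx mulmx0.
  move/rowP => s0; apply/rowP => j; move: (s0 j); rewrite !mxE => /eqP.
  by rewrite intr_eq0 => /eqP.
have -> : (B ^+ (2 * e) - B ^+ e) ^+ n =
    (B ^+ (2 * e) - B ^+ e) ^+ d.+1 *m (B ^+ (2 * e) - B ^+ e) ^+ (n - d.+1).
  by rewrite mulmxE -exprD subnKC.
by rewrite mulmxA sd mul0mx.
Qed.

Lemma diff_bound n (B : 'M[int]_n) (s : 'rV[int]_n) (r e t : nat) i l j :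
  (forall l j, (l <= t)%N -> `|(s *m B ^+ l) 0 j| <= r%:Z) ->
  (l + e * i <= t)%N ->
  `|(s *m (B ^+ e - 1) ^+ i *m B ^+ l) 0 j| <= (2 ^ i * r)%:Z.
Proof.
move=> sr; elim: i l => [|i IHi] l let_.
  by rewrite expr0 mulmx1 mul1n; apply: sr; lia.
have -> : s *m (B ^+ e - 1) ^+ i.+1 *m B ^+ l =
    s *m (B ^+ e - 1) ^+ i *m B ^+ (l + e) - s *m (B ^+ e - 1) ^+ i *m B ^+ l.
  rewrite exprSr -mulmxE mulmxA mulmxBr mulmx1 mulmxBl -[_ *m B ^+ e *m _]mulmxA.
  by rewrite mulmxE -exprD addnC.
rewrite mxE [X in _ + X]mxE; apply: le_trans (ler_normB _ _) _.
have -> : (2 ^ i.+1 * r)%:Z = (2 ^ i * r)%:Z + (2 ^ i * r)%:Z by rewrite expnS; lia.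
by apply: lerD; apply: IHi; lia.
Qed.

(** In units of e: [n] steps absorb the nilpotent part, [2 + 2 ^ n.+1 * r] more let linear growth
    exceed the entries of the orbit, and [spectral_bound] is what [nilpotent_of_bounded] asks
    for. *)
Definition orbit_bound (n r : nat) : nat :=
  let e := idem_exp 7 n in
  (e * (n + 2 + 2 ^ n.+1 * r + spectral_bound n r))%N.

Definition orbit_range (n : nat) : nat := (2 * idem_exp 7 n * n + idem_exp 7 n + n)%N.

Lemma bounded_hit n (B : 'M[int]_n) (s w : 'rV[int]_n) (r k : nat) :
  (0 < r)%N ->
  (forall i j, (i <= orbit_range n)%N -> `|(s *m B ^+ i) 0 j| <= r%:Z) ->
  (forall i j, (i <= orbit_range n)%N -> `|(w *m B ^+ i) 0 j| <= r%:Z) ->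
  s *m B ^+ k = w -> (orbit_bound n r <= k)%N ->
  exists2 e, (0 < e)%N & w *m B ^+ e = w.
Proof.
rewrite /orbit_bound /orbit_range; set e := idem_exp 7 n => r0 sr wr Dw lek.
have e0 : (0 < e)%N by rewrite fact_gt0.
exists e => //.
have len : (n <= 2 * e * n + e + n)%N by lia.
have nil : s *m (B ^+ (2 * e) - B ^+ e) ^+ n = 0.
  apply: (@nilpotent_of_bounded _ _ _ r k) => //.
  - by move=> i j lei; apply: sr; apply: leq_trans len.
  - move=> i j lei; rewrite exprD -mulmxE mulmxA Dw; apply: wr; exact: leq_trans len.
  by apply: leq_trans lek; rewrite -/e leq_mul2l; apply/orP; right; lia.
pose Z := B ^+ e - 1.
have lek2 : (e * n <= k)%N by apply: leq_trans lek; rewrite leq_mul2l; apply/orP; right; lia.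
pose q := ((k - e * n) %/ e)%N; pose j0 := ((k - e * n) %% e)%N.
have Dk : k = (e * n + j0 + e * q)%N.
  by rewrite /q /j0 [X in (_ + X)%N]mulnC -addnA [X in (_ + X)%N]addnC -divn_eq subnKC.
have ltj0 : (j0 < e)%N by rewrite ltn_mod.
have leq_q : (2 ^ n.+1 * r + 2 <= q)%N.
  rewrite /q leq_divRL // -(leq_add2r (e * n)) subnK //; apply: leq_trans lek.
  by rewrite mulnC -mulnDr leq_mul2l; apply/orP; right; lia.
have commBZ i l : Z ^+ i *m B ^+ l = B ^+ l *m Z ^+ i.
  rewrite mulmxE; apply: commrX; apply: commr_sym; apply: commrX.
  by apply: commrB; [apply: commrX | apply: commr1].
(* After e n steps [Z] is nilpotent on the orbit, since B^(2e) - B^e = B^e Z; the offset [j0] leaves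
   a multiple of e to go. *)
pose s2 := s *m B ^+ (e * n + j0).
pose u i := s2 *m Z ^+ i.
have un : u n = 0.
  rewrite /u /s2 -mulmxA -commBZ exprD -mulmxE !mulmxA -[s *m _ *m _]mulmxA commBZ mulmxA.
  have -> : s *m B ^+ (e * n) *m Z ^+ n = s *m (B ^+ (2 * e) - B ^+ e) ^+ n.
    have -> : B ^+ (2 * e) - B ^+ e = B ^+ e * Z by rewrite mulrBr mulr1 -exprD mul2n addnn.
    rewrite exprMn_comm; last first.
      by apply: commrB; [ | apply: commr1].
    by rewrite -exprM -mulmxE mulmxA.
  by rewrite nil mul0mx.
have Dw2 i : u i *m B ^+ (e * q) = w *m Z ^+ i.
  by rewrite /u -mulmxA commBZ mulmxA /s2 -[s *m _ *m _]mulmxA mulmxE -exprD -Dk -Dw.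
have exu : exists i, u i == 0 by exists n; apply/eqP.
(* If [u 0] or [u 1] vanishes, [w] is fixed by B^e. Otherwise u_i B^(eq) = u_i + q u_(i+1) for the
   last two nonzero terms, and q is too large for the bounds on [w] and [s]. *)
case: (ex_minnP exu) => -[|[|i]] /eqP ui0 min_i.
- have w0 : w = 0 by have := Dw2 0%N; rewrite ui0 mul0mx expr0 mulmx1.
  by rewrite w0 mul0mx.
- have := Dw2 1%N; rewrite ui0 mul0mx expr1 mulmxBr mulmx1 => /esym/eqP.
  by rewrite subr_eq0 => /eqP.
have lein : (i.+2 <= n)%N by apply: min_i; apply/eqP.
have ui1 : u i.+1 != 0 by apply/negP => /min_i; rewrite ltnn.
have uS l : u l *m B ^+ e = u l + u l.+1.
  have -> : B ^+ e = 1 + Z by rewrite /Z addrC subrK.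
  by rewrite mulmxDr mulmx1 /u -mulmxA mulmxE -exprSr.
have ui1q p : u i.+1 *m B ^+ (e * p) = u i.+1.
  elim: p => [|p IHp]; first by rewrite muln0 expr0 mulmx1.
  by rewrite mulnS exprD -mulmxE mulmxA uS ui0 addr0 IHp.
have uiq p : u i *m B ^+ (e * p) = u i + u i.+1 *+ p.
  elim: p => [|p IHp]; first by rewrite muln0 expr0 mulmx1 addr0.
  by rewrite mulnS exprD -mulmxE mulmxA uS mulmxDl IHp ui1q -addrA -mulrSr.
have [j uj0] : exists j, u i.+1 0 j != 0.
  case/rV0Pn: ui1 => j uj; by exists j.
have b1 : `|(w *m Z ^+ i) 0 j| <= (2 ^ i * r)%:Z.
  have := @diff_bound n B w r e (2 * e * n + e + n) i 0 j wr.
  by rewrite expr0 mulmx1; apply; nia.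
have b2 : `|(u i) 0 j| <= (2 ^ i * r)%:Z.
  rewrite /u /s2 -mulmxA -commBZ mulmxA.
  by apply: diff_bound sr _; nia.
move: (Dw2 i); rewrite uiq => /rowP/(_ j); rewrite mxE => Dj.
have Dq : u i.+1 0 j * q%:Z = (w *m Z ^+ i) 0 j - (u i) 0 j.
  rewrite -Dj; have -> : (u i.+1 *+ q) 0 j = u i.+1 0 j * q%:Z.
    rewrite -(natz q) mulr_natr; elim: (q) => [|p IHp]; first by rewrite !mulr0n mxE.
    by rewrite !mulrS mxE IHp.
  by rewrite [RHS]addrC addrA addNr add0r.
have qle : q%:Z <= (2 ^ i * r)%:Z + (2 ^ i * r)%:Z.
  apply: le_trans (_ : `|u i.+1 0 j * q%:Z| <= _).
    rewrite normrM; have : 1 <= `|u i.+1 0 j| by lia.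
    by move=> h; rewrite [leRHS]mulrC ler_peMr //; lia.
  by rewrite Dq; apply: le_trans (ler_normB _ _) _; apply: lerD.
have : (2 ^ i * r <= 2 ^ n * r)%N by rewrite leq_mul2r leq_pexp2l ?orbT //; lia.
move: leq_q; rewrite expnS; move: qle; move: (2 ^ i)%N (2 ^ n)%N => x y.
nia.
Qed.

Local Close Scope ring_scope.

(** * Recursive functions on codes of words *)

Definition computable n (F : n.-tuple nat -> nat) : Prop :=
  exists f : recfun n, forall v, computes f v (F v).

Section Closure.
Variable n : nat.
Implicit Types F G A B Z : n.-tuple nat -> nat.

Lemma computable_ext F G : F =1 G -> computable F -> computable G.
Proof. by move=> FG [f fP]; exists f => v; rewrite -FG. Qed.

Lemma computable_proj i : computable (fun v : n.-tuple nat => tnth v i).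
Proof. by exists (Rproj i) => v. Qed.

Lemma computable_comp k (H : k.-tuple nat -> nat) (V : n.-tuple nat -> k.-tuple nat) :
  computable H -> (forall i, computable (fun v => tnth (V v) i)) ->
  computable (fun v => H (V v)).
Proof.
move=> [h hP] cV.
have [gs gsP] := choice cV.
exists (Rcomp h gs) => v /=; exists (V v); last exact: hP.
by move=> i; apply: gsP.
Qed.

Lemma computable0 : computable (fun _ : n.-tuple nat => 0).
Proof. by exists (Rzero n). Qed.

Lemma computableS F : computable F -> computable (fun v => (F v).+1).
Proof.
move=> cF; apply: (@computable_comp 1 (fun u => (thead u).+1) (fun v => [tuple F v])).
  by exists Rsucc => v; rewrite /= /thead.
by move=> i; rewrite ord1; apply: computable_ext cF => v.
Qed.

Lemma computable_const c : computable (fun _ : n.-tuple nat => c).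
Proof. by elim: c => [|c IHc]; [exact: computable0 | exact: computableS]. Qed.

Lemma computable_behead (F : n.-tuple nat -> nat) :
  computable F -> computable (fun v : n.+1.-tuple nat => F (behead_tuple v)).
Proof.
move=> [f fP]; exists (Rcomp f (fun i => Rproj (lift ord0 i))) => v /=.
exists (behead_tuple v) => // i; case/tupleP: v => x t; rewrite tnthS.
by congr tnth; apply: val_inj.
Qed.

End Closure.

(** The last hypothesis follows the convention of [Rprim], whose step function receives the index,
    then the previous value, then the parameters. *)
Lemma computable_iteri n (A Z : n.-tuple nat -> nat) (G : nat -> nat -> n.-tuple nat -> nat) :
  computable A -> computable Z ->
  computable (fun u : n.+2.-tuple nat =>
    G (thead u) (thead (behead_tuple u)) (behead_tuple (behead_tuple u))) ->
  computable (fun v => iteri (A v) (fun i acc => G i acc v) (Z v)).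
Proof.
move=> cA [z zP] [g gP].
have H : computable (fun u : n.+1.-tuple nat =>
    iteri (thead u) (fun i acc => G i acc (behead_tuple u)) (Z (behead_tuple u))).
  exists (Rprim z g) => u /=.
  exists (fun k => iteri k (fun i acc => G i acc (behead_tuple u)) (Z (behead_tuple u))).
  split=> // i _.
  set acc := iteri i _ _.
  have E : behead_tuple (behead_tuple [tuple of i :: acc :: behead_tuple u]) = behead_tuple u by apply: val_inj.
  by move: (gP [tuple of i :: acc :: behead_tuple u]); rewrite E.
apply: (computable_ext (F := fun v =>
    iteri (thead [tuple of A v :: v]) (fun i acc => G i acc (behead_tuple [tuple of A v :: v]))
      (Z (behead_tuple [tuple of A v :: v])))).
  by move=> v; rewrite theadE; have -> : behead_tuple [tuple of A v :: v] = v by apply: val_inj.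
apply: (computable_comp (V := fun v => [tuple of A v :: v]) H).
move=> i; case: (unliftP ord0 i) => [j|] ->.
  by apply: computable_ext (computable_proj j) => v; rewrite tnthS.
by apply: computable_ext cA => v; rewrite tnth0.
Qed.

Lemma computable_thead n : computable (fun u : n.+1.-tuple nat => thead u).
Proof. exact: computable_proj. Qed.

Lemma computable_thead2 n : computable (fun u : n.+2.-tuple nat => thead (behead_tuple u)).
Proof. exact: (computable_behead (@computable_thead _)). Qed.

Lemma computable_behead2 n (F : n.-tuple nat -> nat) : computable F ->
  computable (fun u : n.+2.-tuple nat => F (behead_tuple (behead_tuple u))).
Proof. by move=> cF; exact: (computable_behead (computable_behead cF)). Qed.

Lemma computable_add n (F G : n.-tuple nat -> nat) :
  computable F -> computable G -> computable (fun v => F v + G v).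
Proof.
move=> cF cG.
apply: computable_ext (computable_iteri (G := fun _ acc _ => acc.+1) cF cG _).
  by move=> v; elim: (F v) => //= k ->.
exact: (computableS (@computable_thead2 _)).
Qed.

Lemma computable_mul n (F G : n.-tuple nat -> nat) :
  computable F -> computable G -> computable (fun v => F v * G v).
Proof.
move=> cF cG.
apply: computable_ext (computable_iteri (G := fun _ acc v => G v + acc) cF (computable0 _) _).
  by move=> v; elim: (F v) => //= k ->; rewrite mulSn.
exact: (computable_add (computable_behead2 cG) (@computable_thead2 _)).
Qed.

Lemma computable_pred n (F : n.-tuple nat -> nat) :
  computable F -> computable (fun v => (F v).-1).
Proof.
move=> cF.
apply: computable_ext (computable_iteri (G := fun i _ _ => i) cF (computable0 _) _).
  by move=> v; case: (F v).
exact: computable_thead.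
Qed.

Lemma computable_sub n (F G : n.-tuple nat -> nat) :
  computable F -> computable G -> computable (fun v => F v - G v).
Proof.
move=> cF cG.
apply: computable_ext (computable_iteri (G := fun _ acc _ => acc.-1) cG cF _).
  by move=> v; elim: (G v) => /= [|k ->]; rewrite ?subn0 // subnS.
exact: (computable_pred (@computable_thead2 _)).
Qed.

Lemma computable_exp n (F G : n.-tuple nat -> nat) :
  computable F -> computable G -> computable (fun v => F v ^ G v).
Proof.
move=> cF cG.
apply: computable_ext (computable_iteri (G := fun _ acc v => F v * acc) cG (computable_const _ 1) _).
  by move=> v; elim: (G v) => //= k ->; rewrite expnS.
exact: (computable_mul (computable_behead2 cF) (@computable_thead2 _)).
Qed.

Lemma computable_fact n (F : n.-tuple nat -> nat) :
  computable F -> computable (fun v => (F v)`!).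
Proof.
move=> cF.
apply: computable_ext (computable_iteri (G := fun i acc _ => i.+1 * acc) cF (computable_const _ 1) _).
  by move=> v; elim: (F v) => //= k ->; rewrite factS.
exact: (computable_mul (computableS (@computable_thead _)) (@computable_thead2 _)).
Qed.

Definition computableb n (P : n.-tuple nat -> bool) := computable (fun v => P v : nat).

Lemma computable_if n (P : n.-tuple nat -> bool) (F G : n.-tuple nat -> nat) :
  computableb P -> computable F -> computable G -> computable (fun v => if P v then F v else G v).
Proof.
move=> cP cF cG.
apply: computable_ext (computable_add (computable_mul cP cF) (computable_mul (computable_sub (computable_const _ 1) cP) cG)).
by move=> v; case: (P v); rewrite ?mul1n ?mul0n ?addn0 ?add0n.
Qed.

Lemma computable_leq n (F G : n.-tuple nat -> nat) :
  computable F -> computable G -> computableb (fun v => F v <= G v).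
Proof.
move=> cF cG.
apply: computable_ext (computable_sub (computable_const _ 1) (computable_sub cF cG)) => v.
by rewrite /leq; case: (F v - G v).
Qed.

Lemma computable_andb n (P Q : n.-tuple nat -> bool) :
  computableb P -> computableb Q -> computableb (fun v => P v && Q v).
Proof.
move=> cP cQ; apply: computable_ext (computable_mul cP cQ) => v.
by case: (P v); rewrite ?mul1n.
Qed.

Lemma computable_negb n (P : n.-tuple nat -> bool) :
  computableb P -> computableb (fun v => ~~ P v).
Proof.
move=> cP; apply: computable_ext (computable_sub (computable_const _ 1) cP) => v.
by case: (P v).
Qed.

Lemma computable_eq n (F G : n.-tuple nat -> nat) :
  computable F -> computable G -> computableb (fun v => F v == G v).
Proof.
move=> cF cG.
apply: computable_ext (computable_andb (computable_leq cF cG) (computable_leq cG cF)) => v.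
by rewrite eqn_leq.
Qed.

Lemma computable_sum n (A : n.-tuple nat -> nat) (G : nat -> n.-tuple nat -> nat) :
  computable A -> computable (fun u : n.+1.-tuple nat => G (thead u) (behead_tuple u)) ->
  computable (fun v => \sum_(i < A v) G i v).
Proof.
move=> cA cG.
apply: computable_ext (computable_iteri (G := fun i acc v => acc + G i v) cA (computable0 _) _).
  by move=> v; elim: (A v) => [|k IHk] /=; rewrite ?big_ord0 // big_ord_recr /= IHk.
apply: computable_add (@computable_thead2 _) _.
apply: computable_ext (computable_comp (V := fun u : n.+2.-tuple nat =>
  [tuple of thead u :: behead_tuple (behead_tuple u)]) cG _).
  by move=> u; rewrite theadE; congr G; apply: val_inj.
move=> i; case: (unliftP ord0 i) => [j|] ->.
  apply: computable_ext (computable_behead2 (computable_proj j)) => v; by rewrite tnthS.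
by apply: computable_ext (@computable_thead _) => v; rewrite tnth0.
Qed.

Lemma computable_has n (A : n.-tuple nat -> nat) (P : nat -> n.-tuple nat -> bool) :
  computable A -> computableb (fun u : n.+1.-tuple nat => P (thead u) (behead_tuple u)) ->
  computableb (fun v => has (fun i => P i v) (iota 0 (A v))).
Proof.
move=> cA cP.
apply: computable_ext (computable_negb (computable_eq (computable_sum (G := fun i v => P i v) cA cP) (computable0 _))) => v.
rewrite has_count -lt0n -sum1_count big_mkcond /=.
have -> : iota 0 (A v) = index_iota 0 (A v) by rewrite /index_iota subn0.
rewrite big_mkord.
have -> : \sum_(i < A v) P i v = \sum_(i < A v) (if P i v then 1 else 0).
  by apply: eq_bigr => i _; case: (P i v).
by rewrite -big_mkcond.
Qed.

Lemma computable_iter n (A Z : n.-tuple nat -> nat) (g : nat -> n.-tuple nat -> nat) :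
  computable A -> computable Z ->
  computable (fun u : n.+1.-tuple nat => g (thead u) (behead_tuple u)) ->
  computable (fun v => iter (A v) (g^~ v) (Z v)).
Proof.
move=> cA cZ cg.
apply: computable_ext (computable_iteri (G := fun i acc v => g acc v) cA cZ _).
  by move=> v; elim: (A v) => //= k ->.
exact: (computable_behead cg).
Qed.

(** The quotient counts the positive multiples of the divisor up to [F v]; writing the divisor as a
    successor keeps it nonzero. *)
Lemma computable_div n (F G : n.-tuple nat -> nat) :
  computable F -> computable G -> computable (fun v => F v %/ (G v).+1).
Proof.
move=> cF cG.
have cS : computable (fun v => \sum_(i < F v) (i.+1 * (G v).+1 <= F v : nat)).
  apply: (computable_sum (G := fun i v => i.+1 * (G v).+1 <= F v : nat)) => //.
  apply: computable_leq; last exact: computable_behead.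
  apply: computable_mul; first exact: computableS (@computable_thead _).
  exact: computable_behead (computableS cG).
apply: computable_ext cS => v; set a := F v; set d := (G v).+1.
rewrite (eq_bigr (fun i : 'I_a => (i < a %/ d : nat))); last first.
  by move=> i _; rewrite -leq_divRL.
have : a %/ d <= a by exact: leq_div.
move: (a %/ d) => q; elim: a => [|a IHa]; first by rewrite big_ord0; case: q.
rewrite big_ord_recr /= leq_eqVlt => /orP[/eqP->|]; last first.
  by rewrite ltnS => leqa; rewrite IHa // ltnNge leqa addn0.
by rewrite ltnS leqnn (eq_bigr (fun=> 1)) => [|i _]; rewrite ?sum1_card ?card_ord ?addn1 // ltnS ltnW.
Qed.

Lemma computable_dvd_exp2 n (F G : n.-tuple nat -> nat) :
  computable F -> computable G -> computableb (fun v => 2 ^ G v %| F v).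
Proof.
move=> cF cG.
have cD : computable (fun v => 2 ^ G v) by exact: (computable_exp (computable_const _ 2) cG).
apply: computable_ext (computable_eq (computable_mul (computable_div cF (computable_pred cD)) cD) cF) => v.
by rewrite prednK ?expn_gt0 // dvdn_eq.
Qed.


(* On a code [2 ^ x * (2 * c + 1)] of [x :: s], the head is the 2-adic valuation [x]
   and the tail [s] has code [c]. *)
Definition code_head (c : nat) : nat := \sum_(i < c) (2 ^ i.+1 %| c : nat).
Definition code_tail (c : nat) : nat := (c %/ 2 ^ code_head c) %/ 2.
Definition code_cons (x c : nat) : nat := 2 ^ x * c.*2.+1.

Lemma code_headE s : code_head (CodeSeq.code s) = head 0 s.
Proof.
case: s => [|x s]; first by rewrite /code_head /= big_ord0.
rewrite /code_head /=; set c := 2 ^ x * _.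
(* The sum up to [c] sees the whole valuation, as x < 2^x <= c. *)
have ltx : x < c by rewrite /c -[x.+1]muln1 leq_mul // ltn_expl.
rewrite (eq_bigr (fun i : 'I_c => (i < x : nat))).
  have : x <= c by exact: ltnW.
  move: (c) => q; elim: q => [|q IHq]; first by rewrite big_ord0; case: (x).
  rewrite big_ord_recr /= leq_eqVlt => /orP[/eqP->|]; last first.
    by rewrite ltnS => lexq; rewrite IHq // ltnNge lexq addn0.
  by rewrite ltnS leqnn (eq_bigr (fun=> 1)) => [|i _]; rewrite ?sum1_card ?card_ord ?addn1 // ltnS ltnW.
move=> i _; congr nat_of_bool; rewrite /c.
case: (leqP i.+1 x) => lix; first by rewrite dvdn_mulr // dvdn_exp2l.
rewrite -(subnKC lix) addSn -addnS expnD.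
rewrite dvdn_pmul2l ?expn_gt0 //; apply/negP => h.
have /= : 2 %| (CodeSeq.code s).*2.+1 by apply: dvdn_trans h; rewrite expnS dvdn_mulr.
by rewrite dvdn2 /= odd_double.
Qed.

Lemma code_tailE s : code_tail (CodeSeq.code s) = CodeSeq.code (behead s).
Proof.
rewrite /code_tail code_headE; case: s => //= x s.
by rewrite mulKn ?expn_gt0 // divn2 /= uphalf_double.
Qed.

Lemma computable_code_head n (F : n.-tuple nat -> nat) :
  computable F -> computable (fun v => code_head (F v)).
Proof.
move=> cF; apply: (computable_sum (G := fun i v => 2 ^ i.+1 %| F v : nat)) => //.
by apply: computable_dvd_exp2; [exact: computable_behead | exact: computableS (@computable_thead _)].
Qed.

Lemma computable_code_tail n (F : n.-tuple nat -> nat) :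
  computable F -> computable (fun v => code_tail (F v)).
Proof.
move=> cF.
have cD : computable (fun v => (2 ^ code_head (F v)).-1).
  by apply/computable_pred/computable_exp; [exact: computable_const | exact: computable_code_head].
apply: computable_ext (computable_div (computable_div cF cD) (computable_const _ 1)) => v.
by rewrite prednK ?expn_gt0.
Qed.

Lemma computable_code_cons n (F G : n.-tuple nat -> nat) :
  computable F -> computable G -> computable (fun v => code_cons (F v) (G v)).
Proof.
move=> cF cG.
apply: computable_ext (computable_mul (computable_exp (computable_const _ 2) cF)
  (computableS (computable_add cG cG))) => v.
by rewrite /code_cons addnn.
Qed.

Lemma size_code s : size s <= CodeSeq.code s.
Proof.
elim: s => //= x s IHs; apply: leq_trans (_ : 1 * (CodeSeq.code s).*2.+1 <= _).
  by rewrite mul1n ltnS; apply: leq_trans IHs _; rewrite -addnn leq_addr.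
by rewrite leq_mul2r expn_gt0 orbT.
Qed.

(** A code is at least the length of its sequence, so [L v] rounds are enough; once the remaining
    code is 0 the sequence is exhausted and the accumulator stays put. *)
Lemma computable_foldl n (L Z : n.-tuple nat -> nat) (G : nat -> nat -> n.-tuple nat -> nat) :
  computable L -> computable Z ->
  computable (fun u : n.+2.-tuple nat =>
    G (thead u) (thead (behead_tuple u)) (behead_tuple (behead_tuple u))) ->
  computable (fun v => foldl (fun acc a => G acc a v) (Z v) (CodeSeq.decode (L v))).
Proof.
move=> cL cZ cG.
pose rest i c := iter i code_tail c.
have cI : computable (fun v => iteri (L v) (fun i acc =>
    if rest i (L v) == 0 then acc else G acc (code_head (rest i (L v))) v) (Z v)).
  apply: (computable_iteri (G := fun i acc v =>
    if rest i (L v) == 0 then acc else G acc (code_head (rest i (L v))) v)) => //.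
  have cr : computable (fun u : n.+2.-tuple nat =>
      rest (thead u) (L (behead_tuple (behead_tuple u)))).
    apply: (computable_iter (g := fun c _ => code_tail c)).
    - exact: computable_thead.
    - exact: computable_behead2.
    - exact: computable_code_tail (@computable_thead _).
  apply: computable_if; first by apply: computable_eq => //; exact: computable0.
    exact: computable_thead2.
  apply: computable_ext (computable_comp (V := fun u : n.+2.-tuple nat =>
    [tuple of thead (behead_tuple u) ::
       code_head (rest (thead u) (L (behead_tuple (behead_tuple u)))) ::
       behead_tuple (behead_tuple u)]) cG _).
    by move=> u; congr G; apply: val_inj.
  move=> i; case: (unliftP ord0 i) => [j|] ->.
    case: (unliftP ord0 j) => [k|] ->.
      by apply: computable_ext (computable_behead2 (computable_proj k)) => v; rewrite !tnthS.
    by apply: computable_ext (computable_code_head cr) => v; rewrite tnthS tnth0.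
  by apply: computable_ext (@computable_thead2 _) => v; rewrite tnth0.
apply: computable_ext cI => v.
rewrite -{1 2 3}(CodeSeq.decodeK (L v)); move: (CodeSeq.decode (L v)) => s.
have resti i : rest i (CodeSeq.code s) = CodeSeq.code (drop i s).
  elim: i => [|i IHi] /=; first by rewrite drop0.
  by rewrite /rest /= -/(rest i _) IHi code_tailE -drop1 drop_drop add1n.
have foldi i : iteri i (fun i acc => if rest i (CodeSeq.code s) == 0 then acc
     else G acc (code_head (rest i (CodeSeq.code s))) v) (Z v) =
     foldl (fun acc a => G acc a v) (Z v) (take i s).
  elim: i => [|i IHi]; first by rewrite take0.
  rewrite /= IHi resti code_headE.
  case: (ltnP i (size s)) => lis.
    rewrite (take_nth 0) // foldl_rcons (drop_nth 0) //=.
    by rewrite muln_eq0 expn_eq0.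
  by rewrite drop_oversize //= !take_oversize // ltnW.
by rewrite foldi take_oversize ?size_code.
Qed.

Lemma computable_half n (F : n.-tuple nat -> nat) : computable F -> computable (fun v => (F v)./2).
Proof.
move=> cF; apply: computable_ext (computable_div cF (computable_const _ 1)) => v.
by rewrite divn2.
Qed.

Lemma computable_odd n (F : n.-tuple nat -> nat) : computable F -> computableb (fun v => odd (F v)).
Proof.
move=> cF; apply: computable_ext (computable_sub cF (computable_add (computable_half cF) (computable_half cF))) => v.
by rewrite addnn -{1}(odd_double_half (F v)) addnK.
Qed.

(** * Substitution and free reduction on codes *)

Section WordOps.
Variable r : nat.
Implicit Types (w u : word r) (a : letter r).

Definition subst (ws : 'I_r -> word r) w : word r :=
  flatten [seq (if a.2 then inv_word (ws a.1) else ws a.1) | a <- w].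

(* A stack: the reduced form of [filter p w], read backwards. *)
Definition reduce_rev (p : pred (letter r)) w : word r :=
  foldl (fun st a => if p a then
           (if ohead st == Some (inv_letter a) then behead st else a :: st) else st) [::] w.

(* The generators x_1, ..., x_n form class 0, and t_i is alone in class i + 1. *)
Definition letter_class n a : nat := a.1.+1 - n.

End WordOps.

Definition flip_code (a : nat) : nat := if odd a then a.-1 else a.+1.

Lemma code_letter_inv r (a : letter r) : code_letter (inv_letter a) = flip_code (code_letter a).
Proof.
case: a => i b; rewrite /code_letter /flip_code /= oddD odd_double.
by case: b => /=; rewrite ?addn0 ?addn1.
Qed.

Lemma code_letter_half r (a : letter r) : (code_letter a)./2 = a.1.
Proof. by case: a => i []; rewrite /code_letter /= ?addn1 ?addn0 ?doubleK //= uphalf_double. Qed.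

Lemma code_letter_odd r (a : letter r) : odd (code_letter a) = a.2.
Proof. by case: a => i b; rewrite /code_letter oddD odd_double; case: b. Qed.

Lemma code_letter_inj r : injective (@code_letter r).
Proof.
move=> a b E; move: (code_letter_half a) (code_letter_half b) (code_letter_odd a) (code_letter_odd b).
by rewrite E; case: a b {E} => [i x] [j y] /= -> /val_inj -> -> ->.
Qed.

Lemma code_word_inj r : injective (@code_word r).
Proof. by move=> u v /(can_inj CodeSeq.codeK)/(inj_map (@code_letter_inj r)). Qed.

Lemma decode_code_word r (w : word r) : CodeSeq.decode (code_word w) = [seq code_letter a | a <- w].
Proof. exact: CodeSeq.codeK. Qed.

Lemma code_word_cons r (a : letter r) w : code_cons (code_letter a) (code_word w) = code_word (a :: w).
Proof. by []. Qed.

Definition inv_code c := foldl (fun acc a => code_cons (flip_code a) acc) 0 (CodeSeq.decode c).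
Definition catrev_code c d := foldl (fun acc a => code_cons a acc) d (CodeSeq.decode c).
Definition cat_code c d := catrev_code (catrev_code c 0) d.
Definition image_code W a :=
  if odd a then inv_code (code_head (iter a./2 code_tail W)) else code_head (iter a./2 code_tail W).
Definition subst_code W x := foldl (fun acc a => cat_code acc (image_code W a)) 0 (CodeSeq.decode x).
(** The test [1 <= st] excludes the empty stack: its [code_head] is 0, which is also the code of a
    letter. *)
Definition reduce_code n j x := foldl (fun st a => if a./2.+1 - n == j then
   (if (1 <= st) && (code_head st == flip_code a) then code_tail st else code_cons a st)
   else st) 0 (CodeSeq.decode x).

Lemma inv_codeE r (w : word r) : inv_code (code_word w) = code_word (inv_word w).
Proof.
rewrite /inv_code decode_code_word /inv_word /rev.
rewrite -[0]/(code_word ([::] : word r)); move: [::] => u.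
elim: w u => //= a w IHw u.
by rewrite -code_letter_inv code_word_cons IHw.
Qed.

Lemma catrev_codeE r (w u : word r) : catrev_code (code_word w) (code_word u) = code_word (catrev w u).
Proof.
rewrite /catrev_code decode_code_word; elim: w u => //= a w IHw u.
by rewrite code_word_cons IHw.
Qed.

Lemma cat_codeE r (w u : word r) : cat_code (code_word w) (code_word u) = code_word (w ++ u).
Proof.
rewrite /cat_code -[0]/(code_word ([::] : word r)) !catrev_codeE.
by rewrite catrevE -/(rev w) revK.
Qed.

Lemma image_codeE r (ws : r.-tuple (word r)) a :
  image_code (code_words ws) (code_letter a) =
  code_word (if a.2 then inv_word (tnth ws a.1) else tnth ws a.1).
Proof.
rewrite /image_code code_letter_odd code_letter_half.
have -> : code_head (iter a.1 code_tail (code_words ws)) = code_word (tnth ws a.1).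
  have it i s : iter i code_tail (CodeSeq.code s) = CodeSeq.code (drop i s).
    elim: i => [|i IHi] /=; first by rewrite drop0.
    by rewrite IHi code_tailE -drop1 drop_drop add1n.
  rewrite /code_words it code_headE.
  rewrite (drop_nth 0) ?size_map ?size_tuple //= (nth_map [::]) ?size_tuple //.
  by rewrite (tnth_nth [::]).
by case: a.2; rewrite ?inv_codeE.
Qed.

Lemma subst_codeE r (ws : r.-tuple (word r)) (x : word r) :
  subst_code (code_words ws) (code_word x) = code_word (subst (tnth ws) x).
Proof.
rewrite /subst_code decode_code_word /subst.
rewrite -[RHS]/(code_word ([::] ++ _)) -[0]/(code_word ([::] : word r)); move: [::] => u.
elim: x u => /= [|a x IHx] u; first by rewrite cats0.
by rewrite image_codeE cat_codeE IHx catA.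
Qed.

Lemma reduce_codeE r n j (x : word r) :
  reduce_code n j (code_word x) = code_word (reduce_rev (fun a => letter_class n a == j) x).
Proof.
rewrite /reduce_code /reduce_rev decode_code_word.
rewrite -[X in foldl _ X _]/(code_word ([::] : word r)); move: [::] => u.
elim: x u => //= a x IHx u; rewrite code_letter_half -/(letter_class n a) -IHx.
congr foldl; case: ifP => // _; rewrite (fun_if (@code_word r)).
case: u => [|b u] //.
have -> : (ohead (b :: u) == Some (inv_letter a)) = (b == inv_letter a) by [].
have -> : code_head (code_word (b :: u)) = code_letter b by rewrite /code_word code_headE.
have -> : 0 < code_word (b :: u) by rewrite /code_word /= muln_gt0 expn_gt0.
rewrite -code_letter_inv (inj_eq (@code_letter_inj r)).
by case: (b == _) => /=; rewrite ?code_word_cons // /code_word code_tailE.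
Qed.

Lemma computable_flip n (F : n.-tuple nat -> nat) : computable F -> computable (fun v => flip_code (F v)).
Proof.
move=> cF; apply: computable_if; first exact: computable_odd.
  exact: computable_pred.
exact: computableS.
Qed.

Lemma computable_inv_code n (F : n.-tuple nat -> nat) : computable F -> computable (fun v => inv_code (F v)).
Proof.
move=> cF; apply: (computable_foldl (G := fun acc a _ => code_cons (flip_code a) acc)) => //.
  exact: computable0.
by apply: computable_code_cons; [apply: computable_flip; exact: computable_thead2 | exact: computable_thead].
Qed.

Lemma computable_catrev_code n (F G : n.-tuple nat -> nat) :
  computable F -> computable G -> computable (fun v => catrev_code (F v) (G v)).
Proof.
move=> cF cG; apply: (computable_foldl (G := fun acc a _ => code_cons a acc)) => //.
by apply: computable_code_cons; [exact: computable_thead2 | exact: computable_thead].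
Qed.

Lemma computable_cat_code n (F G : n.-tuple nat -> nat) :
  computable F -> computable G -> computable (fun v => cat_code (F v) (G v)).
Proof.
by move=> cF cG; apply: computable_catrev_code => //; apply: computable_catrev_code => //; exact: computable0.
Qed.

Lemma computable_image_code n (F G : n.-tuple nat -> nat) :
  computable F -> computable G -> computable (fun v => image_code (F v) (G v)).
Proof.
move=> cF cG.
have cH : computable (fun v => code_head (iter (G v)./2 code_tail (F v))).
  apply/computable_code_head/(computable_iter (g := fun c _ => code_tail c)) => //.
    exact: computable_half.
  exact: computable_code_tail (@computable_thead _).
by apply: computable_if => //; [exact: computable_odd | exact: computable_inv_code].
Qed.

Lemma computable_subst_code n (F G : n.-tuple nat -> nat) :
  computable F -> computable G -> computable (fun v => subst_code (F v) (G v)).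
Proof.
move=> cF cG.
apply: (computable_foldl (G := fun acc a v => cat_code acc (image_code (F v) a))) => //.
  exact: computable0.
apply: computable_cat_code; first exact: computable_thead.
by apply: computable_image_code; [exact: computable_behead2 | exact: computable_thead2].
Qed.

Lemma computable_reduce_code n k (J F : n.-tuple nat -> nat) :
  computable J -> computable F -> computable (fun v => reduce_code k (J v) (F v)).
Proof.
move=> cJ cF.
apply: (computable_foldl (G := fun st a v => if a./2.+1 - k == J v then
   (if (1 <= st) && (code_head st == flip_code a) then code_tail st else code_cons a st)
   else st)) => //; first exact: computable0.
have c1 := @computable_thead n.+1; have c2 := @computable_thead2 n.
apply: computable_if => //.
  apply: computable_eq; last exact: computable_behead2.
  by apply: computable_sub; [exact/computableS/computable_half | exact: computable_const].
apply: computable_if; last by exact: computable_code_cons.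
  apply: computable_andb; first by apply: computable_leq => //; exact: computable_const.
  by apply: computable_eq; [exact: computable_code_head | exact: computable_flip].
exact: computable_code_tail.
Qed.

(** This solves the word problem of the group; [FZ_eqP] is the proof of its correctness. *)
Definition same_code n m x y := all (fun j => reduce_code n j x == reduce_code n j y) (iota 0 m.+1).

Lemma computable_same_code k n m (F G : k.-tuple nat -> nat) :
  computable F -> computable G -> computableb (fun v => same_code n m (F v) (G v)).
Proof.
move=> cF cG.
have cH := computable_has (A := fun=> m.+1)
  (P := fun j v => ~~ (reduce_code n j (F v) == reduce_code n j (G v))) (computable_const _ _).
apply: computable_ext (computable_negb (cH _)) => [v|].
  by rewrite -all_predC; congr nat_of_bool; apply: eq_all => j /=; rewrite negbK.
apply: computable_negb; apply: computable_eq; apply: computable_reduce_code;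
  by [exact: computable_thead | exact: computable_behead].
Qed.

Lemma computable_hit n m (K : 3.-tuple nat -> nat) : computable K ->
  computable (fun v => has (fun k =>
     same_code n m (iter k (subst_code (tnth v ord0)) (tnth v (inord 1))) (tnth v (inord 2)))
     (iota 0 (K v)) : nat).
Proof.
move=> cK.
apply: (computable_has (P := fun k v =>
  same_code n m (iter k (subst_code (tnth v ord0)) (tnth v (inord 1))) (tnth v (inord 2)))) => //.
apply: computable_same_code; last by apply: (computable_behead (F := fun u : 3.-tuple nat => tnth u (inord 2))); exact: computable_proj.
apply: (computable_iter (g := fun c (u : 4.-tuple nat) => subst_code (tnth (behead_tuple u) ord0) c)).
- exact: computable_thead.
- by apply: (computable_behead (F := fun u : 3.-tuple nat => tnth u (inord 1))); exact: computable_proj.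
apply: computable_subst_code; last exact: computable_thead.
apply: (computable_behead (F := fun u : 4.-tuple nat => tnth (behead_tuple u) ord0)).
by apply: (computable_behead (F := fun u : 3.-tuple nat => tnth u ord0)); exact: computable_proj.
Qed.

(** * Polynomial functions on groups *)

Local Open Scope ring_scope.

Section GroupMorphism.
Variables (G H : groupType) (phi : {multiplicative G -> H}).

Lemma mult_morph1 : phi 1%g = 1%g.
Proof. by apply: (mulgI (phi 1%g)); rewrite -gmulfM !mulg1. Qed.

Lemma mult_morphV g : phi g^-1%g = (phi g)^-1%g.
Proof. by apply: (mulgI (phi g)); rewrite -gmulfM !mulgV mult_morph1. Qed.

End GroupMorphism.

Section PolynomialFunctions.
Variable G : groupType.
Implicit Types (f k : G -> int) (g h : G) (d : int) (c : nat).

Definition ldiff h f : G -> int := fun g => f (h * g)%g - f g.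

(* Modulo [d], the functions of degree less than [c]. *)
Fixpoint polyfun d c f : Prop :=
  if c is c'.+1 then forall h, polyfun d c' (ldiff h f) else forall g, (d %| f g)%Z.

Lemma polyfunW d c f : polyfun d c f -> polyfun d c.+1 f.
Proof.
elim: c f => [|c IHc] f pf h; last by apply: IHc; apply: pf.
by move=> g; rewrite /ldiff rpredB //; apply: pf.
Qed.

Lemma polyfun_leq d b c f : (b <= c)%N -> polyfun d b f -> polyfun d c f.
Proof. by move/subnK <-; elim: (c - b)%N => // i IHi /IHi; exact: polyfunW. Qed.

Lemma polyfunD d c f k : polyfun d c f -> polyfun d c k -> polyfun d c (fun g => f g + k g).
Proof.
elim: c f k => [|c IHc] f k pf pk; first by move=> g; rewrite rpredD.
move=> h; have -> : ldiff h (fun g => f g + k g) = fun g => ldiff h f g + ldiff h k g.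
  by apply: funext => g; rewrite /ldiff; ring.
by apply: IHc; [apply: pf | apply: pk].
Qed.

Lemma polyfunZ d c f (a : int) : polyfun d c f -> polyfun d c (fun g => a * f g).
Proof.
elim: c f => [|c IHc] f pf; first by move=> g; rewrite dvdz_mull.
move=> h; have -> : ldiff h (fun g => a * f g) = fun g => a * ldiff h f g.
  by apply: funext => g; rewrite /ldiff; ring.
exact: IHc.
Qed.

Lemma polyfunB d c f k : polyfun d c f -> polyfun d c k -> polyfun d c (fun g => f g - k g).
Proof.
move=> pf pk; have -> : (fun g => f g - k g) = (fun g => f g + (-1) * k g).
  by apply: funext => g; ring.
exact/polyfunD/polyfunZ.
Qed.

Lemma polyfun0 d c : polyfun d c (fun=> 0).
Proof. by apply: (polyfun_leq (leq0n _)) => g; exact: dvdz0. Qed.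

Lemma polyfun_sum (I : Type) (s : seq I) d c (F : I -> G -> int) :
  (forall i, polyfun d c (F i)) -> polyfun d c (fun g => \sum_(i <- s) F i g).
Proof.
move=> pF; elim: s => [|i s IHs].
  have -> : (fun g => \sum_(i <- [::]) F i g) = (fun=> 0).
    by apply: funext => g; rewrite big_nil.
  exact: polyfun0.
have -> : (fun g => \sum_(j <- i :: s) F j g) = (fun g => F i g + \sum_(j <- s) F j g).
  by apply: funext => g; rewrite big_cons.
exact: polyfunD.
Qed.

Lemma polyfun_const d (a : int) : polyfun d 1 (fun=> a).
Proof. by move=> h g; rewrite /ldiff subrr dvdz0. Qed.

(** The bounds on degrees are strict, whence the predecessor. The difference of a product is a sum
    of three products, each with a smaller sum of bounds. *)
Lemma polyfunM d b c f k :
  polyfun d b f -> polyfun d c k -> polyfun d (b + c).-1 (fun g => f g * k g).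
Proof.
have [n] := ubnP (b + c); elim: n b c f k => // n IHn [|b] c f k len pf pk.
  by apply: (polyfun_leq (leq0n _)) => g; rewrite dvdz_mulr.
case: c len pk => [|c] len pk.
  by apply: (polyfun_leq (leq0n _)) => g; rewrite dvdz_mull.
rewrite addSn addnS /= => h.
have -> : ldiff h (fun g => f g * k g) =
    fun g => (ldiff h f g * k g + f g * ldiff h k g) + ldiff h f g * ldiff h k g.
  by apply: funext => g; rewrite /ldiff; ring.
move: len; rewrite addSn addnS !ltnS => len.
apply: polyfunD; first apply: polyfunD.
- have := IHn b c.+1 _ _ _ (pf h) pk; rewrite addnS /=; apply; lia.
- have := IHn b.+1 c _ _ _ pf (pk h); rewrite addSn /=; apply; lia.
- by apply: (@polyfun_leq _ (b + c).-1); rewrite ?leq_pred //; apply: IHn => //; lia.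
Qed.

(** Modulus 0 stands for genuine polynomial functions, as 0 divides only 0. *)
Lemma polyfun_dvd d c f : polyfun 0 c f -> polyfun d c f.
Proof.
elim: c f => [|c IHc] f pf; first by move=> g; have := pf g; rewrite dvd0z => /eqP->; rewrite dvdz0.
by move=> h; apply: IHc; exact: pf.
Qed.

Lemma polyfun_div (p : int) c f : p != 0 -> (forall g, (p %| f g)%Z) -> polyfun 0 c f ->
  polyfun 0 c (fun g => (f g %/ p)%Z).
Proof.
move=> p0 pf; have {pf} [k Dk] : exists k : G -> int, forall g, f g = p * k g.
  by exists (fun g => (f g %/ p)%Z) => g; rewrite mulrC divzK.
have -> : (fun g => (f g %/ p)%Z) = k by apply: funext => g; rewrite Dk mulKz.
have {Dk} -> : f = fun g => p * k g by apply: funext.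
elim: c k => [|c IHc] k pf.
  by move=> g; have := pf g; rewrite !dvd0z mulf_eq0 (negPf p0).
move=> h; apply: IHc; have := pf h.
have -> // : ldiff h (fun g => p * k g) = fun g => p * ldiff h k g.
by apply: funext => g; rewrite /ldiff; ring.
Qed.

Lemma polyfun_rtrans d c f x : polyfun d c f -> polyfun d c (fun g => f (g * x)%g).
Proof.
elim: c f => [|c IHc] f pf; first by move=> g.
move=> h; have -> : ldiff h (fun g => f (g * x)%g) = fun g => ldiff h f (g * x)%g.
  by apply: funext => g; rewrite /ldiff mulgA.
exact: IHc.
Qed.

Lemma polyfun_ltrans d c f x : polyfun d c f -> polyfun d c (fun g => f (x * g)%g).
Proof.
case: c => [|c] pf; first by move=> g.
have -> : (fun g => f (x * g)%g) = fun g => f g + ldiff x f g.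
  by apply: funext => g; rewrite /ldiff; ring.
by apply: polyfunD => //; apply: polyfunW.
Qed.

Lemma ldiffM f x y :
  ldiff (x * y)%g f = fun g => ldiff x f (y * g)%g + ldiff y f g.
Proof. by apply: funext => g; rewrite /ldiff mulgA; ring. Qed.

Lemma ldiffV f x : ldiff x^-1%g f = fun g => (-1) * ldiff x f (x^-1 * g)%g.
Proof. by apply: funext => g; rewrite /ldiff mulVKg; ring. Qed.

End PolynomialFunctions.

Lemma polyfun_comp (G H : groupType) (phi : {multiplicative G -> H}) d c (f : H -> int) :
  polyfun d c f -> polyfun d c (fun g => f (phi g)).
Proof.
elim: c f => [|c IHc] f pf; first by move=> g.
move=> h; have -> : ldiff h (fun g => f (phi g)) = fun g => ldiff (phi h) f (phi g).
  by apply: funext => g; rewrite /ldiff gmulfM.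
exact: IHc.
Qed.

Section Presented.
Variables (r : nat) (R : word r -> word r -> Prop).
Local Notation G := (presented R : groupType).
Local Notation elt := (elt_of R).

Definition generator (i : 'I_r) : G := elt [:: (i, false)].

Lemma elt_nil : elt [::] = 1%g :> G. Proof. by []. Qed.

Lemma elt_cat u v : elt (u ++ v) = (elt u * elt v)%g :> G.
Proof. exact: elt_of_cat. Qed.

Lemma elt_cons i b w :
  elt ((i, b) :: w) = ((if b then (generator i)^-1 else generator i) * elt w)%g :> G.
Proof.
rewrite -cat1s elt_cat; congr (_ * _)%g; case: b => //.
apply: (mulgI (generator i)); rewrite mulgV -elt_cat.
exact/elt_ofP/(pres_cancel R (i, false)).
Qed.

Lemma elt_inv w : elt (inv_word w) = (elt w)^-1%g :> G.
Proof.
apply: (mulgI (elt w)); rewrite mulgV -elt_cat.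
exact/elt_ofP/pres_catV.
Qed.

Lemma eltP (g : G) : exists w, g = elt w.
Proof. by exists (word_of g); rewrite word_ofK. Qed.

(** By [ldiffM] and [ldiffV], a difference along a word is a signed sum of translates of differences
    along generators, and translation keeps the degree. *)
Lemma polyfun_gen d c (f : G -> int) :
  (forall i, polyfun d c (ldiff (generator i) f)) -> polyfun d c.+1 f.
Proof.
move=> pf h; have [w ->] := eltP h; elim: w => [|[i b] w IHw].
  have -> : ldiff (elt [::] : G) f = fun=> 0.
    by apply: funext => g; rewrite elt_nil /ldiff mul1g subrr.
  exact: polyfun0.
rewrite elt_cons ldiffM; apply: polyfunD => //; apply: polyfun_ltrans; case: b => //.
rewrite ldiffV; apply: polyfunZ; exact: polyfun_ltrans.
Qed.

Definition expsum (i : 'I_r) (w : word r) : int :=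
  \sum_(a <- w) (if a.1 == i then (-1) ^+ a.2 else 0).

(* Modulo functions of degree two less than [f], [ldiff h f] is additive in [h]. *)
Lemma ldiff_word d c (f : G -> int) w : polyfun d c.+2 f ->
  polyfun d c (fun g => ldiff (elt w : G) f g - \sum_i expsum i w * ldiff (generator i) f g).
Proof.
move=> pf; elim: w => [|[i b] w IHw].
  have -> : (fun g => ldiff (elt [::] : G) f g - \sum_i expsum i [::] * ldiff (generator i) f g) = fun=> 0.
    apply: funext => g; rewrite elt_nil /ldiff mul1g subrr big1 ?subr0 // => i _.
    by rewrite /expsum big_nil mul0r.
  exact: polyfun0.
set x := if b then (generator i)^-1%g else generator i.
have px : polyfun d c (fun g => ldiff x f g - (-1) ^+ b * ldiff (generator i) f g).
  rewrite /x; case: b {x}; last first.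
    have -> : (fun g => ldiff (generator i) f g - (-1) ^+ false * ldiff (generator i) f g) = fun=> 0.
      by apply: funext => g; rewrite expr0 mul1r subrr.
    exact: polyfun0.
  rewrite ldiffV.
  have -> : (fun g => -1 * ldiff (generator i) f ((generator i)^-1 * g)%g - (-1) ^+ true * ldiff (generator i) f g)
     = fun g => (-1) * ldiff (generator i)^-1%g (ldiff (generator i) f) g.
    by apply: funext => g; rewrite {3}/ldiff expr1; ring.
  exact/polyfunZ/pf.
rewrite elt_cons -/x ldiffM.
have -> : (fun g => ldiff x f (elt w * g)%g + ldiff (elt w) f g -
              \sum_j expsum j ((i, b) :: w) * ldiff (generator j) f g) =
   fun g => (ldiff (elt w : G) (ldiff x f) g + (ldiff x f g - (-1) ^+ b * ldiff (generator i) f g)) +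
            (ldiff (elt w) f g - \sum_j expsum j w * ldiff (generator j) f g).
  apply: funext => g.
  have -> : \sum_j expsum j ((i, b) :: w) * ldiff (generator j) f g =
     (-1) ^+ b * ldiff (generator i) f g + \sum_j expsum j w * ldiff (generator j) f g.
    under eq_bigr => j _ do rewrite /expsum big_cons mulrDl /=.
    rewrite big_split /=; congr (_ + _).
    rewrite (bigD1 i) //= eqxx big1 ?addr0 // => j; rewrite eq_sym => /negPf->.
    by rewrite mul0r.
  by rewrite [ldiff (elt w : G) (ldiff x f) g]/ldiff; ring.
apply: polyfunD => //; apply: polyfunD => //; exact: pf.
Qed.

(** The difference along [h] splits in two: one part falls to the induction hypothesis for
    [ldiff (al h) f]; in the other, [ldiff_word] leaves the exponent sums up to lower degree, and
    these agree modulo [d]. The loss of one degree drives both the uniform period and the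
    injectivity of endomorphisms trivial on H_1. *)
Lemma polyfun_congr d c (f : G -> int) (al be : {multiplicative G -> G}) :
  (forall h, exists u v, [/\ al h = elt u, be h = elt v &
     forall i, (d %| expsum i u - expsum i v)%Z]) ->
  polyfun d c.+1 f -> polyfun d c (fun g => f (al g) - f (be g)).
Proof.
move=> ab; elim: c f => [|c IHc] f pf.
  move=> g; have := pf (al g * (be g)^-1)%g (be g).
  by rewrite /ldiff mulgVK.
move=> h.
have -> : ldiff h (fun g => f (al g) - f (be g)) =
    fun g => (ldiff (al h) f (al g) - ldiff (al h) f (be g)) +
             (ldiff (al h) f (be g) - ldiff (be h) f (be g)).
  by apply: funext => g; rewrite /ldiff !gmulfM; ring.
apply: polyfunD; first by apply: IHc; exact: pf.
apply: (polyfun_comp be (f := fun g => ldiff (al h) f g - ldiff (be h) f g)).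
have [u [v [-> -> duv]]] := ab h.
have -> : (fun g => ldiff (elt u) f g - ldiff (elt v) f g) =
  fun g => ((ldiff (elt u) f g - \sum_i expsum i u * ldiff (generator i) f g) -
           (ldiff (elt v) f g - \sum_i expsum i v * ldiff (generator i) f g)) +
           \sum_i (expsum i u - expsum i v) * ldiff (generator i) f g.
  apply: funext => g.
  under [X in _ = _ + X]eq_bigr => i _ do rewrite mulrBl.
  by rewrite sumrB; ring.
apply: polyfunD; first by apply: polyfunB; exact: ldiff_word.
apply: (polyfun_leq (leq0n _)) => g.
by apply: rpred_sum => i _; rewrite dvdz_mulr.
Qed.

End Presented.

(** * Abelianization *)

Section Abel.
Variable r : nat.
Implicit Types (u v w : word r).

Definition abel w : 'rV[int]_r := \row_j expsum j w.

Lemma abel_cat u v : abel (u ++ v) = abel u + abel v.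
Proof. by apply/rowP => j; rewrite !mxE /expsum big_cat. Qed.

(** For such relations the abelianization is Z^r, so exponent sums are defined on group elements. *)
Definition balanced (R : word r -> word r -> Prop) := forall u v, R u v -> abel u = abel v.

Variable R : word r -> word r -> Prop.
Hypothesis balR : balanced R.
Local Notation G := (presented R : groupType).
Local Notation elt := (elt_of R : word r -> G).

Lemma abel_pres u v : pres_eq R u v -> abel u = abel v.
Proof.
elim=> {u v} //.
- by move=> u v w _ -> _ ->.
- by move=> u u' v v' _ E1 _ E2; rewrite !abel_cat E1 E2.
case=> i b; apply/rowP => j; rewrite !mxE /expsum !big_cons !big_nil /= addr0.
by case: (i == j); case: b; rewrite ?addr0 // expr1 expr0 ?addNr ?subrr.
Qed.

Definition abelG (g : G) := abel (word_of g).

Lemma abelG_elt w : abelG (elt w) = abel w.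
Proof. exact/abel_pres/word_of_elt. Qed.

Lemma abelGM g h : abelG (g * h)%g = abelG g + abelG h.
Proof. by rewrite -abel_cat -abelG_elt elt_cat /abelG !word_ofK. Qed.

Lemma abelG1 : abelG 1%g = 0.
Proof. by apply: (addrI (abelG 1%g)); rewrite -abelGM mulg1 addr0. Qed.

Lemma abelGV g : abelG g^-1%g = - abelG g.
Proof. by apply: (addrI (abelG g)); rewrite -abelGM mulgV abelG1 subrr. Qed.

Lemma abelG_gen i : abelG (generator R i) = delta_mx 0 i.
Proof.
rewrite abelG_elt; apply/rowP => j; rewrite !mxE /expsum big_seq1 /= eq_sym.
by case: eqP.
Qed.

End Abel.

Section AbelMorphism.
Variables (r r' : nat) (R : word r -> word r -> Prop) (R' : word r' -> word r' -> Prop).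
Hypotheses (balR : balanced R) (balR' : balanced R').
Local Notation G := (presented R : groupType).
Local Notation H := (presented R' : groupType).

Definition abel_mx (Phi : {multiplicative G -> H}) : 'M[int]_(r, r') :=
  \matrix_i abelG (Phi (generator R i)).

Lemma abelG_act (Phi : {multiplicative G -> H}) g : abelG (Phi g) = abelG g *m abel_mx Phi.
Proof.
have [w ->] := eltP g; elim: w => [|[i b] w IHw].
  by rewrite elt_nil mult_morph1 !abelG1 // mul0mx.
rewrite elt_cons gmulfM !abelGM // mulmxDl IHw; congr (_ + _).
have genE : abelG (Phi (generator R i)) = abelG (generator R i) *m abel_mx Phi.
  by rewrite abelG_gen // -rowE rowK.
by case: b; rewrite // mult_morphV !abelGV // mulNmx genE.
Qed.

End AbelMorphism.

Lemma abelG_iter r (R : word r -> word r -> Prop) (balR : balanced R)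
  (Phi : {multiplicative (presented R : groupType) -> (presented R : groupType)}) k g :
  abelG (iter k Phi g) = abelG g *m abel_mx Phi ^+ k.
Proof.
elim: k => [|k IHk]; first by rewrite expr0 mulmx1.
by rewrite /= (abelG_act balR balR) IHk exprSr -mulmxE mulmxA.
Qed.

Lemma FZ_balanced n m : balanced (@FZ_rel n m).
Proof.
have comm a b : abel [:: a; b] = abel [:: b; a] :> 'rV_(n + m).
  by rewrite -[[:: a; b]]/([:: a] ++ [:: b]) -[[:: b; a]]/([:: b] ++ [:: a]) !abel_cat addrC.
by move=> _ _ [i j|i k].
Qed.

Local Close Scope ring_scope.

(** * Magnus coefficients *)

Local Open Scope ring_scope.

Section Magnus.
Variable r : nat.
Implicit Types (I J : seq 'I_r) (phi psi : seq 'I_r -> int) (w : word r).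

(* Left multiplication by 1 + X_a, respectively by its inverse, on the
   coefficients of a noncommutative power series. *)
Definition magnus_pos (a : 'I_r) phi I : int :=
  phi I + (if I is b :: J then (if b == a then phi J else 0) else 0).

Fixpoint magnus_neg (a : 'I_r) phi I : int :=
  phi I - (if I is b :: J then (if b == a then magnus_neg a phi J else 0) else 0).

Definition magnus_letter (l : letter r) := if l.2 then magnus_neg l.1 else magnus_pos l.1.

Definition magnus_act w phi : seq 'I_r -> int := foldr magnus_letter phi w.

Definition magnus w : seq 'I_r -> int := magnus_act w (fun I => (I == [::])%:R).
Arguments magnus : simpl never.

Lemma magnus_posK a : cancel (magnus_neg a) (magnus_pos a).
Proof.
move=> phi; apply: funext; case=> [|b I]; rewrite /magnus_pos /=; first by ring.
by case: eqP => _; ring.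
Qed.

Lemma magnus_negK a : cancel (magnus_pos a) (magnus_neg a).
Proof.
move=> phi; apply: funext; elim=> [|b I IHI] /=; first by rewrite /magnus_pos; ring.
by rewrite {}IHI /magnus_pos; case: eqP => _; ring.
Qed.

Lemma magnus_act_cancel l phi : magnus_letter l (magnus_letter (inv_letter l) phi) = phi.
Proof.
case: l => a [] /=; rewrite /magnus_letter /=; [exact: magnus_negK | exact: magnus_posK].
Qed.

Lemma magnus_act_cat u v phi : magnus_act (u ++ v) phi = magnus_act u (magnus_act v phi).
Proof. exact: foldr_cat. Qed.

(** A letter costs at most a factor |I| + 1: after multiplication by 1 + X_a or its inverse, the
    coefficient at [I] is a signed sum of at most |I| + 1 old coefficients at suffixes of [I]. *)
Lemma magnus_bound w I : `|magnus w I| <= ((size I).+1 ^ size w)%:Z.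
Proof.
elim: w I => [|[a b] w IHw] I; first by rewrite /magnus /= expn0; case: (I == [::]).
have mono (J K : seq (ordinal r)) : (size J <= size K)%N -> ((size J).+1 ^ size w)%:Z <= ((size K).+1 ^ size w)%:Z.
  by move=> le; rewrite lez_nat; case: (size w) => // q; rewrite leq_exp2r.
have IHw2 (J K : seq (ordinal r)) : (size J <= size K)%N -> `|magnus w J| <= ((size K).+1 ^ size w)%:Z.
  by move/mono; apply: le_trans.
rewrite -[magnus _]/(magnus_letter (a, b) (magnus w)) /magnus_letter /= expnS PoszM.
case: b => /=; last first.
  rewrite /magnus_pos; apply: le_trans (ler_normD _ _) _.
  case: I => [|c I]; first by rewrite normr0 addr0 mul1r.
  have := IHw2 (c :: I) (c :: I) (leqnn _); have := IHw2 I (c :: I) (leqnSn _).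
  move: (((size (c :: I)).+1 ^ _)%N) => x /=.
  by case: eqP; rewrite ?normr0; lia.
suff H : forall K : seq (ordinal r), (size I <= size K)%N ->
    `|magnus_neg a (magnus w) I| <= (size I).+1%:Z * ((size K).+1 ^ size w)%:Z by exact: H.
elim: I => [|c I IHI] K leIK /=.
  by rewrite subr0 mul1r; exact: IHw2.
apply: le_trans (ler_normB _ _) _.
have := IHw2 (c :: I) K leIK; have := IHI K (ltnW leIK).
move: (((size K).+1 ^ _)%N) => x /=.
by case: eqP; rewrite ?normr0; lia.
Qed.

(** The product of noncommutative power series. *)
Definition conv phi psi I : int := \sum_(i < (size I).+1) phi (take i I) * psi (drop i I).

Lemma conv_pos a phi psi : conv (magnus_pos a phi) psi = magnus_pos a (conv phi psi).
Proof.
apply: funext => I; rewrite /conv /magnus_pos.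
case: I => [|b I]; first by rewrite !addr0 !big_ord1 /= addr0.
transitivity (\sum_(i < (size (b :: I)).+1) phi (take i (b :: I)) * psi (drop i (b :: I)) +
  \sum_(i < (size (b :: I)).+1)
    (if take i (b :: I) is c :: J then (if c == a then phi J else 0) else 0) * psi (drop i (b :: I))).
  by rewrite -big_split; apply: eq_bigr => i _; rewrite /= mulrDl.
congr (_ + _); rewrite big_ord_recl /= mul0r add0r.
case: eqP => _; last by rewrite big1 // => i _; rewrite mul0r.
by apply: eq_bigr => i _.
Qed.

Lemma conv_letter l phi psi : conv (magnus_letter l phi) psi = magnus_letter l (conv phi psi).
Proof.
case: l => a [] /=; rewrite /magnus_letter /=; last exact: conv_pos.
by apply: (can_inj (magnus_negK a)); rewrite -conv_pos !magnus_posK.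
Qed.

Lemma magnus_cat u v : magnus (u ++ v) = conv (magnus u) (magnus v).
Proof.
rewrite /magnus magnus_act_cat; elim: u => [|l u IHu] /=; last by rewrite IHu conv_letter.
apply: funext => I; rewrite /conv big_ord_recl /= take0 drop0 mul1r big1 ?addr0 // => i _.
by case: I i => [|b I] [i lti] //=; rewrite mul0r.
Qed.

Definition reduced w : bool := sorted (fun a b => b != inv_letter a) w.

(* The letters of the successive syllables of a reduced word give a nonzero
   coefficient, the product of the syllable exponents. [Q] is that coefficient
   with the first syllable left out, [k] the length of the first syllable. *)
Lemma magnus_reduced_syllables (a : 'I_r) (b : bool) w : reduced ((a, b) :: w) ->
  exists (I : seq 'I_r) (k : nat) (Q : int),
  [/\ (size I <= size w)%N /\ path (fun x y => x != y) a I,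
      (0 < k)%N /\ Q != 0,
      magnus ((a, b) :: w) (a :: I) = (-1) ^+ b * k%:Z * Q,
      magnus ((a, b) :: w) I = Q
    & forall c J, path (fun x y => x != y) c J ->
        ((size I < size J) || ((size I == size J) && (c != a)))%N ->
        magnus ((a, b) :: w) (c :: J) = 0].
Proof.
(* On an index without equal neighbours only the first two terms of 1 - X_c + X_c^2 - ...
   contribute. *)
have letE c s phi x J : path (fun x y => x != y) x J ->
    magnus_letter (c, s) phi (x :: J) = phi (x :: J) + (if x == c then (-1) ^+ s * phi J else 0).
  rewrite /magnus_letter /=; case: s => /=; last by rewrite expr0 mul1r.
  move=> pJ; case: eqP => [xc|_]; last by rewrite ?subr0 ?addr0.
  congr (_ + _); rewrite expr1 mulN1r; congr (- _).
  by case: J pJ => [|y J] /=; rewrite ?subr0 // -xc eq_sym => /andP[/negPf-> _]; rewrite subr0.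
have let0 c s phi : magnus_letter (c, s) phi [::] = phi [::].
  by rewrite /magnus_letter; case: s; rewrite /= ?subr0 // /magnus_pos addr0.
have letN c s phi I : path (fun x y => x != y) c I ->
    magnus_letter (c, s) phi I = phi I.
  case: I => [_|x J /andP[ncx pJ]]; first exact: let0.
  by rewrite letE // eq_sym (negPf ncx) addr0.
elim: w a b => [|[a' b'] w IHw] a b red.
  exists [::], 1%N, 1; split => //.
  - by rewrite -[magnus _]/(magnus_letter (a, b) _) letE //= eqxx add0r !mulr1.
  - by rewrite -[magnus _]/(magnus_letter (a, b) _) let0.
  move=> c J pJ cJ; rewrite -[magnus _]/(magnus_letter (a, b) _) letE //= add0r.
  case: (c =P a) cJ => [_ /=|//]; rewrite andbF orbF.
  by case: (J) => //= x s _; rewrite mulr0.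
move: red; rewrite /reduced [sorted _ _]/= => /andP[nab red].
have [I [k [Q [[sI pI] [k0 Q0] m1 m2 m3]]]] := IHw a' b' red.
set m := magnus ((a', b') :: w) in m1 m2 m3.
have Dm : magnus [:: (a, b), (a', b') & w] = magnus_letter (a, b) m by [].
(* The new letter lengthens the first syllable, reducedness forcing the same sign, or it opens a
   syllable of length 1. *)
rewrite Dm; case: (eqVneq a' a) => [Daa|naa].
  have Dbb : b' = b by move: nab; rewrite /inv_letter Daa /=; case: (b) (b') => [] []; rewrite ?eqxx.
  clearbody m; subst a' b'.
  exists I, k.+1, Q; split=> //.
  - by split; first exact: leqW.
  - by rewrite letE // eqxx m1 m2 intS; ring.
  - by rewrite letN.
  move=> c J pJ cJ; rewrite letE // m3 // add0r.
  case: (c =P a) cJ => [Dc|//]; rewrite andbF orbF => ltIJ.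
  have -> : m J = 0; last by rewrite mulr0.
  case: J ltIJ pJ => //= x J; rewrite ltnS => leIJ /andP[ncx pxJ]; apply: m3 => //.
  by rewrite -Dc [x == c]eq_sym ncx andbT orbC -leq_eqVlt.
exists (a' :: I), 1%N, ((-1) ^+ b' * k%:Z * Q); split.
- by split=> //=; rewrite eq_sym naa.
- by split=> //; rewrite !mulf_neq0 ?signr_eq0 // lt0r_neq0.
- rewrite letE /=; last by rewrite eq_sym naa.
  rewrite eqxx m1 m3; first by rewrite add0r mulr1.
    by rewrite /= eq_sym naa.
  by rewrite /= ltnSn.
- by rewrite letN //= eq_sym naa.
move=> c J pJ cJ; rewrite letE // m3 //; last first.
  by case/orP: cJ => [/= /ltnW->//|/andP[/eqP<- _]]; rewrite /= ltnSn.
rewrite add0r; case: (c =P a) cJ => [Dc|//]; rewrite andbF orbF /= => ltIJ.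
case: J ltIJ pJ => //= x J; rewrite ltnS => leIJ /andP[ncx pxJ].
by rewrite m3 ?mulr0 // leIJ.
Qed.

Lemma magnus_reduced w : reduced w -> w != [::] ->
  exists2 I, (size I <= size w)%N & I != [::] /\ magnus w I != 0.
Proof.
case: w => [//|[a b] w] red _.
have [I [k [Q [[sI _] [k0 Q0] m1 _ _]]]] := magnus_reduced_syllables red.
exists (a :: I) => //; split=> //.
by rewrite m1 !mulf_neq0 ?signr_eq0 // lt0r_neq0.
Qed.

End Magnus.

(** * Taylor expansion of polynomial functions *)

Section Expansion.
Variables (r : nat) (R : word r -> word r -> Prop).
Local Notation G := (presented R : groupType).
Local Notation elt := (elt_of R : word r -> G).

Fixpoint short_seqs c : seq (seq 'I_r) :=
  if c is c'.+1 then [::] :: [seq a :: J | a <- enum 'I_r, J <- short_seqs c'] else [::].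

Lemma mem_short_seqs c I : (I \in short_seqs c) = (size I < c)%N.
Proof.
elim: c I => //= c IHc [|a I]; first by rewrite inE.
rewrite inE /=; apply/allpairsP/idP => [[[b J] [_ /=]]|ltI].
  by rewrite IHc => ltJ [_ ->].
by exists (a, I); rewrite mem_enum IHc.
Qed.

Lemma sum_short_seqs c (F : seq 'I_r -> int) :
  \sum_(I <- short_seqs c.+1) F I = F [::] + \sum_a \sum_(J <- short_seqs c) F (a :: J).
Proof. by rewrite /= big_cons big_allpairs_dep /= big_enum. Qed.

Definition ldiffs (I : seq 'I_r) (f : G -> int) : G -> int :=
  foldl (fun f a => ldiff (generator R a) f) f I.

(** A Taylor formula at 1: f(ag) = f(g) + (ldiff a f)(g) mirrors multiplication by 1 + X_a. For an
    inverse letter the difference is taken at a^-1 g itself, which calls for an inner induction on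
    the degree. *)
Lemma magnus_expansion c (f : G -> int) w : polyfun 0 c f ->
  f (elt w) = \sum_(I <- short_seqs c) magnus w I * ldiffs I f 1%g.
Proof.
elim: w c f => [|[a b] w IHw] c f pf.
  case: c pf => [|c] pf; first by rewrite big_nil; apply/eqP; rewrite -dvd0z; exact: pf.
  rewrite sum_short_seqs /= mul1r big1 ?addr0 // => a _.
  by rewrite big1 // => J _; rewrite mul0r.
rewrite elt_cons; case: b.
  elim: c f pf => [|c IHc] f pf; first by rewrite big_nil; apply/eqP; rewrite -dvd0z; exact: pf.
  have -> : f ((generator R a)^-1 * elt w)%g = f (elt w) - ldiff (generator R a) f ((generator R a)^-1 * elt w)%g.
    by rewrite /ldiff mulVKg; ring.
  rewrite (IHw _ _ pf) (IHc _ (pf _)) !sum_short_seqs /= -addrA; congr (_ + _).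
    by rewrite /magnus_letter /= subr0.
  rewrite [X in _ - X](_ : _ = \sum_b \sum_(J <- short_seqs c)
     (if b == a then magnus ((a, true) :: w) J else 0) * ldiffs (b :: J) f 1%g); last first.
    rewrite (bigD1 a) //= eqxx [X in _ = _ + X]big1 ?addr0 // => b /negPf->.
    by rewrite big1 // => J _; rewrite mul0r.
  rewrite -sumrB; apply: eq_bigr => b _; rewrite -sumrB; apply: eq_bigr => J _.
  by rewrite -mulrBl.
have -> : f (generator R a * elt w)%g = f (elt w) + ldiff (generator R a) f (elt w).
  by rewrite /ldiff; ring.
case: c pf => [|c] pf.
  have f0 g : f g = 0 by apply/eqP; rewrite -dvd0z; exact: pf.
  by rewrite big_nil /ldiff !f0.
rewrite (IHw _ _ pf) (IHw _ _ (pf _)) !sum_short_seqs /= -addrA; congr (_ + _).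
  by rewrite /magnus_letter /= /magnus_pos addr0.
rewrite [X in _ + X](_ : _ = \sum_b \sum_(J <- short_seqs c)
   (if b == a then magnus w J else 0) * ldiffs (b :: J) f 1%g); last first.
  rewrite (bigD1 a) //= eqxx [X in _ = _ + X]big1 ?addr0 // => b /negPf->.
  by rewrite big1 // => J _; rewrite mul0r.
rewrite -big_split; apply: eq_bigr => b _; rewrite -big_split; apply: eq_bigr => J _.
by rewrite /= -mulrDl.
Qed.

End Expansion.

(** * Free reduction *)

Section Reduction.
Variable r : nat.
Implicit Types (w u v : word r) (a : letter r).

Lemma inv_letterK : involutive (@inv_letter r).
Proof. by case=> i b; rewrite /inv_letter /= negbK. Qed.

Lemma reduce_rev_reduced p w : reduced (rev (reduce_rev p w)).
Proof.
rewrite /reduced rev_sorted /reduce_rev.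
have : sorted (fun x y : letter r => x != inv_letter y) [::] by [].
move: [::] => st; elim: w st => //= a w IHw st red; apply: IHw.
case: (p a) => //; case: st red => [|b st] //= red.
have -> : (Some b == Some (inv_letter a)) = (b == inv_letter a) by [].
case: eqP => [_|/eqP nba]; first exact: path_sorted red.
by rewrite /= red andbT -(inj_eq (inv_inj inv_letterK)) inv_letterK eq_sym.
Qed.

Lemma reduce_rev_size p w : (size (reduce_rev p w) <= size w)%N.
Proof.
rewrite /reduce_rev -[size w]add0n -[0%N]/(size ([::] : word r)).
move: [::] => st; elim: w st => [|a w IHw] st /=; first by rewrite addn0.
apply: leq_trans (IHw _) _; rewrite addnS -addSn leq_add2r.
case: (p a) => //; case: st => [|b st] //=; case: ifP => // _; exact: leqW.
Qed.

Lemma reduce_rev_ind (T : Type) (E : word r -> T) p w :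
  (forall u v a, E (u ++ [:: inv_letter a; a] ++ v) = E (u ++ v)) ->
  E (rev (reduce_rev p w)) = E (filter p w).
Proof.
move=> Ecancel; rewrite /reduce_rev -[filter p w]cat0s -[X in X ++ filter _ _]/(rev [::]).
move: [::] => st; elim: w st => [|a w IHw] st /=; first by rewrite cats0.
rewrite IHw; case: (p a) => //=.
case: st => [|b st] //=.
have -> : (Some b == Some (inv_letter a)) = (b == inv_letter a) by [].
case: eqP => [->|_]; last by rewrite !rev_cons -!cats1 -!catA.
by rewrite rev_cons -cats1 -catA (Ecancel (rev st) (filter p w) a).
Qed.

Lemma magnus_act_reduce p w phi :
  magnus_act (rev (reduce_rev p w)) phi = magnus_act (filter p w) phi.
Proof.
apply: (reduce_rev_ind (E := fun u => magnus_act u phi)) => u v a.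
rewrite !magnus_act_cat /=; congr magnus_act.
by have := magnus_act_cancel (inv_letter a) (magnus_act v phi); rewrite inv_letterK.
Qed.

Lemma elt_reduce (R : word r -> word r -> Prop) p w :
  elt_of R (rev (reduce_rev p w)) = elt_of R (filter p w).
Proof.
apply: (reduce_rev_ind (E := elt_of R)) => u v a.
rewrite !elt_of_cat; congr pres_mul.
have -> : elt_of R [:: inv_letter a; a] = pres_one R.
  by apply/elt_ofP; have := pres_cancel R (inv_letter a); rewrite inv_letterK.
by rewrite pres_mul1.
Qed.

Lemma inv_word_reduced w : reduced w -> reduced (inv_word w).
Proof.
rewrite /reduced /inv_word rev_sorted sorted_map.
apply: sub_sorted => a b /= nab.
by rewrite inv_letterK eq_sym -(inj_eq (inv_inj inv_letterK)) inv_letterK eq_sym in nab *.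
Qed.

Lemma magnus_act_inv w phi : magnus_act (inv_word w ++ w) phi = phi.
Proof.
rewrite magnus_act_cat; elim: w phi => [|a w IHw] phi //=.
rewrite -cat1s inv_word_cat magnus_act_cat /=.
by have := magnus_act_cancel (inv_letter a) (magnus_act w phi); rewrite inv_letterK => ->.
Qed.

Lemma reduced_magnus_act1 w : reduced w -> (forall phi, magnus_act w phi = phi) -> w = [::].
Proof.
move=> red act1; apply/eqP; apply: contraT => w0.
have [I _ [I0 mI]] := magnus_reduced red w0.
by move: mI; rewrite /magnus act1 (negPf I0) eqxx.
Qed.

(** Once common prefixes are removed the first letters differ, so u^-1 v is itself reduced; acting
    trivially, it is empty. *)
Lemma reduced_magnus_act_inj u v : reduced u -> reduced v ->
  (forall phi, magnus_act u phi = magnus_act v phi) -> u = v.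
Proof.
elim: u v => [|a u IHu] [|b v] // redu redv uv.
- by apply/esym/reduced_magnus_act1 => // phi; rewrite -uv.
- by apply/reduced_magnus_act1 => // phi; rewrite uv.
have redS x w : reduced (x :: w) -> reduced w by exact: path_sorted.
have letK x : injective (magnus_letter (r := r) x).
  move=> f g fg; have := magnus_act_cancel (inv_letter x); rewrite inv_letterK => canx.
  by rewrite -(canx f) fg canx.
case: (eqVneq a b) => [Dab|nab].
  rewrite -Dab in uv redv *; congr (_ :: _); apply: IHu => [||phi].
  - exact: redS redu.
  - exact: redS redv.
  - exact: letK (uv phi).
suff : inv_word (a :: u) ++ b :: v = [::].
  by move/(congr1 size)/eqP; rewrite size_cat addnS.
apply: reduced_magnus_act1 => [|phi]; last first.
  by rewrite magnus_act_cat -uv -magnus_act_cat magnus_act_inv.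
have redi := inv_word_reduced redu.
move: redi; rewrite /reduced -cat1s inv_word_cat -[inv_word [:: a]]/[:: inv_letter a].
case: (inv_word u) => [|c w] /=; first by rewrite inv_letterK eq_sym nab.
rewrite !cat_path => /andP[-> /=]; rewrite andbT => ->.
by rewrite last_cat /= inv_letterK eq_sym nab.
Qed.

End Reduction.

(** * Normal words in F_n x Z^m *)

Section FZ.
Variables n m : nat.
Local Notation N := (n + m)%N.
Local Notation G := (presented (@FZ_rel n m) : groupType).
Local Notation elt := (elt_of (@FZ_rel n m) : word N -> G).
Local Notation cls := (letter_class n).
Implicit Types (w u v : word N) (a : letter N).

Definition class_part j w : word N := [seq a <- w | cls a == j].
Arguments class_part : simpl never.
(** The classes are the factors of F_n x Z x ... x Z, so letters of different classes may be moved
    past each other. *)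
Definition normal_word w : word N := flatten [seq class_part j w | j <- iota 0 m.+1].

Lemma letter_class_le a : (cls a <= m)%N.
Proof. by rewrite /letter_class; have := ltn_ord a.1; lia. Qed.

Lemma gen_commute (i j : 'I_N) : cls (i, false) != cls (j, false) ->
  commute (generator (@FZ_rel n m) i) (generator (@FZ_rel n m) j).
Proof.
rewrite /letter_class /=.
have com x y : FZ_rel [:: x; y] [:: y; x] -> elt [:: x; y] = elt [:: y; x].
  by move=> xy; apply/elt_ofP; apply: pres_rel.
have comE p q : elt [:: (p, false); (q, false)] = (generator (@FZ_rel n m) p * generator (@FZ_rel n m) q)%g.
  by rewrite -cat1s elt_cat.
rewrite -(splitK i) -(splitK j); case: (split i) => p; case: (split j) => q /= npq.
- by exfalso; move: npq; have := ltn_ord p; have := ltn_ord q; lia.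
- by apply/commute_sym; rewrite /commute -!comE; apply/com/FZ_tx.
- by rewrite /commute -!comE; apply/com/FZ_tx.
- by rewrite /commute -!comE; apply/com/FZ_tt.
Qed.

Lemma elt_commute a w : all (fun b => cls b != cls a) w -> commute (elt [:: a]) (elt w).
Proof.
case: a => i b; rewrite [elt [:: _]]elt_cons mulg1.
elim: w => [|[j c] w IHw] /=; first by move=> _; exact: commute1.
case/andP => nij allw; rewrite elt_cons; apply: commuteM; last exact: IHw.
have ij : commute (generator (@FZ_rel n m) i) (generator (@FZ_rel n m) j).
  by apply: gen_commute; rewrite eq_sym.
have sgn (x : G) p d : commute p x -> commute p (if d then x^-1 else x)%g.
  by case: d => // px; apply: commuteV.
by apply: (sgn); apply: commute_sym; apply: sgn; apply: commute_sym.
Qed.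

Lemma elt_normal_word w : elt (normal_word w) = elt w.
Proof.
elim: w => [|a w IHw]; first by rewrite /normal_word; congr elt; elim: (iota _ _).
rewrite -cat1s [RHS]elt_cat -IHw /normal_word.
have : cls a \in iota 0 m.+1 by rewrite mem_iota ltnS letter_class_le.
have : uniq (iota 0 m.+1) by exact: iota_uniq.
have partN j : cls a != j -> class_part j (a :: w) = class_part j w.
  by rewrite /class_part /= => /negPf->.
elim: (iota 0 m.+1) => [|j js IHjs] //= /andP[njs ujs]; rewrite inE.
case: (eqVneq (cls a) j) => [Daj _|naj /= ajs].
  have -> : class_part j (a :: w) = a :: class_part j w by rewrite /class_part /= Daj eqxx.
  rewrite -cat1s !elt_cat mulgA; congr (_ * elt (flatten _))%g.
  apply/eq_in_map => k kjs; apply: partN; apply: contraNneq njs => Dk.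
  by rewrite -Daj Dk.
rewrite partN // !elt_cat (IHjs ujs ajs) !mulgA; congr (_ * _)%g.
apply/esym/elt_commute/allP => b; rewrite mem_filter => /andP[/eqP-> _].
by rewrite eq_sym.
Qed.
End FZ.

Section Coefficients.
Variables n m : nat.
Local Notation N := (n + m)%N.
Local Notation G := (presented (@FZ_rel n m) : groupType).
Local Notation elt := (elt_of (@FZ_rel n m) : word N -> G).
Local Notation gen := (generator (@FZ_rel n m)).
Local Notation cls := (letter_class n).
Implicit Types (w u v : word N) (a : letter N) (I J : seq 'I_N).

Lemma class_part_cat j u v : class_part j (u ++ v) = class_part j u ++ class_part j v.
Proof. exact: filter_cat. Qed.

Lemma magnus_act_class_part j u v phi : pres_eq (@FZ_rel n m) u v ->
  magnus_act (class_part j u) phi = magnus_act (class_part j v) phi.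
Proof.
move=> uv; elim: uv phi => {u v} //.
- by move=> u v w _ IHu _ IHv phi; rewrite IHu.
- move=> u u' v v' _ IHu _ IHv phi.
  by rewrite !class_part_cat !magnus_act_cat IHu IHv.
- move=> a phi; rewrite /class_part /=.
  have -> : cls (inv_letter a) = cls a by [].
  by case: (cls a == j) => //=; rewrite magnus_act_cancel.
move=> _ _ [i k|i k] phi; congr magnus_act; rewrite /class_part /=.
  rewrite /letter_class /=.
  case: (altP ((n + i).+1 - n =P j)%N) => Di; case: (altP ((n + k).+1 - n =P j)%N) => Dk //.
  by rewrite (_ : i = k) //; apply: val_inj; rewrite /=; lia.
rewrite /letter_class /=.
case: (altP ((n + i).+1 - n =P j)%N) => Di; case: (altP (k.+1 - n =P j)%N) => Dk //.
by have := ltn_ord k; lia.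
Qed.

Definition class_coef j I (g : G) : int := magnus (class_part j (word_of g)) I.

Lemma class_coefE j I w : class_coef j I (elt w) = magnus (class_part j w) I.
Proof. by rewrite /class_coef /magnus (magnus_act_class_part _ _ (word_of_elt _ w)). Qed.

Lemma polyfun_class_coef j I : polyfun 0 (size I).+1 (class_coef j I).
Proof.
elim: I => [|b I IHI]; apply: polyfun_gen => i.
  have -> : ldiff (gen i) (class_coef j [::]) = fun=> 0.
    apply: funext => g; have [w ->] := eltP g.
    rewrite /ldiff -(elt_cons _ i false) !class_coefE /class_part /=.
    by case: ifP => _; rewrite ?subrr //= /magnus_letter /= /magnus_pos addr0 subrr.
  exact: polyfun0.
have -> : ldiff (gen i) (class_coef j (b :: I)) =
    if (cls (i, false) == j) && (b == i) then class_coef j I else fun=> 0.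
  apply: funext => g; have [w ->] := eltP g.
  rewrite /ldiff -(elt_cons _ i false) (fun_if (fun f => f (elt w))) !class_coefE /class_part /=.
  case: (_ == j); rewrite /= ?subrr // /magnus /= /magnus_letter /= /magnus_pos.
  by case: eqP => _; rewrite addrC addKr.
by case: ifP => _ //; exact: polyfun0.
Qed.

(** Magnus coefficients of an arbitrary word change under t x = x t. Those of the normal word are
    convolutions of coefficients of the class parts, which depend on the element only. *)
Definition normal_coef I (g : G) : int := magnus (normal_word (word_of g)) I.

Lemma coef_class_part (js : seq nat) I :
  polyfun 0 (size I).+1 (fun g : G => magnus (flatten [seq class_part j (word_of g) | j <- js]) I) /\
  forall w, magnus (flatten [seq class_part j (word_of (elt w)) | j <- js]) I =
            magnus (flatten [seq class_part j w | j <- js]) I.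
Proof.
elim: js I => [|j js IHjs] I.
  by split=> //; apply: (@polyfun_leq _ _ 1) => //; exact: polyfun_const.
split; last first.
  move=> w; rewrite /= !magnus_cat; apply: eq_bigr => i _.
  by rewrite (IHjs _).2 -/(class_coef j _ _) class_coefE.
have -> : (fun g : G => magnus (class_part j (word_of g) ++
      flatten [seq class_part j0 (word_of g) | j0 <- js]) I) =
   fun g => \sum_(i < (size I).+1) class_coef j (take i I) g *
      magnus (flatten [seq class_part j0 (word_of g) | j0 <- js]) (drop i I).
  by apply: funext => g; rewrite magnus_cat.
apply: polyfun_sum => i.
have := polyfunM (polyfun_class_coef j (take i I)) (IHjs (drop i I)).1.
by apply: polyfun_leq; rewrite size_drop size_take; have := ltn_ord i; case: ifP; lia.
Qed.

Lemma normal_coefE I w : normal_coef I (elt w) = magnus (normal_word w) I.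
Proof. exact: (coef_class_part (iota 0 m.+1) I).2. Qed.

Lemma polyfun_coef I : polyfun 0 (size I).+1 (normal_coef I).
Proof. exact: (coef_class_part (iota 0 m.+1) I).1. Qed.

Lemma size_normal_word w : (size (normal_word w) <= size w)%N.
Proof.
rewrite /normal_word size_flatten /shape -map_comp.
rewrite (eq_map (g := fun j => count (fun a => cls a == j) w)); last first.
  by move=> j /=; rewrite size_filter.
have : uniq (iota 0 m.+1) by exact: iota_uniq.
move: (iota 0 m.+1) => js ujs; elim: w => [|a w IHw]; first by elim: (js).
have -> : sumn [seq count (fun b => cls b == j) (a :: w) | j <- js] =
   (count_mem (cls a) js + sumn [seq count (fun b => cls b == j) w | j <- js])%N.
  by elim: (js) => //= j s ->; rewrite (eq_sym j); lia.
by rewrite count_uniq_mem //= -add1n leq_add // leq_b1.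
Qed.

Lemma coef_bound c I w : (size I < c)%N -> `|normal_coef I (elt w)| <= (c ^ size w)%:Z.
Proof.
move=> ltIc; rewrite normal_coefE; apply: le_trans (magnus_bound _ _) _.
rewrite lez_nat; apply: leq_trans (_ : c ^ size (normal_word w) <= _)%N.
  by case: (size (normal_word w)) => // q; rewrite leq_exp2r.
by rewrite leq_pexp2l ?size_normal_word //; lia.
Qed.

(** This is why endomorphisms act by integer matrices: the short coefficients span the polynomial
    functions over the integers. *)
Lemma coef_expansion c (f : G -> int) g : polyfun 0 c f ->
  f g = \sum_(I <- short_seqs N c) normal_coef I g * ldiffs I f 1%g.
Proof.
have [w ->] := eltP g; rewrite -{1}elt_normal_word => /magnus_expansion ->.
by apply: eq_bigr => I _; rewrite normal_coefE.
Qed.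

(** Reduction does not change the element, and the Magnus action of a class part, an invariant of
    the element, determines its reduced form. *)
Lemma FZ_eqP u v : reflect (elt u = elt v)
  (all (fun j => reduce_rev (fun a => cls a == j) u == reduce_rev (fun a => cls a == j) v) (iota 0 m.+1)).
Proof.
apply: (iffP idP) => [/allP uv|uv].
  rewrite -(elt_normal_word u) -(elt_normal_word v) /normal_word.
  elim: (iota 0 m.+1) uv => //= j js IHjs uv.
  rewrite [LHS]elt_cat [RHS]elt_cat; congr (_ * _)%g; last first.
    by apply: IHjs => k kjs; apply: uv; rewrite inE kjs orbT.
  by rewrite /class_part -!elt_reduce (eqP (uv j _)) ?mem_head.
apply/allP => j _; apply/eqP/(can_inj revK).
apply: reduced_magnus_act_inj; rewrite ?reduce_rev_reduced // => phi.
by rewrite !magnus_act_reduce; apply: magnus_act_class_part; apply/elt_ofP.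
Qed.

Lemma elt_neq1_coef w : elt w <> 1%g -> exists j I,
  [/\ (size I <= size w)%N, I != [::] & class_coef j I (elt w) != 0].
Proof.
move=> w1.
have [j red] : exists j, reduce_rev (fun a => cls a == j) w != [::].
  apply: contrapT => none; apply: w1; rewrite -elt_nil; apply/FZ_eqP/allP => j _.
  by apply: contraT => nj; case: none; exists j.
have [|I leI [I0 mI]] := magnus_reduced (reduce_rev_reduced (fun a => cls a == j) w).
  by rewrite -size_eq0 size_rev size_eq0.
exists j, I; split=> //.
  by apply: leq_trans leI _; rewrite size_rev reduce_rev_size.
by rewrite class_coefE; move: mI; rewrite /magnus magnus_act_reduce.
Qed.

(** Take a coefficient of u v^-1 at a nonempty index, which vanishes at 1, and translate it by v.
    The index is no longer than the word, so the separating level is explicit. *)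
Lemma polyfun_separation u v : elt u <> elt v ->
  exists2 f : G -> int, polyfun 0 (size u + size v).+1 f & f (elt u) != f (elt v).
Proof.
move=> uv; have [|j [I [leI I0 fI]]] := @elt_neq1_coef (u ++ inv_word v).
  rewrite elt_cat elt_inv => uv1; apply: uv.
  by apply/eqP; rewrite -divg_eq1 uv1.
exists (fun g => class_coef j I (g * (elt v)^-1)%g).
  apply: polyfun_rtrans; apply: polyfun_leq (polyfun_class_coef _ _).
  by move: leI; rewrite size_cat /inv_word size_rev size_map ltnS.
rewrite mulgV; move: fI; rewrite elt_cat elt_inv.
by rewrite -elt_nil class_coefE /magnus /= (negPf I0).
Qed.

End Coefficients.

Local Close Scope ring_scope.

(** * Uniform periods *)

Local Open Scope ring_scope.

Section Sequences.

(** If the second difference vanishes, the sequence is linear along multiples of [q]; being bounded,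
    it has slope 0. The order of the difference goes down one at a time. *)
Lemma bounded_diff_eq0 (q i : nat) (a : nat -> int) (r : nat) :
  (forall k, `|a k| <= r%:Z) ->
  (forall k, iter i (fun (b : nat -> int) k => b (k + q)%N - b k) a k = 0) -> (0 < i)%N ->
  forall k, a (k + q)%N = a k.
Proof.
elim: i a r => // i IHi a r ar ai0 _.
case: i => [|i] in IHi ai0 *.
  by move=> k; apply/eqP; rewrite -subr_eq0; apply/eqP; exact: ai0.
pose b k := a (k + q)%N - a k.
have br k : `|b k| <= (r + r)%:Z.
  by apply: le_trans (ler_normB _ _) _; rewrite PoszD lerD.
have bq : forall k, b (k + q)%N = b k.
  by apply: (IHi b _ br) => // k; have := ai0 k; rewrite iterSr.
have aM k j : a (k + j * q)%N = a k + j%:Z * b k.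
  elim: j k => [|j IHj] k; first by rewrite mul0n addn0 mul0r addr0.
  rewrite mulSn addnA IHj bq.
  have -> : a (k + q)%N = a k + b k by rewrite /b; ring.
  by rewrite intS; ring.
move=> k; apply/eqP; rewrite -subr_eq0 -/(b k); apply: contraT => bk0.
have := aM k (r + r).+1; have := ar k; have := ar (k + (r + r).+1 * q)%N.
move: bk0; move: (a k) (a _) (b k) => x y z z0 yr xr Dy.
have : `|(r + r).+1%:Z * z| <= (r + r)%:Z by lia.
rewrite normrM => h; have : 1 <= `|z| by lia.
by nia.
Qed.

(* The i-th iterated difference is divisible by [p ^ i] and bounded by [2 ^ i * r], hence
   eventually vanishes. *)
Lemma bounded_divisible_periodic (p q : nat) (S : (nat -> int) -> Prop) : (2 < p)%N ->
  (forall a, S a -> exists r : nat, forall k, `|a k| <= r%:Z) ->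
  (forall a, S a -> exists2 b, S b & forall k, a (k + q)%N - a k = p%:Z * b k) ->
  forall a, S a -> forall k, a (k + q)%N = a k.
Proof.
move=> p3 Sbound Sdiv a Sa.
have [r ar] := Sbound a Sa.
pose D (b : nat -> int) k := b (k + q)%N - b k.
have Dbound i k : `|iter i D a k| <= (2 ^ i * r)%:Z.
  elim: i k => [|i IHi] k; first by rewrite mul1n.
  rewrite /= {1}/D; apply: le_trans (ler_normB _ _) _.
  by rewrite expnS -mulnA mul2n -addnn PoszD lerD.
have Ddiv i : exists2 b, S b & forall k, iter i D a k = (p ^ i)%:Z * b k.
  elim: i => [|i [b Sb Db]]; first by exists a => // k; rewrite mul1r.
  have [b' Sb' Db'] := Sdiv b Sb; exists b' => // k.
  by rewrite /= {1}/D !Db -mulrBr Db' mulrA -PoszM expnSr.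
have [i lti] : exists i, (2 ^ i * r < p ^ i)%N.
  (* For p = 3 this reads 4^r r < 9^r. *)
  exists (2 * r)%N.
  apply: leq_trans (_ : 3 ^ (2 * r) <= _)%N; last first.
    by case: (2 * r)%N => // k; rewrite leq_exp2r.
  rewrite !expnM -[(2 ^ 2)%N]/4%N -[(3 ^ 2)%N]/9%N.
  elim: (r) => [|k IHk]; first by rewrite muln0.
  have : (4 ^ k <= 9 ^ k)%N by case: (k) => // l; rewrite leq_exp2r.
  rewrite !expnSr; nia.
apply: (@bounded_diff_eq0 q i.+1 a r ar) => // k.
have D0 j : iter i D a j = 0.
  have [b _ Db] := Ddiv i; have := Dbound i j; rewrite Db normrM.
  by case: (eqVneq (b j) 0) => [->|b0]; [rewrite mulr0 | move: lti; nia].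
by rewrite iterS -[iter i _ _]/(iter i D a) {1}/D !D0 subrr.
Qed.

Lemma coprime_periods (T : Type) (a : nat -> T) (q q' : nat) : coprime q q' -> (0 < q)%N ->
  (forall k, a (k + q)%N = a k) -> (forall k, a (k + q')%N = a k) -> a 1%N = a 0%N.
Proof.
move=> co q0 aq aq'; case: (egcdnP q' q0) => km kn E _.
have per p (ap : forall k, a (k + p)%N = a k) k i : a (k + i * p)%N = a k.
  by elim: i => [|i IHi]; rewrite ?mul0n ?addn0 // mulSn addnCA addnC ap.
by rewrite -(per q aq 0%N km) -(per q' aq' 1%N kn) E (eqP co) add0n addnC.
Qed.

(** The linear form taking X^k to [a k]: iterated differences become polynomials, to which Frobenius
    applies. *)
Definition seq_eval (a : nat -> int) (P : {poly int}) : int := \sum_(i < size P) P`_i * a i.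

Lemma seq_evalE a (P : {poly int}) k : (size P <= k)%N -> seq_eval a P = \sum_(i < k) P`_i * a i.
Proof.
move=> leP; rewrite /seq_eval (big_ord_widen k (fun i => P`_i * a i)) // big_mkcond /=.
apply: eq_bigr => i _; case: ltnP => // leP'; by rewrite nth_default ?mul0r.
Qed.

Lemma seq_evalD a P Q : seq_eval a (P + Q) = seq_eval a P + seq_eval a Q.
Proof.
pose k := maxn (size P) (size Q).
rewrite !(@seq_evalE a _ k) ?leq_maxl ?leq_maxr ?size_polyD // -big_split.
by apply: eq_bigr => i _; rewrite coefD mulrDl.
Qed.

Lemma seq_evalZ a c P : seq_eval a (c *: P) = c * seq_eval a P.
Proof.
rewrite (@seq_evalE a (c *: P) (size P)) ?size_scale_leq // mulr_sumr.
by apply: eq_bigr => i _; rewrite coefZ mulrA.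
Qed.

Lemma seq_evalB a P Q : seq_eval a (P - Q) = seq_eval a P - seq_eval a Q.
Proof. by rewrite seq_evalD -scaleN1r seq_evalZ mulN1r. Qed.

Lemma seq_evalX a P : seq_eval a ('X * P) = seq_eval (fun i => a i.+1) P.
Proof.
rewrite (@seq_evalE a ('X * P) (size P).+1) ?size_polyXM_leq //; last first.
  by rewrite mulrC; apply: leq_trans (size_polyMleq _ _) _; rewrite size_polyX addn2.
rewrite big_ord_recl coefXM mul0r add0r.
by apply: eq_bigr => i _; rewrite coefXM.
Qed.

Lemma seq_evalXn a k : seq_eval a 'X^k = a k.
Proof.
elim: k a => [|k IHk] a; last by rewrite exprS seq_evalX IHk.
by rewrite /seq_eval size_poly1 big_ord1 coef1 mul1r.
Qed.

End Sequences.

Section IterMorph.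
Variables (G : groupType) (Phi : {multiplicative G -> G}).

Fact iter_multiplicative k : {morph iter k Phi : x y / (x * y)%g}.
Proof. by elim: k => [|k IHk] x y //=; rewrite IHk gmulfM. Qed.

Definition iter_morph k : {multiplicative G -> G} :=
  HB.pack (iter k Phi) (isMultiplicative.Build G G _ (iter_multiplicative k)).

End IterMorph.

(** * Coordinates and the matrix of an endomorphism *)

Section Act.
Variables n m : nat.
Local Notation N := (n + m)%N.
Local Notation G := (presented (@FZ_rel n m) : groupType).
Local Notation elt := (elt_of (@FZ_rel n m) : word N -> G).
Local Notation gen := (generator (@FZ_rel n m)).
Implicit Types (w u v : word N) (Phi : {multiplicative G -> G}) (c : nat).

Definition coord_dim c : nat := size (short_seqs N c).

Lemma coord_dimS c : coord_dim c.+1 = (1 + N * coord_dim c)%N.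
Proof. by rewrite /coord_dim /= size_allpairs -cardE card_ord. Qed.

Definition coords c (g : G) : 'rV[int]_(coord_dim c) :=
  \row_i normal_coef (nth [::] (short_seqs N c) i) g.

(** Column j holds the Taylor coefficients of the j-th coordinate composed with [Phi]. The
    coordinates span but need not be independent, so this is one of possibly many matrices
    satisfying [coords_act]. *)
Definition act_mx c Phi : 'M[int]_(coord_dim c) :=
  \matrix_(i, j) ldiffs (nth [::] (short_seqs N c) i)
                  (fun g => normal_coef (nth [::] (short_seqs N c) j) (Phi g)) 1%g.

Lemma nth_short_seqs c (i : 'I_(coord_dim c)) : (size (nth [::] (short_seqs N c) i) < c)%N.
Proof. by rewrite -mem_short_seqs mem_nth. Qed.

Lemma polyfun_coord c (i : 'I_(coord_dim c)) :
  polyfun 0 c (normal_coef (nth [::] (short_seqs N c) i) : G -> int).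
Proof. exact: polyfun_leq (nth_short_seqs i) (polyfun_coef _). Qed.

Lemma coords_expansion c (f : G -> int) g : polyfun 0 c f ->
  f g = \sum_(i < coord_dim c) coords c g 0 i * ldiffs (nth [::] (short_seqs N c) i) f 1%g.
Proof.
move=> pf; rewrite (coef_expansion _ pf) (big_nth [::]) big_mkord.
by apply: eq_bigr => i _; rewrite mxE.
Qed.

Lemma coords_act c Phi g : coords c (Phi g) = coords c g *m act_mx c Phi.
Proof.
apply/rowP => j; rewrite mxE [RHS]mxE.
rewrite (@coords_expansion c (fun g => normal_coef (nth [::] (short_seqs N c) j) (Phi g))).
  by apply: eq_bigr => i _; rewrite [act_mx _ _ _ _]mxE.
exact: polyfun_comp (polyfun_coord j).
Qed.

Lemma coords_iter c Phi k g : coords c (iter k Phi g) = coords c g *m act_mx c Phi ^+ k.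
Proof.
elim: k => [|k IHk]; first by rewrite expr0 mulmx1.
by rewrite /= coords_act IHk exprSr -mulmxE mulmxA.
Qed.

Lemma coords_eqP c g h :
  coords c g = coords c h <-> forall f : G -> int, polyfun 0 c f -> f g = f h.
Proof.
split=> [gh f pf|gh].
  by rewrite !(coords_expansion _ pf) gh.
by apply/rowP => i; rewrite !mxE; apply: gh; exact: polyfun_coord.
Qed.

Lemma coords_bound c w i : `|coords c (elt w) 0 i| <= (c ^ size w)%:Z.
Proof. by rewrite mxE; apply: coef_bound; apply: nth_short_seqs. Qed.

Section Period.
Variable Phi : {multiplicative G -> G}.
Let M := idem_exp 5 N.
Let Psi := iter_morph Phi M.

Lemma Psi_iter k g : iter k Psi g = iter (k * M) Phi g.
Proof. by elim: k => //= k IHk; rewrite IHk mulSn iterD. Qed.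

(** [Phi] may be singular, so [Psi] is idempotent on H_1 modulo p rather than the identity; hence
    Psi^2 is compared with Psi. *)
Let step (f : G -> int) : G -> int := fun g => f (Psi (Psi g)) - f (Psi g).

Lemma step_polyfun p c (f : G -> int) : prime p -> (p <= 5)%N ->
  polyfun p c.+1 f -> polyfun p c (step f).
Proof.
move=> p_pr lep5 pf.
have := @polyfun_congr _ _ p%:Z c f (iter_morph Psi 2) Psi _ pf; apply=> h.
exists (word_of (Psi (Psi h))), (word_of (Psi h)); rewrite !word_ofK; split=> // i.
have [E DE] := idem_mod (abel_mx Phi) p_pr lep5.
have -> : expsum i (word_of (Psi (Psi h))) - expsum i (word_of (Psi h)) =
    (abelG (iter (2 * M) Phi h) - abelG (iter M Phi h)) 0 i.
  by rewrite mul2n -addnn iterD !mxE.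
rewrite !(abelG_iter (@FZ_balanced n m)) -mulmxBr DE -scalemxAr mxE; exact: dvdz_mulr.
Qed.

Lemma step_nilpotent p c (f : G -> int) k : prime p -> (p <= 5)%N -> (c <= k)%N ->
  polyfun p c f -> polyfun p 0 (iter k step f).
Proof.
move=> p_pr lep5; elim: k c f => [|k IHk] c f; first by rewrite leqn0 => /eqP->.
rewrite iterSr; case: c => [|c] ck pf.
  by apply: (IHk 0%N) => // g; rewrite /step rpredB //; apply: pf.
by apply: (IHk c) => //; apply: step_polyfun.
Qed.

Lemma iter_step_eval k (f : G -> int) g :
  iter k step f g = seq_eval (fun i => f (iter i Psi g)) (('X^2 - 'X) ^+ k).
Proof.
elim: k f g => [|k IHk] f g; first by rewrite expr0 -(expr0 'X) seq_evalXn.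
rewrite iterSr IHk (exprS _ k); set P := _ ^+ k; set a := fun i => f (iter i Psi g).
have -> : seq_eval a (('X^2 - 'X) * P) =
    seq_eval (fun i => a i.+2) P - seq_eval (fun i => a i.+1) P.
  by rewrite mulrBl seq_evalB expr2 -mulrA !seq_evalX.
by rewrite /seq_eval -sumrB; apply: eq_bigr => i _; rewrite -mulrBr.
Qed.

Lemma poly_frobenius (p s : nat) : prime p -> exists R : {poly int},
  ('X^2 - 'X) ^+ (p ^ s) = 'X^(2 * p ^ s) - 'X^(p ^ s) + p%:Z *: R.
Proof.
move=> p_pr; set q := (p ^ s)%N.
pose A : {poly int} := ('X^2 - 'X) ^+ q - ('X^(2 * q) - 'X^q).
have A0 : map_poly (intr : int -> 'F_p) A = 0.
  have pch : p \in [pchar {poly 'F_p}] by rewrite pchar_poly pchar_Fp.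
  have qnat : ([pchar {poly 'F_p}]).-nat q.
    by rewrite (eq_pnat _ (pcharf_eq pch)) pnatX pnat_id.
  rewrite /A !rmorphB !rmorphXn /= rmorphB rmorphXn /= !map_polyX.
  have Dpow : ('X^2 : {poly 'F_p}) ^+ q - 'X ^+ q = ('X^2 - 'X) ^+ q.
    by have := exprDn_pchar ('X^2 - 'X) 'X qnat; rewrite subrK => ->; rewrite addrK.
  by rewrite -Dpow -exprM subrr.
exists (map_poly (fun x => (x %/ p)%Z) A).
have -> : p%:Z *: map_poly (fun x => (x %/ p)%Z) A = A.
  apply/polyP => i; rewrite coefZ coef_map_id0 ?div0z // mulrC divzK //.
  rewrite (dvdz_pcharf (pchar_Fp p_pr)).
  by move/polyP/(_ i): A0; rewrite coef_map coef0 => ->.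
by rewrite /A [RHS]addrC subrK.
Qed.

(** At least c steps kill [f] modulo p. Taking p^c of them lets Frobenius reduce (X^2 - X)^(p^c) to
    two terms; division by p keeps the degree. *)
Lemma iter_Psi_mod (p c : nat) (f : G -> int) : prime p -> (p <= 5)%N -> polyfun 0 c f ->
  exists2 h : G -> int, polyfun 0 c h &
    forall g, f (iter (2 * p ^ c) Psi g) - f (iter (p ^ c) Psi g) = p%:Z * h g.
Proof.
move=> p_pr lep5 pf; set q := (p ^ c)%N.
have leq_cq : (c <= q)%N by rewrite ltnW // ltn_expl // prime_gt1.
have p0 : p%:Z != 0 by rewrite eqz_nat -lt0n prime_gt0.
have [R DR] := poly_frobenius c p_pr.
pose h0 g := f (iter (2 * q) Psi g) - f (iter q Psi g).
have dvdh g : (p%:Z %| h0 g)%Z.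
  have := step_nilpotent p_pr lep5 leq_cq (polyfun_dvd p pf) g.
  rewrite iter_step_eval DR !seq_evalD -scaleN1r !seq_evalZ !seq_evalXn mulN1r -/(h0 g).
  by rewrite rpredDr // dvdz_mulr.
exists (fun g => (h0 g %/ p%:Z)%Z) => [|g]; last by rewrite mulrC divzK.
apply: polyfun_div => //; apply: polyfunB.
  exact: (polyfun_comp (iter_morph Psi (2 * q)) pf).
exact: (polyfun_comp (iter_morph Psi q) pf).
Qed.

Lemma uniform_period c y e : (0 < e)%N ->
  (forall f : G -> int, polyfun 0 c f -> f (iter e Phi y) = f y) ->
  forall f : G -> int, polyfun 0 c f -> f (iter M Phi y) = f y.
Proof.
move=> e0 per.
have pcomp k f : polyfun 0 c f -> polyfun 0 c (fun g => f (iter k Psi g)).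
  exact: (polyfun_comp (iter_morph Psi k)).
have perPhi k f : polyfun 0 c f -> f (iter (k * e) Phi y) = f y.
  elim: k => [|k IHk] // pf.
  rewrite mulSn [(e + _)%N]addnC iterD (per (fun g => f (iter (k * e) Phi g))); first exact: IHk.
  exact: (polyfun_comp (iter_morph Phi (k * e)) pf).
have perPsi k i f : polyfun 0 c f -> f (iter (k + i * e) Psi y) = f (iter k Psi y).
  move=> pf; rewrite iterD (Psi_iter (i * e)).
  have -> : (i * e * M = (i * M) * e)%N by rewrite -!mulnA [(e * M)%N]mulnC.
  by rewrite (perPhi (i * M)%N (fun g => f (iter k Psi g))) //; apply: pcomp.
(* All functions of the level are taken together so that [S] is closed under the division by p. *)
pose S a := exists2 f : G -> int, polyfun 0 c f & a = fun k => f (iter k Psi y).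
have Sper p : prime p -> (2 < p <= 5)%N -> forall a, S a -> forall k, a (k + p ^ c)%N = a k.
  move=> p_pr /andP[p2 p5]; apply: (bounded_divisible_periodic p2).
    move=> a [f pf ->]; exists (\sum_(k < e) `|f (iter k Psi y)|%N)%N => k.
    rewrite (divn_eq k e) [(k %/ e * e + _)%N]addnC perPsi //.
    have lte : (k %% e < e)%N by rewrite ltn_mod.
    by rewrite (bigD1 (Ordinal lte)) //= PoszD abszE ler_wpDr.
  move=> a [f pf ->]; have [h ph Dh] := iter_Psi_mod p_pr p5 pf.
  set q := (p ^ c)%N in Dh *; set t := ((e - 1) * q)%N.
  exists (fun k => h (iter t Psi (iter k Psi y))).
    by exists (fun g => h (iter t Psi g)) => //; exact: pcomp.
  have De : e = ((e - 1) + 1)%N by rewrite subnK.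
  move=> k; rewrite -Dh.
  have -> : iter (2 * q) Psi (iter t Psi (iter k Psi y)) = iter (k + q + q * e) Psi y.
    by rewrite -!iterD; congr iter; rewrite /t [in RHS]De; nia.
  have -> : iter q Psi (iter t Psi (iter k Psi y)) = iter (k + q * e) Psi y.
    by rewrite -!iterD; congr iter; rewrite /t [in RHS]De; nia.
  by rewrite !perPsi.
move=> f pf.
have Sf : S (fun k => f (iter k Psi y)) by exists f.
apply: (@coprime_periods _ (fun k => f (iter k Psi y)) (3 ^ c) (5 ^ c)).
- by rewrite coprimeXl ?coprimeXr.
- by rewrite expn_gt0.
- by apply: Sper Sf.
- by apply: Sper Sf.
Qed.

End Period.
End Act.

Local Close Scope ring_scope.

(** * Subgroups of free groups *)

Local Open Scope ring_scope.

Definition no_rel r (_ _ : word r) := False.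
Local Notation free r := (presented (@no_rel r) : groupType).

Lemma free_balanced r : balanced (@no_rel r). Proof. by []. Qed.

Section Universal.
Variables (r : nat) (K : groupType) (x : 'I_r -> K).

Fixpoint word_eval (w : word r) : K :=
  if w is a :: w' then ((if a.2 then (x a.1)^-1 else x a.1) * word_eval w')%g else 1%g.

Lemma word_eval_cat u v : word_eval (u ++ v) = (word_eval u * word_eval v)%g.
Proof. by elim: u => [|a u IHu] /=; rewrite ?mul1g // IHu mulgA. Qed.

Lemma word_eval_pres (R : word r -> word r -> Prop) u v :
  (forall u v, R u v -> word_eval u = word_eval v) ->
  pres_eq R u v -> word_eval u = word_eval v.
Proof.
move=> RE; elim=> {u v} //; first by move=> u v w _ -> _ ->.
  by move=> u u' v v' _ E1 _ E2; rewrite !word_eval_cat E1 E2.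
by case=> i b /=; case: b; rewrite /= mulg1 ?mulVg ?mulgV.
Qed.

Definition free_lift_fun (g : free r) : K := word_eval (word_of g).

Lemma free_lift_elt w : free_lift_fun (elt_of _ w) = word_eval w.
Proof. by apply: word_eval_pres (word_of_elt _ _). Qed.

Fact free_lift_mul : {morph free_lift_fun : g h / (g * h)%g}.
Proof.
by move=> g h; rewrite -(word_ofK g) -(word_ofK h) -elt_cat !free_lift_elt word_eval_cat.
Qed.

Definition free_lift : {multiplicative free r -> K} :=
  HB.pack free_lift_fun (isMultiplicative.Build _ _ _ free_lift_mul).

Lemma free_lift_gen i : free_lift (generator _ i) = x i.
Proof. by rewrite /= [LHS]free_lift_elt /= mulg1. Qed.

End Universal.

Lemma free_morph_elt r (K : groupType) (f : {multiplicative free r -> K}) w :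
  f (elt_of _ w) = word_eval (fun i => f (generator _ i)) w.
Proof.
elim: w => [|[i b] w IHw]; first exact: mult_morph1.
by rewrite elt_cons gmulfM IHw /=; case: b; rewrite ?mult_morphV.
Qed.

Lemma free_magnus_act r u v phi : pres_eq (@no_rel r) u v -> magnus_act u phi = magnus_act v phi.
Proof.
move=> uv; elim: uv phi => {u v} //.
- by move=> u v w _ IHu _ IHv phi; rewrite IHu.
- by move=> u u' v v' _ IHu _ IHv phi; rewrite !magnus_act_cat IHu IHv.
- by move=> a phi; rewrite /= magnus_act_cancel.
Qed.

Lemma free_separation r (g : free r) : g <> 1%g ->
  exists c, exists2 f : free r -> int, polyfun 0 c f & f g <> f 1%g.
Proof.
have [w ->] := eltP g => w1.
have [|I _ [I0 mI]] := magnus_reduced (reduce_rev_reduced xpredT w).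
  apply: contra_notN w1 => /eqP red.
  by rewrite -[w]filter_predT -elt_reduce red.
pose coef J (h : free r) := magnus (word_of h) J.
have coefE J u : coef J (elt_of _ u) = magnus u J.
  by rewrite /coef /magnus (free_magnus_act _ (word_of_elt _ u)).
exists (size I).+1, (coef I); last first.
  rewrite -elt_nil !coefE; move: mI; rewrite /magnus magnus_act_reduce filter_predT.
  by rewrite /= (negPf I0) => /eqP.
elim: (I) => [|b J IHJ]; apply: polyfun_gen => i.
  have -> : ldiff (generator _ i) (coef [::]) = fun=> 0; last exact: polyfun0.
  apply: funext => h; have [u ->] := eltP h.
  by rewrite /ldiff -(elt_cons _ i false) !coefE /magnus /= /magnus_letter /= /magnus_pos addr0 subrr.
have -> : ldiff (generator _ i) (coef (b :: J)) = if b == i then coef J else fun=> 0.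
  apply: funext => h; have [u ->] := eltP h.
  rewrite /ldiff -(elt_cons _ i false) (fun_if (fun f => f (elt_of _ u))) !coefE.
  by rewrite /magnus /= /magnus_letter /= /magnus_pos addrC addKr.
by case: ifP => _ //; exact: polyfun0.
Qed.

(** By [polyfun_congr] the function f o tau - f has lower degree, so by induction it agrees at [g]
    and 1; as tau(g) = tau(1), so does f, and no polynomial function separates [g] from 1. *)
Lemma abel_trivial_inj r (tau : {multiplicative free r -> free r}) :
  (forall g, abelG (tau g) = abelG g) -> forall g, tau g = 1%g -> g = 1%g.
Proof.
move=> abtau g tg1; apply: contrapT => /free_separation[c [f pf]]; apply.
elim: c f pf => [|c IHc] f pf.
  by have := pf g; have := pf 1%g; rewrite !dvd0z => /eqP-> /eqP->.
have pk : polyfun 0 c (fun h => f (tau h) - f h).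
  have := @polyfun_congr _ _ 0 c f tau idfun _ pf; apply=> h.
  exists (word_of (tau h)), (word_of h); rewrite !word_ofK; split=> // i.
  by have /rowP/(_ i) := abtau h; rewrite /abelG !mxE => ->; rewrite subrr dvdz0.
have := IHc _ pk; rewrite tg1 mult_morph1 subrr => /eqP.
by rewrite subr_eq0 => /eqP.
Qed.

Lemma free_surjection_rank k d (theta : {multiplicative free k -> free d}) :
  (forall h, exists g, theta g = h) -> (d <= k)%N.
Proof.
move=> surj; have [x xP] := choice (fun j => surj (generator _ j)).
apply: (@mulmx1_min int d k (abel_mx (free_lift x)) (abel_mx theta)).
apply/row_matrixP => j.
rewrite row_mul rowK free_lift_gen -abelG_act ?xP //; try exact: free_balanced.
by rewrite abelG_gen ?row1 //; exact: free_balanced.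
Qed.

(** Lifting the generators gives a section [chi]. A one-sided inverse of a square integer matrix is
    two-sided, so [chi \o theta] is the identity on H_1, hence injective. *)
Lemma free_hopfian k (theta : {multiplicative free k -> free k}) :
  (forall h, exists g, theta g = h) -> forall g, theta g = 1%g -> g = 1%g.
Proof.
move=> surj; have [x xP] := choice (fun j => surj (generator _ j)).
pose chi := free_lift x; have bal := @free_balanced k.
have AB : abel_mx chi *m abel_mx theta = 1%:M.
  apply/row_matrixP => j; rewrite row_mul rowK free_lift_gen -abelG_act // xP.
  by rewrite abelG_gen // row1.
move=> g tg1.
have := @abel_trivial_inj _ (chi \o theta : {multiplicative _ -> _}); apply.
  by move=> h; change (abelG (chi (theta h)) = abelG h); rewrite !abelG_act // -mulmxA (mulmx1C AB) mulmx1.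
by change (chi (theta g) = 1%g); rewrite tg1 mult_morph1.
Qed.

Local Close Scope ring_scope.
Local Open Scope group_scope.

(** * The Schreier graph of a subgroup *)

Section Schreier.
Variables (n : nat) (S : free n -> Prop).
Hypotheses (S1 : S 1) (SM : forall g h, S g -> S h -> S (g * h)) (SV : forall g, S g -> S g^-1).
Local Notation elt := (elt_of (@no_rel n) : word n -> free n).
Local Notation gen := (generator (@no_rel n)).
Implicit Types (t u v w : seq ('I_n * bool)) (a : 'I_n * bool).

Lemma elt_rcons w a : elt (rcons w a) = elt w * elt [:: a].
Proof. by rewrite -cats1 elt_cat. Qed.

(* Digits in base 2n + 1, the leading letter being the most significant one: an
   injective numbering for which appending a letter is monotone, so that the least
   representatives of the cosets are closed under prefixes. *)
Definition word_num w : nat := foldl (fun acc a => acc * n.*2.+1 + (code_letter a).+1) 0 w.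

Lemma word_num_rcons w a : word_num (rcons w a) = word_num w * n.*2.+1 + (code_letter a).+1.
Proof. by rewrite /word_num foldl_rcons. Qed.

Lemma word_num_inj : injective word_num.
Proof.
move=> u v; elim/last_ind: u v => [|u a IHu] v; elim/last_ind: v => [|v b _] //;
  rewrite ?word_num_rcons //; try by rewrite /word_num /=; lia.
have lt a' : (code_letter a').+1 < n.*2.+1.
  by rewrite /code_letter; case: a' => i []; have := ltn_ord i; rewrite /=; lia.
move=> E; have := congr1 (modn^~ n.*2.+1) E; have := congr1 (divn^~ n.*2.+1) E.
rewrite /= !divnMDl // !divn_small // !addn0 !modnMDl !modn_small // => /IHu -> [].
by move/code_letter_inj ->.
Qed.

Definition same_coset u v : Prop := S (elt u * (elt v)^-1).

Lemma same_coset_refl u : same_coset u u.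
Proof. by rewrite /same_coset mulgV. Qed.

Lemma same_coset_sym u v : same_coset u v -> same_coset v u.
Proof. by move/SV; rewrite /same_coset invgF. Qed.

Lemma same_coset_trans u v w : same_coset u v -> same_coset v w -> same_coset u w.
Proof. by move=> uv vw; have := SM uv vw; rewrite /same_coset -mulgA mulKg. Qed.

Lemma same_coset_cat u v w : same_coset u v -> same_coset (u ++ w) (v ++ w).
Proof. by rewrite /same_coset !elt_cat invgM mulgA mulgK. Qed.

Lemma same_coset_elt u v : elt u = elt v -> same_coset u v.
Proof. by rewrite /same_coset => ->; rewrite mulgV. Qed.

Lemma coset_rep_ex w : exists t, same_coset w t /\ forall v, same_coset w v -> word_num t <= word_num v.
Proof.
have exk : exists k, `[<exists t, same_coset w t /\ word_num t = k>].
  by exists (word_num w); apply/asboolP; exists w; split=> //; exact: same_coset_refl.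
case: (ex_minnP exk) => k /asboolP[t [wt Dk]] kmin; exists t; split=> // v wv.
by rewrite Dk; apply: kmin; apply/asboolP; exists v.
Qed.

Definition coset_rep w := projT1 (cid (coset_rep_ex w)).

Lemma same_rep w : same_coset w (coset_rep w).
Proof. by rewrite /coset_rep; case: cid => t []. Qed.

Lemma rep_min w v : same_coset w v -> word_num (coset_rep w) <= word_num v.
Proof. by rewrite /coset_rep; case: cid => t [_ ] /= h; exact: h. Qed.

Lemma rep_eq u v : same_coset u v -> coset_rep u = coset_rep v.
Proof.
move=> uv; apply: word_num_inj; apply/eqP; rewrite eqn_leq !rep_min //.
  exact: same_coset_trans (same_coset_sym uv) (same_rep u).
exact: same_coset_trans uv (same_rep v).
Qed.

Lemma rep_rep w : coset_rep (coset_rep w) = coset_rep w.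
Proof. by apply: rep_eq; apply: same_coset_sym; exact: same_rep. Qed.

Lemma rep_nil : coset_rep [::] = [::].
Proof.
apply: word_num_inj; apply/eqP; rewrite eqn_leq rep_min //; exact: same_coset_refl.
Qed.

(** A smaller word in the coset of [t] would give, with [a] appended, a smaller one for [rcons t a].
    So the representatives form a spanning tree of the coset graph. *)
Lemma rep_prefix t a : coset_rep (rcons t a) = rcons t a -> coset_rep t = t.
Proof.
move=> Dt; apply: word_num_inj; apply/eqP; rewrite eqn_leq rep_min /=; last exact: same_coset_refl.
have : same_coset (rcons t a) (rcons (coset_rep t) a).
  by rewrite -!cats1; apply: same_coset_cat; exact: same_rep.
by move/rep_min; rewrite Dt !word_num_rcons leq_add2r leq_pmul2r.
Qed.

Lemma rep_cat w v : coset_rep (coset_rep w ++ v) = coset_rep (w ++ v).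
Proof. by apply: rep_eq; apply: same_coset_cat; apply: same_coset_sym; exact: same_rep. Qed.

Definition coset_next t a := coset_rep (rcons t a).

Lemma next_cancel t a : coset_rep t = t -> coset_next (coset_next t a) (inv_letter a) = t.
Proof.
move=> Dt; rewrite /coset_next -!cats1 rep_cat -catA -[RHS]Dt; apply: rep_eq; apply: same_coset_elt.
rewrite elt_cat -[RHS]mulg1 -elt_nil; congr (_ * _).
by apply/elt_ofP; exact: pres_cancel.
Qed.

Definition path_end t w := foldl coset_next t w.

Lemma path_endE t w : coset_rep t = t -> path_end t w = coset_rep (t ++ w).
Proof.
elim: w t => [|a w IHw] t Dt /=; first by rewrite cats0.
by rewrite IHw ?rep_rep // /coset_next rep_cat cat_rcons.
Qed.

(** Edges are recorded in the positive direction, while the tree may traverse them either way. *)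
Definition tree_edge t (i : 'I_n) : Prop :=
  coset_next t (i, false) = rcons t (i, false) \/ t = rcons (coset_next t (i, false)) (i, true).

Section Cocycle.
Variables (K : groupType) (phi : seq ('I_n * bool) -> 'I_n -> K).

(** A negative letter crosses backwards the edge that starts at its end point. *)
Definition path_step t a : K := if a.2 then (phi (coset_next t a) a.1)^-1 else phi t a.1.

Fixpoint path_val t w : K := if w is a :: w' then path_step t a * path_val (coset_next t a) w' else 1.

Lemma path_val_cat t u v : path_val t (u ++ v) = path_val t u * path_val (path_end t u) v.
Proof. by elim: u t => [|a u IHu] t /=; rewrite ?mul1g // IHu mulgA. Qed.

Lemma path_val_pres u v t : coset_rep t = t -> pres_eq (@no_rel n) u v -> path_val t u = path_val t v.
Proof.
move=> Dt uv; elim: uv t Dt => {u v} //.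
- by move=> u v _ IH t Dt; rewrite IH.
- by move=> u v w _ IH1 _ IH2 t Dt; rewrite IH1 ?IH2.
- move=> u u' v v' uu' IH1 _ IH2 t Dt; rewrite !path_val_cat IH1 //; congr (_ * _).
  have -> : path_end t u = path_end t u'.
    rewrite !path_endE //; apply/rep_eq/same_coset_elt.
    by rewrite !elt_cat; congr (_ * _); apply/elt_ofP.
  by apply: IH2; rewrite path_endE // rep_rep.
case=> i b t Dt /=; rewrite mulg1 /path_step /=.
have := next_cancel (i, b) Dt; rewrite /inv_letter /=; case: b => /= Dn.
  by rewrite mulVg.
by rewrite Dn mulgV.
Qed.

Hypothesis phi_tree : forall t i, coset_rep t = t -> tree_edge t i -> phi t i = 1.

Lemma path_val_rep t : coset_rep t = t -> path_val [::] t = 1.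
Proof.
elim/last_ind: t => [//|t [i b] IHt] Dta; have Dt := rep_prefix Dta.
rewrite -cats1 path_val_cat IHt // mul1g path_endE ?rep_nil //= Dt mulg1 /path_step /=.
case: b Dta => Dta /=; last by apply: phi_tree => //; left.
rewrite phi_tree ?invg1 //; first by rewrite /coset_next rep_rep.
right; rewrite /coset_next in Dta *; rewrite Dta.
by have := next_cancel (i, true) Dt; rewrite /coset_next Dta => ->.
Qed.

Lemma path_val_schreier t i : coset_rep t = t ->
  path_val [::] (rcons t (i, false) ++ inv_word (coset_next t (i, false))) = phi t i.
Proof.
move=> Dt; set s := coset_next t (i, false).
have Ds : coset_rep s = s by rewrite /s /coset_next rep_rep.
have r0 := rep_nil.
rewrite path_val_cat -cats1 path_val_cat path_val_rep // mul1g !path_endE //= Dt mulg1.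
rewrite {1}/path_step /= cats1 -/(coset_next t (i, false)) -/s.
have := path_val_pres r0 (pres_catV (@no_rel n) s).
by rewrite path_val_cat path_val_rep // mul1g path_endE //= Ds => ->; rewrite mulg1.
Qed.

(** Multiplicativity is proved for a left factor in [S], whose path returns to the base point. *)
Definition subgroup_hom (g : free n) : K := path_val [::] (word_of g).

Lemma subgroup_hom_elt w : subgroup_hom (elt w) = path_val [::] w.
Proof. by apply: path_val_pres rep_nil (word_of_elt _ w). Qed.

Lemma subgroup_homM g h : S g -> subgroup_hom (g * h) = subgroup_hom g * subgroup_hom h.
Proof.
rewrite -(word_ofK g) -(word_ofK h) => Sg.
rewrite -elt_cat !subgroup_hom_elt path_val_cat path_endE ?rep_nil //.
have -> : coset_rep ([::] ++ word_of g) = [::]; last by [].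
rewrite -[RHS]rep_nil; apply: rep_eq.
by rewrite /same_coset elt_nil invg1 mulg1.
Qed.

End Cocycle.

Definition schreier t i : free n := elt (rcons t (i, false)) * (elt (coset_next t (i, false)))^-1.

Lemma schreier_in t i : S (schreier t i).
Proof. exact: same_rep. Qed.

Lemma schreier_tree t i : coset_rep t = t -> tree_edge t i -> schreier t i = 1.
Proof.
move=> Dt [Dn|Dn]; first by rewrite /schreier Dn mulgV.
have E : elt [:: (i, true)] * elt [:: (i, false)] = 1.
  by rewrite -elt_cat; apply/elt_ofP; exact: (pres_cancel _ (i, true)).
by rewrite /schreier {1}Dn !elt_rcons -[_ * _ * elt [:: (i, false)]]mulgA E mulg1 mulgV.
Qed.

(** Reidemeister-Schreier rewriting: insert s^-1 s after each letter, s being the representative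
    just reached. *)
Lemma schreier_telescope t w : coset_rep t = t ->
  elt t * elt w = path_val schreier t w * elt (path_end t w).
Proof.
elim: w t => [|[i b] w IHw] t Dt /=; first by rewrite mulg1 mul1g.
rewrite -mulgA -IHw ?/coset_next ?rep_rep // -/(coset_next t (i, b)) -cat1s elt_cat !mulgA; congr (_ * _).
rewrite /path_step; case: b => /=; last by rewrite /schreier elt_rcons mulgVK.
rewrite /schreier elt_rcons.
have := next_cancel (i, true) Dt; rewrite /inv_letter /= => ->.
rewrite !invgM invgK -!mulgA mulVg mulg1; congr (_ * _).
by rewrite !elt_cons elt_nil !mulg1.
Qed.

Variables (k : nat) (psi : {multiplicative free k -> free n}).
Hypotheses (psiS : forall g, S (psi g)) (Spsi : forall h, S h -> exists g, psi g = h).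

Definition off_tree (L : seq (seq ('I_n * bool) * 'I_n)) : Prop :=
  uniq L /\ forall t i, (t, i) \in L -> coset_rep t = t /\ ~ tree_edge t i.

(** Listed edges carry the free generators and all others 1, so [S] is mapped onto the free group on
    the list. *)
Definition basis_hom (L : seq (seq ('I_n * bool) * 'I_n)) t i : free (size L) :=
  if insub (index (t, i) L) is Some j then generator _ j else 1.

Lemma basis_hom_tree L t i : off_tree L -> coset_rep t = t -> tree_edge t i -> basis_hom L t i = 1.
Proof.
move=> [_ offL] Dt tr; rewrite /basis_hom insubF // index_mem.
by apply/negP => /offL[].
Qed.

Lemma subgroup_hom_schreier L t i : off_tree L -> coset_rep t = t ->
  subgroup_hom (basis_hom L) (schreier t i) = basis_hom L t i.
Proof.
move=> offL Dt; rewrite /schreier -elt_inv -elt_cat subgroup_hom_elt path_val_schreier //.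
by move=> t' i'; exact: basis_hom_tree.
Qed.

Section Theta.
Variable L : seq (seq ('I_n * bool) * 'I_n).
Hypothesis offL : off_tree L.

Definition theta_fun (g : free k) : free (size L) := subgroup_hom (basis_hom L) (psi g).

Fact theta_mul : {morph theta_fun : g h / g * h}.
Proof. by move=> g h; rewrite /theta_fun gmulfM subgroup_homM. Qed.

Definition theta : {multiplicative free k -> free (size L)} :=
  HB.pack theta_fun (isMultiplicative.Build _ _ theta_fun theta_mul).

Lemma theta_surjective h : exists g, theta g = h.
Proof.
have [w ->] := eltP h; elim: w => [|[j b] w [g Dg]].
  by exists 1; rewrite mult_morph1.
have [x Dx] : exists x, theta x = generator _ j.
  case Dp: (tnth (in_tuple L) j) => [t i].
  have memL : (t, i) \in L by rewrite -Dp -[X in _ \in X]/(tval (in_tuple L)) mem_tnth.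
  have [Dt _] := offL.2 t i memL.
  have [x Dx] := Spsi (schreier_in t i); exists x.
  rewrite /= /theta_fun Dx subgroup_hom_schreier // /basis_hom.
  rewrite insubT ?index_mem // => lt; congr generator; apply: val_inj => /=.
  by rewrite -Dp (tnth_nth (t, i)) /= index_uniq //; exact: offL.1.
rewrite elt_cons; case: b; [exists (x^-1 * g) | exists (x * g)].
  by rewrite gmulfM mult_morphV Dx Dg.
by rewrite gmulfM Dx Dg.
Qed.

Lemma size_off_tree : size L <= k.
Proof. exact: free_surjection_rank theta_surjective. Qed.

End Theta.

(** The free group of rank k maps onto [S], and so onto the free group on any list of edges off the
    tree. Such lists have length at most k, and one of maximal length contains all these edges. *)
Lemma max_off_tree : exists2 L, off_tree L &
  forall t i, coset_rep t = t -> ~ tree_edge t i -> (t, i) \in L.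
Proof.
have exd : exists d, `[<exists2 L, off_tree L & size L = d>].
  by exists 0; apply/asboolP; exists [::].
have maxd d : `[<exists2 L, off_tree L & size L = d>] -> d <= k.
  by move=> /asboolP[L offL <-]; exact: size_off_tree.
case: (ex_maxnP exd maxd) => d /asboolP[L offL sL] dmax; exists L => // t i Dt ntr.
apply: contraT => nL; suff : d.+1 <= d by rewrite ltnn.
apply: dmax; apply/asboolP; exists ((t, i) :: L); last by rewrite /= sL.
split=> [|t' i'] /=; first by rewrite nL offL.1.
by rewrite inE => /orP[/eqP[-> ->]|] //; exact: offL.2.
Qed.

(** With k edges off the tree, [theta] would be a surjection between free groups of equal rank,
    hence injective, yet it kills [g0]. So fewer than k Schreier generators generate [S]. *)
Lemma schreier_rank_drop (g0 : free k) : g0 <> 1 -> psi g0 = 1 ->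
  exists2 d, d < k & exists psi' : {multiplicative free d -> free n},
    forall h, S h <-> exists g, psi' g = h.
Proof.
move=> g01 psig0; have [L offL maxL] := max_off_tree.
pose x (j : 'I_(size L)) := schreier (tnth (in_tuple L) j).1 (tnth (in_tuple L) j).2.
have ltd : size L < k.
  rewrite ltn_neqAle size_off_tree // andbT; apply/negP => /eqP sL.
  have: theta L g0 = 1.
    by rewrite /= /theta_fun psig0 -elt_nil subgroup_hom_elt.
  have := theta_surjective offL; move: (theta L); rewrite sL => th surj.
  by move/(free_hopfian surj).
exists (size L) => //; exists (free_lift x) => h; split; last first.
  case=> g <-; have [w ->] := eltP g; rewrite free_morph_elt.
  have -> : (fun j => free_lift x (generator _ j)) = x by apply: funext => j; rewrite free_lift_gen.
  elim: w => //= -[j b] w IHw; apply: SM => //=.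
  by case: b; [apply: SV|]; exact: schreier_in.
have sch t i : coset_rep t = t -> exists g, free_lift x g = schreier t i.
  move=> Dt; case: (pselect (tree_edge t i)) => [tr|ntr].
    by exists 1; rewrite mult_morph1 schreier_tree.
  have memL := maxL t i Dt ntr.
  have lti : index (t, i) L < size L by rewrite index_mem.
  exists (generator _ (Ordinal lti)); rewrite free_lift_gen /x.
  by rewrite (tnth_nth (t, i)) /= nth_index.
have pathI t w : coset_rep t = t -> exists g, free_lift x g = path_val schreier t w.
  elim: w t => [|[i b] w IHw] t Dt; first by exists 1; exact: mult_morph1.
  have Dn : coset_rep (coset_next t (i, b)) = coset_next t (i, b) by rewrite /coset_next rep_rep.
  have [g1 E1] := IHw _ Dn.
  have [g2 E2] : exists g, free_lift x g = path_step schreier t (i, b).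
    case: b {E1} Dn => Dn; last exact: sch.
    by have [g Dg] := sch _ i Dn; exists g^-1; rewrite mult_morphV Dg.
  by exists (g2 * g1); rewrite gmulfM E1 E2.
have [w ->] := eltP h => Sh.
have [g Dg] := pathI [::] w rep_nil; exists g; rewrite Dg.
have := schreier_telescope w rep_nil; rewrite elt_nil mul1g path_endE ?rep_nil // => ->.
have -> : coset_rep ([::] ++ w) = [::].
  by rewrite -[RHS]rep_nil; apply: rep_eq; rewrite /same_coset elt_nil invg1 mulg1.
by rewrite elt_nil mulg1.
Qed.

End Schreier.

Local Close Scope group_scope.

(** * Stable kernels *)

Local Open Scope group_scope.

Lemma free_rank_drop k n (psi : {multiplicative free k -> free n}) (g0 : free k) :
  g0 <> 1 -> psi g0 = 1 ->
  exists2 d, d < k & exists psi' : {multiplicative free d -> free n},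
    forall h, (exists g, psi g = h) <-> exists g, psi' g = h.
Proof.
move=> g01 psig0; apply: (schreier_rank_drop (S := fun h => exists g, psi g = h)) g01 psig0 => //.
- by exists 1; rewrite mult_morph1.
- by move=> _ _ [g <-] [h <-]; exists (g * h); rewrite gmulfM.
- by move=> _ [g <-]; exists g^-1; rewrite mult_morphV.
- by move=> g; exists g.
Qed.

Lemma iter_morph1 (G : groupType) (f : {multiplicative G -> G}) k : iter k f 1 = 1.
Proof. by elim: k => //= k ->; rewrite mult_morph1. Qed.

(** Generalized to a stable image of a free group of rank d, where d steps suffice: either [phi] is
    injective on the image, or one step leads to an image of smaller rank. *)
Lemma free_kernel_stable n (phi : {multiplicative free n -> free n}) k g :
  iter k phi g = 1 -> iter n phi g = 1.
Proof.
suff main d (psi : {multiplicative free d -> free n}) :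
    (forall g, exists g', psi g' = phi (psi g)) ->
    forall k g, iter k phi (psi g) = 1 -> iter d phi (psi g) = 1.
  by apply: (main n idfun) => h; exists (phi h).
have [b] := ubnP d; elim: b d psi => // b IHb d psi ltdb stab {}k {}g.
case: (pselect (exists2 h, psi h <> 1 & phi (psi h) = 1)) => [[h psih phih]|inj].
  have h1 : h <> 1 by move=> h1; apply: psih; rewrite h1 mult_morph1.
  have [d' ltd' [psi' img]] := @free_rank_drop _ _ (phi \o psi : {multiplicative _ -> _}) h h1 phih.
  have stab' x : exists y, psi' y = phi (psi' x).
    have [y Dy] := (img (psi' x)).2 (ex_intro _ x erefl).
    have [z Dz] := stab y; apply/img; exists z.
    by change (phi (psi z) = phi (psi' x)); rewrite Dz; congr (phi _); exact: Dy.
  case: k => [/= ->|k]; first exact: iter_morph1.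
  have [x Dx] := (img (phi (psi g))).1 (ex_intro _ g erefl).
  rewrite iterSr -Dx => /(IHb d' psi' (leq_trans ltd' ltdb) stab'); rewrite Dx -iterSr => Hg.
  have -> : iter d phi (psi g) = iter (d - d'.+1) phi (iter d'.+1 phi (psi g)).
    by rewrite -iterD subnK.
  by rewrite Hg iter_morph1.
move=> psig.
suff -> : psi g = 1 by exact: iter_morph1.
elim: k g psig => // k IHk g; rewrite iterSr.
have [x Dx] := stab g; rewrite -Dx => /IHk; rewrite Dx => phig.
by apply: contrapT => psig; apply: inj; exists g.
Qed.

(** * Commutation in free groups *)

Lemma elt_commute_gens r (R : word r -> word r -> Prop) :
  (forall i j, commute (generator R i) (generator R j)) ->
  forall g h : presented R, commute g h.
Proof.
move=> com.
have comgen i (h : presented R) : commute (generator R i) h.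
  have [w ->] := eltP h; elim: w => [|[j b] w IHw]; first exact: commute1.
  rewrite elt_cons; apply: commuteM => //; case: b => //; exact: commuteV.
move=> g h; have [w ->] := eltP g; elim: w => [|[j b] w IHw].
  exact/commute_sym/commute1.
rewrite elt_cons; apply/commute_sym/commuteM; last exact: commute_sym.
apply: commute_sym; case: b => //; apply/commute_sym/commuteV/commute_sym; exact: comgen.
Qed.

Lemma free1_commute d (g h : free d) : d < 2 -> commute g h.
Proof.
move=> d2; apply: elt_commute_gens => i j.
have -> : i = j by apply: ord_inj; have := ltn_ord i; have := ltn_ord j; lia.
exact: commute_refl.
Qed.

Lemma free2_image_commute n (psi : {multiplicative free 2 -> free n}) (g0 : free 2) :
  g0 <> 1 -> psi g0 = 1 ->
  exists d, d < 2 /\ exists psi' : {multiplicative free d -> free n},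
    forall g, exists g', psi' g' = psi g.
Proof.
move=> g01 pg0; have [d d2 [psi' img]] := free_rank_drop g01 pg0.
by exists d; split=> //; exists psi' => g; apply/img; exists g.
Qed.

Lemma free2_noncommutative : ~ commute (generator (@no_rel 2) ord0) (generator (@no_rel 2) ord_max).
Proof.
pose w : word 2 := [:: (ord0, false); (ord_max, false); (ord0, true); (ord_max, true)].
move=> com; suff: w = [::] by [].
apply: reduced_magnus_act1 => // phi.
rewrite (@free_magnus_act 2 w [::]) //; apply/elt_ofP.
rewrite /w !elt_cons elt_nil mulg1 mulgA com -mulgA.
by rewrite mulVKg mulgV.
Qed.

(** The map from F_2 with values [u] and [z] kills the commutator of the generators, so the rank of
    its image drops. *)
Lemma commuting_cyclic n (u z : free n) : commute u z ->
  exists d, d < 2 /\ exists psi : {multiplicative free d -> free n},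
    (exists g, psi g = u) /\ (exists g, psi g = z).
Proof.
move=> uz; pose x (i : 'I_2) := if i == ord0 then u else z.
pose y0 := generator (@no_rel 2) ord0; pose y1 := generator (@no_rel 2) ord_max.
have c1 : [~ y0, y1] <> 1.
  by move/eqP/commgP; exact: free2_noncommutative.
have pc : free_lift x [~ y0, y1] = 1.
  have -> : free_lift x [~ y0, y1] = [~ u, z].
    by rewrite /commg /conjg !gmulfM !mult_morphV !free_lift_gen.
  by apply/eqP/commgP.
have [d [d2 [psi img]]] := free2_image_commute c1 pc.
exists d; split=> //; exists psi; split.
  by have [g Dg] := img y0; exists g; rewrite Dg free_lift_gen.
by have [g Dg] := img y1; exists g; rewrite Dg free_lift_gen.
Qed.

(** Map the generators of F_2 to generators of a cyclic group containing u, z and of one containing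
    v, z. The two expressions of [z] give a nontrivial element of the kernel, so u and v lie in a
    common cyclic group. *)
Lemma free_commute_trans n (u v z : free n) : z <> 1 ->
  commute u z -> commute v z -> commute u v.
Proof.
move=> z1 /commuting_cyclic[d [d2 [al [[a Da] [a' Da']]]]].
case/commuting_cyclic=> e [e2 [be [[b Db] [b' Db']]]].
have dim1 k (ga : {multiplicative free k -> free n}) (c : free k) : k < 2 -> ga c = z -> k = 1%N.
  case: k ga c => [|[|k]] // ga c _ gac; case: z1; rewrite -gac.
  have [[|[[]]] //] := eltP c; move=> ->; exact: mult_morph1.
have d1 := dim1 _ _ _ d2 Da'; have e1 := dim1 _ _ _ e2 Db'.
subst d e.
pose i0 := free_lift (fun _ : 'I_1 => generator (@no_rel 2) ord0).
pose i1 := free_lift (fun _ : 'I_1 => generator (@no_rel 2) ord_max).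
(* A retraction onto the first factor, used to see that the kernel element is nontrivial. *)
pose rho := free_lift (fun i : 'I_2 => if i == ord0 then generator (@no_rel 1) ord0 else 1).
pose psi := free_lift (fun i : 'I_2 => if i == ord0 then al (generator _ ord0) else be (generator _ ord0)).
have i0g : i0 (generator _ ord0) = generator _ ord0 by exact: free_lift_gen.
have i1g : i1 (generator _ ord0) = generator _ ord_max by exact: free_lift_gen.
have rho0g : rho (generator _ ord0) = generator _ ord0 by exact: free_lift_gen.
have rho1g : rho (generator _ ord_max) = 1 by exact: free_lift_gen.
have psi0g : psi (generator _ ord0) = al (generator _ ord0) by exact: free_lift_gen.
have psi1g : psi (generator _ ord_max) = be (generator _ ord0) by exact: free_lift_gen.
clearbody i0 i1 rho psi.
have ext (K : groupType) (f f' : free 1 -> K) : {morph f : x y / x * y} -> {morph f' : x y / x * y} ->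
    f (generator _ ord0) = f' (generator _ ord0) -> forall g, f g = f' g.
  move=> fM f'M ff g.
  pose F : {multiplicative free 1 -> K} := HB.pack f (isMultiplicative.Build _ _ f fM).
  pose F' : {multiplicative free 1 -> K} := HB.pack f' (isMultiplicative.Build _ _ f' f'M).
  rewrite -[f g]/(F g) -[f' g]/(F' g); have [w ->] := eltP g; rewrite !free_morph_elt.
  by elim: w => //= -[j c] w ->; rewrite ord1 ff.
have psi0 g : psi (i0 g) = al g.
  by apply: (ext _ (psi \o i0) al) => [x y|x y|] /=; rewrite ?i0g // !gmulfM.
have psi1 g : psi (i1 g) = be g.
  by apply: (ext _ (psi \o i1) be) => [x y|x y|] /=; rewrite ?i1g // !gmulfM.
have rho0 g : rho (i0 g) = g.
  by apply: (ext _ (rho \o i0) id) => [x y|x y|] /=; rewrite ?i0g // !gmulfM.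
have rho1 g : rho (i1 g) = 1.
  by apply: (ext _ (rho \o i1) (fun=> 1)) => [x y|x y|] /=; rewrite ?i1g ?mulg1 // !gmulfM.
have r1 : i0 a' * (i1 b')^-1 <> 1.
  move=> E; apply: z1; rewrite -Da'; have := congr1 rho E.
  by rewrite gmulfM mult_morphV rho0 rho1 mult_morph1 invg1 mulg1 => ->; rewrite mult_morph1.
have pr : psi (i0 a' * (i1 b')^-1) = 1.
  by rewrite gmulfM mult_morphV psi0 psi1 Da' Db' mulgV.
have [d [d2' [ga img]]] := free2_image_commute r1 pr.
have [p Dp] := img (i0 a); have [q Dq] := img (i1 b).
rewrite -Da -Db -psi0 -psi1 -Dp -Dq /commute -!gmulfM.
by rewrite (free1_commute p q d2').
Qed.

(** Over the rationals the kernels of the powers increase, their dimensions cannot rise N + 1 times,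
    and two equal successive kernels stay equal. *)
Lemma mx_kernel_stable N (A : 'M[int]_N) (v : 'rV[int]_N) k :
  (v *m (A ^+ k)%R = 0 -> v *m (A ^+ N)%R = 0)%R.
Proof.
pose f : {rmorphism int -> rat} := intr.
pose Q : 'M[rat]_N := map_mx f A; pose u : 'rV[rat]_N := map_mx f v.
have powE i : (u *m (Q ^+ i)%R = map_mx f (v *m (A ^+ i)%R))%R.
  elim: i => [|i IHi]; first by rewrite !expr0 !mulmx1.
  by rewrite !GRing.exprSr -!mulmxE !mulmxA IHi [RHS]map_mxM.
have f0 i : (v *m (A ^+ i)%R = 0 <-> u *m (Q ^+ i)%R = 0)%R.
  rewrite powE; split=> [->|/rowP z]; first exact: map_mx0.
  by apply/rowP => j; move: (z j); rewrite !mxE => /eqP; rewrite intr_eq0 => /eqP.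
rewrite !f0; pose K i := kermx (Q ^+ i)%R.
have KS i : (K i <= K i.+1)%MS.
  by apply/sub_kermxP; rewrite GRing.exprSr -mulmxE mulmxA mulmx_ker mul0mx.
have [i leiN rk] : exists2 i, i <= N & \rank (K i) = \rank (K i.+1).
  apply: contrapT => none.
  have lt i : i <= N -> \rank (K i) < \rank (K i.+1).
    by move=> lei; rewrite ltn_neqAle mxrankS // andbT; apply/eqP => E; apply: none; exists i.
  have ge i : i <= N.+1 -> i <= \rank (K i).
    by elim: i => // i IHi lei; apply: leq_ltn_trans (lt i lei); apply: IHi; exact: ltnW.
  by have := ge N.+1 (leqnn _); have := rank_leq_row (K N.+1); lia.
have sub : (K i.+1 <= K i)%MS.
  by rewrite -(mxrank_leqif_sup (KS i)) rk.
have stab (w : 'rV[rat]_N) j : (w *m (Q ^+ (i + j))%R = 0 -> w *m (Q ^+ i)%R = 0)%R.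
  elim: j w => [|j IHj] w; first by rewrite addn0.
  rewrite addnS -addSn addnC exprD -mulmxE mulmxA => /sub_kermxP wK.
  have /sub_kermxP := submx_trans wK sub.
  by rewrite -mulmxA mulmxE -exprD addnC; exact: IHj.
move=> uk; have ui : (u *m (Q ^+ i)%R = 0)%R.
  by apply: (stab u k); rewrite addnC exprD -mulmxE mulmxA uk mul0mx.
have -> : (Q ^+ N = Q ^+ i *m Q ^+ (N - i))%R by rewrite mulmxE -exprD subnKC.
by rewrite mulmxA ui mul0mx.
Qed.

Section AbelianImage.
Variables (r : nat) (R : word r -> word r -> Prop) (balR : balanced R) (K : groupType).
Variable (f : {multiplicative (presented R : groupType) -> K}).
Hypothesis com : forall i j, commute (f (generator R i)) (f (generator R j)).

(** When its exponent sum is 0, the first letter has an opposite occurrence, with which it cancels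
    in the commutative image. *)
Lemma abelian_image_kernel g : abelG g = 0%R -> f g = 1.
Proof.
have [w ->] := eltP g; rewrite (abelG_elt balR).
have [b] := ubnP (size w); elim: b w => // b IHb [|[i c] w] ltw ab.
  by rewrite elt_nil mult_morph1.
have mem : (i, ~~ c) \in w.
  apply: contraT => nmem.
  have : expsum i ((i, c) :: w) = ((-1) ^+ c * (1 + count (fun a => a.1 == i) w)%N%:Z)%R.
    rewrite /expsum big_cons eqxx PoszD mulrDr mulr1; congr (_ + _)%R.
    elim: w nmem {ltw ab} => [|[j d] w IHw]; first by rewrite big_nil mulr0.
    rewrite inE negb_or => /andP[ne /IHw Dw]; rewrite big_cons Dw /= PoszD mulrDr; congr (_ + _)%R.
    case: (j =P i) ne => [->|_ _]; last by rewrite mulr0.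
    by rewrite mulr1; case: (c) (d) => [] [] //; rewrite eqxx.
  have -> : expsum i ((i, c) :: w) = 0%R by move/rowP/(_ i): ab; rewrite !mxE.
  by move/esym/eqP; rewrite mulf_eq0 signr_eq0 /=; lia.
case/splitPr: mem ltw ab => u v ltw ab.
have comf (h : presented R) : commute (f (elt_of R [:: (i, c)])) (f h).
  have [t ->] := eltP h.
  have comi j : commute (f (generator R j)) (f (elt_of R [:: (i, c)])).
    rewrite elt_cons elt_nil mulg1; case: c {ltw ab} => //.
    by rewrite mult_morphV; exact: commuteV.
  elim: t => [|[j d] t IHt]; first by rewrite elt_nil mult_morph1; exact: commute1.
  rewrite [elt_of R (_ :: t)]elt_cons gmulfM; apply: commuteM => //; apply: commute_sym.
  case: d; last exact: comi.
  by rewrite mult_morphV; apply/commute_sym/commuteV/commute_sym.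
have inv1 : elt_of R [:: (i, ~~ c)] = (elt_of R [:: (i, c)])^-1 :> presented R.
  by rewrite -elt_inv.
have Dw : (i, c) :: u ++ (i, ~~ c) :: v = [:: (i, c)] ++ u ++ [:: (i, ~~ c)] ++ v by [].
rewrite Dw in ltw ab *; rewrite !elt_cat inv1 !gmulfM mult_morphV !mulgA comf.
rewrite -[_ * _ / _]mulgA mulgV mulg1 -gmulfM -elt_cat.
apply: IHb; first by move: ltw; rewrite !size_cat /=; lia.
move: ab; rewrite !abel_cat.
have -> : abel [:: (i, ~~ c)] = (- abel [:: (i, c)])%R :> 'rV_r.
  by apply/rowP => j; rewrite !mxE /expsum !big_seq1 /=; case: eqP; case: (c); rewrite ?oppr0 ?opprK.
by move=> <-; rewrite [in RHS]addrCA (addrA (abel [:: (i, c)])) subrr add0r.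
Qed.
End AbelianImage.

(** * Kernels of the powers of an endomorphism of F_n x Z^m *)

Section Kernel.
Variables n m : nat.
Local Notation N := (n + m)%N.
Local Notation G := (presented (@FZ_rel n m) : groupType).
Local Notation elt := (elt_of (@FZ_rel n m) : word N -> G).
Local Notation gen := (generator (@FZ_rel n m)).
Implicit Types (w u v : word N) (g h : G) (Phi : {multiplicative G -> G}).

Lemma t_gen_central (j : 'I_m) h : commute (gen (rshift n j)) h.
Proof.
have [w ->] := eltP h; elim: w => [|[k b] w IHw]; first exact: commute1.
rewrite elt_cons; apply: commuteM => //.
suff com : commute (gen (rshift n j)) (gen k) by case: b => //; exact: commuteV.
case: (eqVneq (rshift n j) k) => [->|njk]; first exact: commute_refl.
apply: gen_commute; rewrite /letter_class /=; apply: contraNneq njk => E.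
by apply/eqP/ord_inj => /=; move: E; have := ltn_ord j; lia.
Qed.

Definition x_image (k : 'I_N) : free n := if split k is inl i then generator _ i else 1.
Definition t_image (k : 'I_N) : free m := if split k is inr j then generator _ j else 1.

Lemma image_cases k :
  (exists i, [/\ k = lshift m i, x_image k = generator _ i & t_image k = 1]) \/
  (exists j, [/\ k = rshift n j, x_image k = 1 & t_image k = generator _ j]).
Proof.
rewrite -(splitK k) /x_image /t_image unsplitK; case: (split k) => i; [left|right];
  by exists i.
Qed.

Definition x_proj_fun (g : G) : free n := word_eval x_image (word_of g).

Lemma x_proj_elt w : x_proj_fun (elt w) = word_eval x_image w.
Proof.
apply: word_eval_pres (word_of_elt _ _) => _ _ [i j|i k] /=;
  by rewrite /x_image ?(unsplitK (inl _)) ?(unsplitK (inr _)) !mul1g ?mulg1.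
Qed.

Fact x_proj_mul : {morph x_proj_fun : g h / g * h}.
Proof.
by move=> g h; rewrite -(word_ofK g) -(word_ofK h) -elt_cat !x_proj_elt word_eval_cat.
Qed.

Definition x_proj : {multiplicative G -> free n} :=
  HB.pack x_proj_fun (isMultiplicative.Build _ _ x_proj_fun x_proj_mul).

Definition x_incl : {multiplicative free n -> G} := free_lift (fun i => gen (lshift m i)).
Definition t_incl : {multiplicative free m -> G} := free_lift (fun j => gen (rshift n j)).

Lemma x_proj_gen k : x_proj (gen k) = x_image k.
Proof. by rewrite -[LHS]/(x_proj_fun (gen k)) x_proj_elt /= mulg1. Qed.

Lemma t_incl_central (g : free m) h : commute (t_incl g) h.
Proof.
have [w ->] := eltP g; rewrite free_morph_elt.
have -> : (fun j => t_incl (generator _ j)) = (fun j => gen (rshift n j)).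
  by apply: funext => j; exact: free_lift_gen.
elim: w => [|[j b] w IHw] /=; first exact/commute_sym/commute1.
apply/commute_sym/commuteM; last exact/commute_sym.
case: b; last by apply: commute_sym; exact: t_gen_central.
by apply: commuteV; apply: commute_sym; exact: t_gen_central.
Qed.

Lemma FZ_split w : elt w = x_incl (word_eval x_image w) * t_incl (word_eval t_image w).
Proof.
have Ex i : x_incl (generator _ i) = gen (lshift m i) by exact: free_lift_gen.
have Et j : t_incl (generator _ j) = gen (rshift n j) by exact: free_lift_gen.
elim: w => [|[k b] w IHw]; first by rewrite elt_nil [x_incl _]mult_morph1 [t_incl _]mult_morph1 mulg1.
have cons (K : groupType) (y : 'I_N -> K) :
    word_eval y ((k, b) :: w) = (if b then (y k)^-1 else y k) * word_eval y w by [].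
rewrite elt_cons IHw !cons !gmulfM.
have [[i [Dk -> ->]]|[j [Dk -> ->]]] := image_cases k.
- have -> : t_incl (if b then 1^-1 else 1) = 1 by case: (b); rewrite ?invg1 mult_morph1.
  rewrite mul1g mulgA; congr (_ * _ * _); rewrite Dk -Ex.
  by case: (b); rewrite ?mult_morphV.
have -> : x_incl (if b then 1^-1 else 1) = 1 by case: (b); rewrite ?invg1 mult_morph1.
have -> : (if b then (gen k)^-1 else gen k) = t_incl (if b then (generator _ j)^-1 else generator _ j).
  by rewrite Dk -Et; case: (b); rewrite ?mult_morphV.
by rewrite mul1g !mulgA t_incl_central.
Qed.

Lemma x_proj_commute g h : commute (x_proj g) (x_proj h) -> commute g h.
Proof.
have [u ->] := eltP g; have [v ->] := eltP h.
rewrite -![x_proj _]/(x_proj_fun _) !x_proj_elt => uv.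
rewrite (FZ_split u) (FZ_split v); apply: commuteM; last first.
  by apply: commute_sym; exact: t_incl_central.
apply: commute_sym; apply: commuteM; last by apply: commute_sym; exact: t_incl_central.
by rewrite /commute -!gmulfM uv.
Qed.

Lemma x_proj_abel_inj g : x_proj g = 1 -> abelG g = 0%R -> g = 1.
Proof.
have [w ->] := eltP g; rewrite -[x_proj _]/(x_proj_fun _) x_proj_elt => Dw ab.
rewrite FZ_split Dw [x_incl _]mult_morph1 mul1g.
apply: abelian_image_kernel; first exact: free_balanced.
  by move=> i j; exact: t_incl_central.
have -> : word_eval t_image w = free_lift t_image (elt_of (@no_rel N) w) by rewrite -free_lift_elt.
rewrite (abelG_act (@free_balanced N) (@free_balanced m)) (abelG_elt (@free_balanced N)).
by move: ab; rewrite (abelG_elt (@FZ_balanced n m)) => ->; rewrite mul0mx.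
Qed.

(** If every Phi(t_j) has trivial free part, [Phi] induces an endomorphism of F_n: n steps
    trivialize the free part and N more the exponent sums. Otherwise the image of [Phi] centralizes
    an element with nontrivial free part, so it is abelian; after N steps the exponent sums vanish
    and one more application gives 1. *)
Lemma FZ_kernel_stable Phi k g : iter k Phi g = 1 -> iter (N + n + 1) Phi g = 1.
Proof.
move=> kg.
have abN h j : iter j Phi h = 1 -> abelG (iter N Phi h) = 0%R.
  move=> jh; have bal := @FZ_balanced n m.
  rewrite (abelG_iter bal); apply: (@mx_kernel_stable _ _ _ j).
  by rewrite -(abelG_iter bal) jh abelG1.
case: (pselect (forall j : 'I_m, x_proj (Phi (gen (rshift n j))) = 1)) => [typeI|typeII].
  pose phi := free_lift (fun i : 'I_n => x_proj (Phi (gen (lshift m i)))).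
  have phiP h : x_proj (Phi h) = phi (x_proj h).
    have [w ->] := eltP h; elim: w => [|[k' b] w IHw].
      by rewrite elt_nil !mult_morph1.
    rewrite elt_cons !gmulfM IHw; congr (_ * _).
    have genE : x_proj (Phi (gen k')) = phi (x_proj (gen k')).
      rewrite x_proj_gen; have [[j [Dk -> _]]|[j [Dk -> _]]] := image_cases k'; rewrite Dk.
        by rewrite [RHS]free_lift_gen.
      by rewrite typeI [RHS]mult_morph1.
    by case: b; rewrite // !mult_morphV genE.
  have phi_iter j h : x_proj (iter j Phi h) = iter j phi (x_proj h).
    by elim: j => [|j IHj] //; rewrite !iterS phiP IHj.
  have pn : x_proj (iter n Phi g) = 1.
    rewrite phi_iter; apply: (@free_kernel_stable n phi k).
    by rewrite -phi_iter kg mult_morph1.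
  have pN : x_proj (iter N Phi (iter n Phi g)) = 1 by rewrite phi_iter pn iter_morph1.
  have E : iter N Phi (iter n Phi g) = 1.
    apply: x_proj_abel_inj pN (abN (iter n Phi g) k _).
    by rewrite -iterD [(k + n)%N]addnC iterD kg iter_morph1.
  have -> : (N + n + 1 = 1 + (N + n))%N by rewrite addnC.
  by rewrite iterD (iterD N n) E iter_morph1.
have [j0 tj0] : exists j : 'I_m, x_proj (Phi (gen (rshift n j))) <> 1.
  by apply: contrapT => none; apply: typeII => j; apply: contrapT => H; apply: none; exists j.
have com h h' : commute (Phi h) (Phi h').
  apply: x_proj_commute; apply: (free_commute_trans tj0).
    by rewrite /commute -!gmulfM (t_gen_central j0 h).
  by rewrite /commute -!gmulfM (t_gen_central j0 h').
have -> : (N + n + 1 = n + (1 + N))%N by lia.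
rewrite iterD iterD /= (abelian_image_kernel (@FZ_balanced n m)) ?iter_morph1 //.
exact: abN kg.
Qed.

End Kernel.

Local Close Scope group_scope.

(** * The bound *)

Section Bound.
Variables n m : nat.
Local Notation N := (n + m)%N.
Local Notation G := (presented (@FZ_rel n m) : groupType).
Local Notation elt := (elt_of (@FZ_rel n m) : word N -> G).

Section Hit.
Variables (Phi : {multiplicative G -> G}) (ws : 'I_N -> word N).
Hypothesis wsP : forall i, elt (ws i) = Phi (elt [:: (i, false)]).

Lemma elt_subst w : elt (subst ws w) = Phi (elt w).
Proof.
elim: w => [|[i b] w IHw]; first by rewrite [RHS]mult_morph1.
rewrite /subst /= elt_cat -/(subst ws w) IHw elt_cons gmulfM; congr (_ * _)%g.
by case: b; rewrite ?elt_inv wsP ?mult_morphV.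
Qed.

Lemma elt_iter_subst k w : elt (iter k (subst ws) w) = iter k Phi (elt w).
Proof. by elim: k => //= k IHk; rewrite elt_subst IHk. Qed.

Lemma size_subst a w : (forall i, size (ws i) <= a) -> size (subst ws w) <= size w * a.+1.
Proof.
move=> wsa; elim: w => //= -[i b] w IHw; rewrite /subst /= size_cat mulSn leq_add //.
by case: b; rewrite ?size_rev ?size_map; exact: leqW.
Qed.

Lemma size_iter_subst a k w : (forall i, size (ws i) <= a) ->
  size (iter k (subst ws) w) <= size w * a.+1 ^ k.
Proof.
move=> wsa; elim: k => [|k IHk]; first by rewrite muln1.
by rewrite /= expnSr mulnA (leq_trans (size_subst _ wsa)) // leq_mul2r IHk orbT.
Qed.

Lemma periodic_hit (x y : G) M k : (0 < M)%N -> iter M Phi y = y -> iter k Phi x = y ->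
  exists2 j, (j < N + n + 1 + M)%N & iter j Phi x = y.
Proof.
move=> M0 My kx; set L := (N + n + 1)%N.
case: (ltnP k (L + M)%N) => [ltk|lek]; first by exists k.
pose j := ((k - L) %% M)%N; exists (j + L)%N.
  by rewrite addnC ltn_add2l ltn_mod.
have iterM q : iter (q * M) Phi y = y by elim: q => // q IHq; rewrite mulSn iterD IHq.
(* The point of the cycle of [y] that L steps send to [y]. *)
pose y' := iter (L * M - L) Phi y.
have Dy : iter L Phi y' = y by rewrite -iterD subnKC ?iterM // leq_pmulr.
pose g := (iter j Phi x * y'^-1)%g.
have iterF i (u v : G) : iter i Phi (u * v^-1)%g = (iter i Phi u * (iter i Phi v)^-1)%g.
  by rewrite -[iter i Phi _]/(iter_morph Phi i _) gmulfM mult_morphV.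
have gL : iter L Phi g = 1%g.
  apply: (@FZ_kernel_stable n m Phi ((k - L) %/ M * M + L)).
  rewrite iterF [X in (_ * X^-1)%g]iterD Dy iterM -iterD.
  have -> : ((k - L) %/ M * M + L + j = k)%N.
    by rewrite /j addnAC -divn_eq subnK // (leq_trans _ lek) // leq_addr.
  by rewrite kx mulgV.
move: gL; rewrite iterF Dy -iterD [(L + j)%N]addnC => /eqP.
by rewrite divg_eq1 => /eqP.
Qed.

(** Exceeds the total length of words for (y)Phi^M and y, as [polyfun_separation] requires. *)
Definition level (a Y : nat) : nat := (Y * a.+1 ^ idem_exp 5 N + Y).+1.
(** Coordinates at level c of a word of length l are at most c^l; the exponent covers all words met
    within [orbit_range] steps. *)
Definition size_bound (a X Y : nat) : nat :=
  level a Y ^ ((X + Y) * a.+1 ^ orbit_range (coord_dim n m (level a Y))).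
Definition hit_bound (a X Y : nat) : nat :=
  (N + n + 1 + idem_exp 5 N + orbit_bound (coord_dim n m (level a Y)) (size_bound a X Y))%N.

Lemma bounded_orbit_hit a X Y x y k :
  (forall i, size (ws i) <= a) -> (size x <= X)%N -> (size y <= Y)%N ->
  iter k Phi (elt x) = elt y ->
  exists2 j, (j < hit_bound a X Y)%N & iter j Phi (elt x) = elt y.
Proof.
move=> wsa xX yY kxy; pose M := idem_exp 5 N.
case: (pselect (iter M Phi (elt y) = elt y)) => [My|nMy].
  have [|j ltj jxy] := periodic_hit _ My kxy; first exact: fact_gt0.
  by exists j => //; apply: leq_trans ltj _; rewrite /hit_bound leq_addr.
(* A larger [k] would make y periodic, hence fixed by Phi^M, at a level that separates y from
   (y)Phi^M. *)
exists k => //; rewrite /hit_bound; set c := level a Y; set r := size_bound a X Y.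
rewrite ltnNge; apply/negP => lek; apply: nMy.
have c0 : (0 < c)%N by [].
have a0 : (0 < a.+1)%N by [].
have sizei z i : (size z <= X + Y)%N -> (i <= orbit_range (coord_dim n m c))%N ->
    (size (iter i (subst ws) z) <= (X + Y) * a.+1 ^ orbit_range (coord_dim n m c))%N.
  move=> zXY lei; apply: leq_trans (size_iter_subst i z wsa) _.
  by rewrite leq_mul // leq_pexp2l.
have ri z i j : (size z <= X + Y)%N -> (i <= orbit_range (coord_dim n m c))%N ->
    (`|(coords c (elt z) *m (act_mx c Phi) ^+ i) 0%R j| <= r%:Z)%R.
  move=> zXY lei; rewrite -coords_iter -elt_iter_subst.
  apply: le_trans (coords_bound _ _) _; rewrite lez_nat /r /size_bound -/c.
  by rewrite leq_pexp2l //; exact: sizei.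
have [e e0 We] : exists2 e, (0 < e)%N &
    (coords c (elt y) *m act_mx c Phi ^+ e)%R = coords c (elt y).
  apply: (@bounded_hit _ (act_mx c Phi) (coords c (elt x)) _ r k).
  - by rewrite expn_gt0.
  - by move=> i j lei; apply: ri => //; apply: leq_trans xX _; rewrite leq_addr.
  - by move=> i j lei; apply: ri => //; apply: leq_trans yY _; rewrite leq_addl.
  - by rewrite -coords_iter kxy.
  - by apply: leq_trans lek; rewrite leq_addl.
have per : forall f : G -> int, polyfun 0 c f -> f (iter M Phi (elt y)) = f (elt y).
  by apply: (uniform_period e0); apply/coords_eqP; rewrite coords_iter.
apply: contrapT => ne; rewrite -elt_iter_subst in ne per.
have [f pf] := polyfun_separation ne; apply/negP; rewrite negbK; apply/eqP/per.
apply: polyfun_leq pf; rewrite /c /level ltnS leq_add //.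
by apply: leq_trans (size_iter_subst M y wsa) _; rewrite leq_mul2r yY orbT.
Qed.

End Hit.

Lemma computable_coord_dim k (F : k.-tuple nat -> nat) :
  computable F -> computable (fun v => coord_dim n m (F v)).
Proof.
move=> cF.
have cI := computable_iter (g := fun d _ => (1 + N * d)%N) cF (computable0 _) _.
apply: computable_ext (cI _) => [v|].
  by elim: (F v) => // c IHc; rewrite iterS IHc coord_dimS.
apply: computable_add; first exact: computable_const.
by apply: computable_mul; [exact: computable_const | exact: computable_thead].
Qed.

Lemma computable_idem_exp k b (F : k.-tuple nat -> nat) :
  computable F -> computable (fun v => idem_exp b (F v)).
Proof.
move=> cF; apply/computable_fact/computable_exp; first exact: computable_const.
exact: computable_mul.
Qed.

Lemma computable_hit_bound k (A X Y : k.-tuple nat -> nat) :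
  computable A -> computable X -> computable Y ->
  computable (fun v => hit_bound (A v) (X v) (Y v)).
Proof.
move=> cA cX cY.
have cc b : computable (fun _ : k.-tuple nat => b) by exact: computable_const.
have clev : computable (fun v => level (A v) (Y v)).
  apply/computableS/computable_add => //; apply: computable_mul => //.
  by apply: computable_exp => //; exact: computableS.
have cD := computable_coord_dim clev.
have ce := computable_idem_exp 7 cD.
have cr : computable (fun v => size_bound (A v) (X v) (Y v)).
  apply: computable_exp => //; apply: computable_mul; first exact: computable_add.
  apply: computable_exp; first exact: computableS.
  apply: computable_add => //; apply: computable_add => //.
  by apply: computable_mul => //; apply: computable_mul.
apply: computable_add => //; apply: computable_mul => //.
apply: computable_add; first apply: computable_add.
- exact: computable_add.
- by apply: computable_mul => //; apply: computable_exp => //; exact: computableS.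
apply: computable_mul => //; apply: computable_mul => //; apply: computable_mul => //.
by apply: computable_mul; [exact: computable_fact | exact: computable_exp].
Qed.

End Bound.

Theorem theorem2p7 (n m : nat) :
  exists f : recfun 3,
    forall (Phi : {multiplicative FZ n m -> FZ n m})
           (ws : (n + m).-tuple (word (n + m))) (x y : word (n + m)),
      represents ws Phi ->
      exists2 b : bool,
        b <-> (exists k : nat, iter k Phi (FZ_elt x) = FZ_elt y)
        & computes f [tuple code_words ws; code_word x; code_word y] b.
Proof.
(* Codes replace lengths: the code of a word is at least its length, and the code of a list exceeds
   the codes of its entries. *)
pose K (v : 3.-tuple nat) := hit_bound n m (tnth v ord0) (tnth v (inord 1)) (tnth v (inord 2)).
have [f fP] : computable (fun v => has (fun k =>
     same_code n m (iter k (subst_code (tnth v ord0)) (tnth v (inord 1))) (tnth v (inord 2)))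
     (iota 0 (K v)) : nat).
  by apply: computable_hit; apply: computable_hit_bound; exact: computable_proj.
exists f => Phi ws x y wsP; have := fP [tuple code_words ws; code_word x; code_word y].
set v := [tuple _; _; _]; set b := has _ _ => fb; exists b => //.
have v0 : tnth v ord0 = code_words ws by [].
have v1 : tnth v (inord 1) = code_word x by rewrite (tnth_nth 0) inordK.
have v2 : tnth v (inord 2) = code_word y by rewrite (tnth_nth 0) inordK.
have sizeW (w : word (n + m)) : size w <= code_word w.
  by rewrite -(size_map (@code_letter _) w) size_code.
have hitE k : same_code n m (iter k (subst_code (tnth v ord0)) (tnth v (inord 1))) (tnth v (inord 2))
    <-> iter k Phi (FZ_elt x) = FZ_elt y.
  rewrite v0 v1 v2.
  have -> : iter k (subst_code (code_words ws)) (code_word x) =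
      code_word (iter k (subst (tnth ws)) x).
    by elim: k => //= k ->; rewrite subst_codeE.
  have -> : iter k Phi (FZ_elt x) = FZ_elt (iter k (subst (tnth ws)) x).
    by rewrite /FZ_elt (elt_iter_subst wsP).
  rewrite /same_code.
  rewrite (eq_all (a2 := fun j => reduce_rev (fun a => letter_class n a == j) (iter k (subst (tnth ws)) x)
     == reduce_rev (fun a => letter_class n a == j) y)); last first.
    by move=> j; rewrite !reduce_codeE (inj_eq (@code_word_inj _)).
  by split=> [/FZ_eqP|/FZ_eqP].
split=> [/hasP[k _ /hitE]|[k kxy]]; first by exists k.
have [j ltj jxy] : exists2 j, j < hit_bound n m (code_words ws) (code_word x) (code_word y) &
    iter j Phi (FZ_elt x) = FZ_elt y.
  apply: (bounded_orbit_hit wsP _ (sizeW x) (sizeW y) kxy) => i.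
  apply: leq_trans (sizeW _) _; apply: ltnW; rewrite /code_words.
  have /allP := CodeSeq.ltn_code [seq code_word w | w <- ws]; apply.
  by apply: map_f; exact: mem_tnth.
by apply/hasP; exists j; [rewrite mem_iota /K v0 v1 v2 | apply/hitE].
Qed.
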